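(* Let $f$ be a non-constant meromorphic function on $\mathbb{C}$, let $c\in\mathbb{C}$, $\delta<1$ and $\varepsilon>0$. Then there is a set $E\subset(0,\infty)$ of finite logarithmic measure, i.e. $\int_E\frac{dr}{r}<\infty$, such that $$m\left(r,\frac{f(z+c)}{f(z)}\right)= o\left(\frac{T(r+|c|,f)^{1+\varepsilon}}{r^\delta}\right)$$ as $r\to\infty$ with $r\notin E$.
   Context: Meromorphic means meromorphic in the whole complex plane. $m(r,g)=\frac{1}{2\pi}\int_0^{2\pi}\log^{+}|g(re^{i\theta})|\,d\theta$ is the Nevanlinna proximity function, where $\log^+x=\max\{\log x,0\}$, and $T(r,g)=m(r,g)+N(r,g)$ is the Nevanlinna characteristic function of a meromorphic function $g$, with $N(r,g)$ the integrated counting function of poles. $m\left(r,\frac{f(z+c)}{f(z)}\right)$ denotes the proximity function of the meromorphic function $z\mapsto f(z+c)/f(z)$. *)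

(* Defs.v *)
From HB Require Import structures.
From mathcomp Require Import all_boot all_order all_algebra.
From mathcomp Require Import complex.
From mathcomp Require Import all_classical all_reals all_analysis.

Set Implicit Arguments.
Unset Strict Implicit.
Unset Printing Implicit Defensive.

Import Order.TTheory GRing.Theory Num.Theory.
Import numFieldNormedType.Exports.
Import ComplexField.Normc.

Local Open Scope classical_set_scope.
Local Open Scope complex_scope.
Local Open Scope ring_scope.

(* Complex differentiability is [derivable] over the scalar field [R[i]], along
   the direction 1; the topology of the plane is that of [R[i]^o]. *)
Definition holomorphic_at (R : realType) (f : R[i] -> R[i]) (z : R[i]) : Prop :=
  \forall w \near (z : R[i]^o), derivable (f : R[i]^o -> R[i]^o) w 1.

Definition pole_of_order (R : realType) (f : R[i] -> R[i]) (z : R[i]) (k : nat)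
    : Prop :=
  (0 < k)%N /\
  exists g : R[i] -> R[i],
    [/\ holomorphic_at g z, g z != 0 &
        \forall w \near (z : R[i]^o)^', f w = g w / (w - z) ^+ k].

(* A meromorphic function is represented by a total function; its value at a
   pole is arbitrary and carries no meaning.  Removable singularities are
   excluded, so a constant meromorphic function is one whose representative is
   literally constant. *)
Definition meromorphic (R : realType) (f : R[i] -> R[i]) : Prop :=
  forall z, holomorphic_at f z \/ exists k, pole_of_order f z k.

(* The multiplicity of z as a pole of f, and 0 if z is not a pole. *)
Definition pole_mult (R : realType) (f : R[i] -> R[i]) (z : R[i]) : nat :=
  xget 0%N [set k | pole_of_order f z k].

Definition pole_count (R : realType) (f : R[i] -> R[i]) (t : R) : R :=
  \sum_(z \in [set z : R[i] | normc z <= t]) ((pole_mult f z)%:R : R).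

(* N(r,f) = \int_0^r (n(t,f) - n(0,f)) / t dt + n(0,f) log r *)
Definition integrated_count (R : realType) (r : R) (f : R[i] -> R[i]) : R :=
  \int[lebesgue_measure]_(t in `]0, r])
     ((pole_count f t - pole_count f 0) / t)
  + pole_count f 0 * ln r.

(* [ln] is 0 on nonpositive reals, so that log^+ 0 = 0 as it should be. *)
Definition logp (R : realType) (x : R) : R := Num.max (ln x) 0.

Definition proximity (R : realType) (r : R) (g : R[i] -> R[i]) : R :=
  (2 * pi)^-1 *
  \int[lebesgue_measure]_(t in `[0, 2 * pi])
     logp (normc (g ((r * cos t) +i* (r * sin t)))).

Definition characteristic (R : realType) (r : R) (g : R[i] -> R[i]) : R :=
  proximity r g + integrated_count r g.

Definition finite_log_measure (R : realType) (E : set R) : Prop :=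
  measurable E /\ (\int[lebesgue_measure]_(r in E) (r^-1)%:E < +oo)%E.

(* The filter of r -> +oo with r outside E. *)
Definition infty_off (R : realType) (E : set R) : filter_on R :=
  FilterType (within (~` E) (pinfty_nbhs R)) _.

(* Main.v *)
Require Import Defs.
From mathcomp Require Import all_boot all_order all_algebra.
From mathcomp Require Import complex.
From mathcomp Require Import all_classical all_reals all_analysis measurable_realfun.
From mathcomp Require Import ring lra.

Set Implicit Arguments.
Unset Strict Implicit.
Unset Printing Implicit Defensive.

Import Order.TTheory GRing.Theory Num.Theory.
Import numFieldNormedType.Exports.
Import ComplexField.Normc.

Local Open Scope classical_set_scope.
Local Open Scope complex_scope.
Local Open Scope ring_scope.

Local Notation Re := (@complex.Re _).
Local Notation Im := (@complex.Im _).

(* Write [f = g / Q] on a disc of radius [rho], where [Q] vanishes exactly at the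
   poles, and approximate [g] uniformly by polynomials; this reduces every formula
   of Nevanlinna theory that is needed to rational functions, for which the
   Poisson-Jensen formula splits into one identity per zero or pole.  Subtracting
   this formula at [z] from the one at [z + c] bounds [log |f(z+c)/f(z)|] by the
   mean of [|log |f||] and by differences of Green functions.  A power
   [|z - a|^(-d)], [0 < d < 1], absorbs the logarithmic singularities, and the
   mean of that power over [|z| = r] is at most [C r^(-d)] for every [a].  By
   Fatou's lemma, [m(r, f(z+c)/f) <= K eta^(-4) r^(-d) (T(rho, f) + K)] whenever
   [rho - r - |c| >= eta rho] and no pole lies on [|z| = rho].  Borel's growth
   lemma then provides, outside a set of finite logarithmic measure, such a [rho]
   with [T(rho, f) <= 2 T(r + |c|, f)] and [eta^(-4)] at most a constant times
   [T(r + |c|, f)^epsilon]. *)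

(** The zeros of [f] are never listed. Each approximant has zeros of its own, and their number may
    grow without control as the approximation improves. What stays bounded is their sum weighted by
    [1 - |a|^2 / rho^2], by the Poisson-Jensen formula at one fixed point [z0] with [f z0 != 0]. The
    poles need no larger circle for the same reason: a pole [b] contributes [ln (rho / |b|)] to
    [N(rho, f)], which vanishes to first order on the circle, as the weight does. Differences of
    Green functions must therefore be bounded with the weight as a factor. For [a] close to the
    circle this costs [eta^(-4)], since [|z - a|] and [|z + c - a|] enter squared and are only known
    to exceed [eta rho / 2]. In Borel's lemma the relative gap at height [2^n] is
    [2^(-n epsilon / 4)]: the gaps are summable, and the fourth power of their inverse costs
    [T^epsilon]. The radii [r] with a pole on [|z| = r + |c|] are countable and go into [E]. The
    exponent [d] is taken strictly between [delta] and 1, and the spare power of [r] turns a bound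
    into [o]. *)

Section ComplexModulus.
Context {R : realType}.
Implicit Types x y z w : R[i].

Lemma normc_ge0 z : 0 <= normc z.
Proof. by case: z => a b; rewrite sqrtr_ge0. Qed.

Lemma normC_normc z : `|z| = (normc z)%:C.
Proof. by case: z => a b; rewrite normc_def. Qed.

Lemma normcD_le z w : normc (z + w) <= normc z + normc w.
Proof. exact: (@le_normcD R z w). Qed.

Lemma normc_opp z : normc (- z) = normc z.
Proof. exact: (@normcN R z). Qed.

Lemma normcB_le z w : normc (z - w) <= normc z + normc w.
Proof. by rewrite -(normc_opp w) normcD_le. Qed.

Lemma normcBC z w : normc (z - w) = normc (w - z).
Proof. by rewrite -normc_opp opprB. Qed.

Lemma normc_eq0 z : (normc z == 0) = (z == 0).
Proof.
apply/eqP/eqP => [/eq0_normc//|->].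
exact: normc0.
Qed.

Lemma normc_gt0 z : (0 < normc z) = (z != 0).
Proof. by rewrite lt0r normc_eq0 normc_ge0 andbT. Qed.

Lemma normc_real (a : R) : normc a%:C = `|a|.
Proof. by rewrite /= expr0n addr0 sqrtr_sqr. Qed.

Lemma sqr_normc_ReIm z : normc z ^+ 2 = Re z ^+ 2 + Im z ^+ 2.
Proof. by case: z => a b; rewrite sqr_sqrtr// addr_ge0 ?sqr_ge0. Qed.

Lemma normc_i : normc ('i : R[i]) = 1.
Proof. by rewrite /normc /= expr0n expr1n add0r sqrtr1. Qed.

Lemma normcX z n : normc (z ^+ n) = normc z ^+ n.
Proof.
elim: n => [|n IH]; first by rewrite !expr0 normc1.
by rewrite !exprS normcM IH.
Qed.

Lemma normc_conj z : normc z^* = normc z.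
Proof. by case: z => a b /=; rewrite sqrrN. Qed.

Lemma mul_conjc z : z * z^* = (normc z ^+ 2)%:C.
Proof. by rewrite -sqr_normc normC_normc rmorphXn. Qed.

Lemma Re_le_normc z : `|Re z| <= normc z.
Proof. by rewrite -lecR -normC_normc normc_ge_Re. Qed.

Lemma Im_le_normc z : `|Im z| <= normc z.
Proof.
rewrite -(@ler_pXn2r _ 2)// ?nnegrE ?normc_ge0//.
by rewrite real_normK ?num_real// sqr_normc_ReIm lerDr sqr_ge0.
Qed.

Lemma normc_le_ReIm z : normc z <= `|Re z| + `|Im z|.
Proof.
rewrite [z in normc z]complexE; apply: le_trans (normcD_le _ _) _.
by rewrite normcM !normc_real /= expr0n expr1n add0r sqrtr1 mul1r.
Qed.

Lemma ReDc z w : Re (z + w) = Re z + Re w. Proof. by case: z; case: w. Qed.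
Lemma ImDc z w : Im (z + w) = Im z + Im w. Proof. by case: z; case: w. Qed.
Lemma ReNc z : Re (- z) = - Re z. Proof. by case: z. Qed.
Lemma ImNc z : Im (- z) = - Im z. Proof. by case: z. Qed.
Lemma ReMc z w : Re (z * w) = Re z * Re w - Im z * Im w.
Proof. by case: z; case: w. Qed.
Lemma ImMc z w : Im (z * w) = Re z * Im w + Im z * Re w.
Proof. by case: z => a b; case: w => c d /=; rewrite [b * c]mulrC. Qed.

Lemma eq_ReIm z w : Re z = Re w -> Im z = Im w -> z = w.
Proof. by case: z; case: w => a b c d /= -> ->. Qed.

Lemma normc_sub_ge z w : normc z - normc w <= normc (z - w).
Proof. by rewrite lerBlDr -{1}(subrK w z) normcD_le. Qed.

Lemma dist_normc z w : `|normc z - normc w| <= normc (z - w).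
Proof. by rewrite ler_norml normc_sub_ge andbT lerNl opprB normcBC normc_sub_ge. Qed.

End ComplexModulus.

(** * Complex differentiability as a first-order expansion *)

Section Differentiability.
Context {R : realType}.
Implicit Types (f g : R[i] -> R[i]) (z w : R[i]).

(** The expansion is stated with real [e] and [eta] and without division, so that [w = z] is allowed
    and the complex-valued norm of [R[i]] does not appear. *)
Definition has_cderiv f z (d : R[i]) := forall e : R, 0 < e ->
  exists2 eta : R, 0 < eta & forall w, normc (w - z) < eta ->
    normc (f w - f z - d * (w - z)) <= e * normc (w - z).

Definition cdiff f z := exists d, has_cderiv f z d.

Lemma derivable_cdiff f z :
  derivable (f : R[i]^o -> R[i]^o) z 1 <-> cdiff f z.
Proof.
rewrite /derivable; split.
  move=> /cvg_ex[/= d /cvgrPdist_le Hd]; exists d => e e0.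
  have eC : 0 < e%:C by rewrite ltcR.
  have := Hd _ eC; rewrite -nbhs_nearE => -[/= r r0 Hr].
  (* In [R[i]] the relation [0 < r] forces [Im r = 0], so the radius of a complex neighbourhood is a
     real number. *)
  have rE : r = (Re r)%:C.
    by move: r0; rewrite ltcE /= => /andP[/eqP r0 _]; apply/eq_ReIm.
  exists (Re r); first by rewrite -ltcR -rE.
  move=> w wz; have [->|wnz] := eqVneq w z.
    by rewrite !subrr mulr0 subrr normc0 mulr0.
  have wz0 : w - z != 0 by rewrite subr_eq0.
  have := Hr (w - z); rewrite /ball_ /= sub0r normrN normC_normc rE ltcR.
  move=> /(_ wz wz0); rewrite normC_normc lecR.
  rewrite [_ *: 1]mulr1 subrK => H.
  rewrite -(ler_pdivrMr _ _ (_ : 0 < normc (w - z))) ?normc_gt0//.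
  rewrite -normcV -normcM; apply: le_trans H.
  rewrite normcBC le_eqVlt; apply/orP; left; apply/eqP; congr normc.
  rewrite mulrBl mulfK//; congr (_ - _).
  by rewrite mulrC.
move=> [d Hd]; apply/cvg_ex; exists d; apply/cvgrPdist_le => e e0.
have eE : e = (Re e)%:C.
  by move: e0; rewrite ltcE /= => /andP[/eqP e0 _]; apply/eq_ReIm.
have [eta eta0 H] := Hd (Re e) (ltac:(by rewrite -ltcR -eE)).
rewrite -nbhs_nearE; exists eta%:C; first by rewrite /= ltcR.
move=> h; rewrite /ball_ /= sub0r normrN normC_normc ltcR => he h0.
rewrite normC_normc eE lecR [_ *: 1]mulr1.
have := H (h + z); rewrite addrK => /(_ he) Hh.
have n0 : 0 < normc h by rewrite normc_gt0.
have -> : d - h^-1 *: (f (h + z) - f z) = - (h^-1 * (f (h + z) - f z - d * h)).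
  rewrite mulrBr [h^-1 * (d * h)]mulrCA mulVf// mulr1 opprB.
  by [].
by rewrite normc_opp normcM normcV mulrC ler_pdivrMr.
Qed.

Lemma has_cderiv_cont f z d : has_cderiv f z d -> forall e : R, 0 < e ->
  exists2 eta : R, 0 < eta & forall w, normc (w - z) < eta ->
    normc (f w - f z) <= e.
Proof.
move=> Hf e e0; have [eta eta0 H] := Hf 1 ltr01.
pose K := 1 + normc d; have K0 : 0 < K by rewrite ltr_pwDl ?normc_ge0.
exists (Num.min eta (e / K)); first by rewrite lt_min eta0 divr_gt0.
move=> w; rewrite lt_min => /andP[w1 w2].
rewrite -(subrK (d * (w - z)) (f w - f z)).
apply: le_trans (normcD_le _ _) _; rewrite normcM.
apply: le_trans (lerD (H _ w1) (lexx _)) _.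
by rewrite -mulrDl mulrC -ler_pdivlMr// ltW.
Qed.

Lemma cdiff_cst (a : R[i]) z : cdiff (fun=> a) z.
Proof.
exists 0 => e e0; exists 1 => // w _.
by rewrite subrr mul0r subrr normc0 mulr_ge0 ?normc_ge0 ?ltW.
Qed.

Lemma cdiff_id z : cdiff id z.
Proof.
exists 1 => e e0; exists 1 => // w _.
by rewrite mul1r subrr normc0 mulr_ge0 ?normc_ge0 ?ltW.
Qed.

Lemma cdiffD f g z : cdiff f z -> cdiff g z -> cdiff (fun w => f w + g w) z.
Proof.
move=> /derivable_cdiff df /derivable_cdiff dg; apply/derivable_cdiff.
exact: (derivableD df dg).
Qed.

Lemma cdiffB f g z : cdiff f z -> cdiff g z -> cdiff (fun w => f w - g w) z.
Proof.
move=> /derivable_cdiff df /derivable_cdiff dg; apply/derivable_cdiff.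
exact: (derivableB df dg).
Qed.

Lemma cdiffM f g z : cdiff f z -> cdiff g z -> cdiff (fun w => f w * g w) z.
Proof.
move=> /derivable_cdiff df /derivable_cdiff dg; apply/derivable_cdiff.
exact: (derivableM df dg).
Qed.

Lemma cdiffV f z : f z != 0 -> cdiff f z -> cdiff (fun w => (f w)^-1) z.
Proof.
move=> f0 /derivable_cdiff df; apply/derivable_cdiff.
exact: (derivableV f0 df).
Qed.

Lemma cdiff_subc (a : R[i]) z : cdiff (fun w => w - a) z.
Proof. by apply: cdiffB; [exact: cdiff_id|exact: cdiff_cst]. Qed.

Lemma cdiffX n z : cdiff (fun w => w ^+ n) z.
Proof.
elim: n => [|n IH]; first exact: cdiff_cst.
have -> : (fun w : R[i] => w ^+ n.+1) = (fun w => w * w ^+ n).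
  by apply/funext => w; rewrite exprS.
by apply: cdiffM => //; exact: cdiff_id.
Qed.

Lemma cdiff_near f g z (eta : R) : 0 < eta ->
  (forall w, normc (w - z) < eta -> f w = g w) -> cdiff f z -> cdiff g z.
Proof.
move=> eta0 fg [d Hd]; exists d => e e0; have [r r0 Hr] := Hd e e0.
exists (Num.min eta r); first by rewrite lt_min eta0.
move=> w; rewrite lt_min => /andP[w1 w2].
by rewrite -!fg ?subrr ?normc0//; exact: Hr.
Qed.

Lemma cdiff_sum (I : Type) (s : seq I) (F : I -> R[i] -> R[i]) z :
  (forall i, cdiff (F i) z) -> cdiff (fun w => \sum_(i <- s) F i w) z.
Proof.
move=> H; elim: s => [|i s IH].
  have -> : (fun w => \sum_(i <- [::]) F i w) = (fun=> 0).
    by apply/funext => w; rewrite big_nil.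
  exact: cdiff_cst.
have -> : (fun w => \sum_(i <- i :: s) F i w)
        = (fun w => F i w + \sum_(i <- s) F i w).
  by apply/funext => w; rewrite big_cons.
exact: cdiffD.
Qed.

Lemma cdiff_prod (I : Type) (s : seq I) (F : I -> R[i] -> R[i]) z :
  (forall i, cdiff (F i) z) -> cdiff (fun w => \prod_(i <- s) F i w) z.
Proof.
move=> H; elim: s => [|i s IH].
  have -> : (fun w => \prod_(i <- [::]) F i w) = (fun=> 1).
    by apply/funext => w; rewrite big_nil.
  exact: cdiff_cst.
have -> : (fun w => \prod_(i <- i :: s) F i w)
        = (fun w => F i w * \prod_(i <- s) F i w).
  by apply/funext => w; rewrite big_cons.
exact: cdiffM.
Qed.

End Differentiability.

(** * Curves in the plane and their integrals *)

Section ComplexCurves.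
Context {R : realType}.
Implicit Types (phi psi : R -> R[i]) (t a b c : R).

Definition ccont phi t : Prop :=
  continuous_at t (fun x => Re (phi x)) /\ continuous_at t (fun x => Im (phi x)).

Definition cderiv phi t (d : R[i]) : Prop :=
  is_derive t (1 : R) (fun x => Re (phi x)) (Re d) /\
  is_derive t (1 : R) (fun x => Im (phi x)) (Im d).

(** The componentwise form gives access to real calculus; the form with [normc] is the one that
    composes with complex differentiable maps. *)
Lemma ccontP phi t : ccont phi t <-> forall e : R, 0 < e ->
  exists2 eta : R, 0 < eta & forall x, `|x - t| < eta ->
    normc (phi x - phi t) <= e.
Proof.
split.
  move=> [/cvgrPdist_le cR /cvgrPdist_le cI] e e0.
  have e2 : 0 < e / 2 by rewrite divr_gt0.
  have := cR _ e2; rewrite -nbhs_nearE => /nbhs_ballP[/= r r0 Hr].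
  have := cI _ e2; rewrite -nbhs_nearE => /nbhs_ballP[/= s s0 Hs].
  exists (Num.min r s); first by rewrite lt_min r0.
  move=> x; rewrite lt_min => /andP[xr xs].
  apply: le_trans (normc_le_ReIm _) _; rewrite ReDc ReNc ImDc ImNc [e]splitr.
  by apply: lerD; rewrite distrC; [apply: Hr|apply: Hs]; rewrite /ball/= distrC.
move=> H; split; apply/cvgrPdist_le => e e0; have [r r0 Hr] := H e e0;
  rewrite -nbhs_nearE; apply/nbhs_ballP; exists r => // x /=;
  rewrite /ball/= distrC => xr; rewrite distrC; apply: le_trans (Hr _ xr).
  by rewrite -ReNc -ReDc Re_le_normc.
by rewrite -ImNc -ImDc Im_le_normc.
Qed.

Lemma ccont_cst (k : R[i]) t : ccont (fun=> k) t.
Proof. by split; exact: cvg_cst. Qed.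

Lemma ccontD phi psi t : ccont phi t -> ccont psi t ->
  ccont (fun x => phi x + psi x) t.
Proof.
move=> [r1 i1] [r2 i2]; split.
  rewrite (eq_fun (fun x => ReDc (phi x) (psi x))); exact: (continuousD r1 r2).
rewrite (eq_fun (fun x => ImDc (phi x) (psi x))); exact: (continuousD i1 i2).
Qed.

Lemma ccontM phi psi t : ccont phi t -> ccont psi t ->
  ccont (fun x => phi x * psi x) t.
Proof.
move=> [r1 i1] [r2 i2]; split.
  rewrite (eq_fun (fun x => ReMc (phi x) (psi x))).
  exact: (continuousB (continuousM r1 r2) (continuousM i1 i2)).
rewrite (eq_fun (fun x => ImMc (phi x) (psi x))).
exact: (continuousD (continuousM r1 i2) (continuousM i1 r2)).
Qed.

Lemma ccontB phi psi t : ccont phi t -> ccont psi t ->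
  ccont (fun x => phi x - psi x) t.
Proof.
move=> cphi cpsi; have := ccontD cphi (ccontM (ccont_cst (-1) t) cpsi).
by under [fun x => phi x - _]eq_fun do rewrite -mulN1r.
Qed.

Lemma ccont_comp (f : R[i] -> R[i]) phi t : cdiff f (phi t) -> ccont phi t ->
  ccont (fun x => f (phi x)) t.
Proof.
move=> [d df] /ccontP cphi; apply/ccontP => e e0.
have [r r0 Hr] := has_cderiv_cont df e0.
have r2 : 0 < r / 2 by rewrite divr_gt0.
have [s s0 Hs] := cphi _ r2; exists s => // x xs.
by apply: Hr; apply: le_lt_trans (Hs _ xs) _; rewrite ltr_pdivrMr//; lra.
Qed.

Lemma ccont_normc phi t : ccont phi t -> {for t, continuous (fun x => normc (phi x))}.
Proof.
move=> /ccontP cphi; apply/cvgrPdist_le => e e0; have [r r0 Hr] := cphi _ e0.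
rewrite -nbhs_nearE; apply/nbhs_ballP; exists r => // x /=.
rewrite /ball/= distrC => xr; rewrite distrC.
by apply: le_trans (dist_normc _ _) (Hr _ xr).
Qed.

Lemma is_derive_continuous (F : R -> R) t (d : R) : is_derive t (1 : R) F d ->
  continuous_at t F.
Proof. by move=> [dF _]; apply: differentiable_continuous; apply/derivable1_diffP. Qed.

Lemma cderiv_cont phi t d : cderiv phi t d -> ccont phi t.
Proof. by move=> [dR dI]; split; [exact: is_derive_continuous dR|exact: is_derive_continuous dI]. Qed.

Lemma cderiv_eq phi t d d' : cderiv phi t d -> d = d' -> cderiv phi t d'.
Proof. by move=> + <-. Qed.

Lemma cderiv_cst (k : R[i]) t : cderiv (fun=> k) t 0.
Proof. by split; exact: is_derive_cst. Qed.

Lemma cderiv_real (u : R -> R) t (d : R) : is_derive t (1 : R) u d ->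
  cderiv (fun x => (u x)%:C) t d%:C.
Proof. by move=> du; split => //=; exact: is_derive_cst. Qed.

Lemma cderivD phi psi t d1 d2 : cderiv phi t d1 -> cderiv psi t d2 ->
  cderiv (fun x => phi x + psi x) t (d1 + d2).
Proof.
move=> [r1 i1] [r2 i2]; split; rewrite ?ReDc ?ImDc.
  rewrite (eq_fun (fun x => ReDc (phi x) (psi x))); exact: is_deriveD.
rewrite (eq_fun (fun x => ImDc (phi x) (psi x))); exact: is_deriveD.
Qed.

Lemma cderivM phi psi t d1 d2 : cderiv phi t d1 -> cderiv psi t d2 ->
  cderiv (fun x => phi x * psi x) t (d1 * psi t + phi t * d2).
Proof.
move=> [r1 i1] [r2 i2]; split; rewrite ?ReDc ?ImDc ?ReMc ?ImMc.
  rewrite (eq_fun (fun x => ReMc (phi x) (psi x))).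
  apply: is_derive_eq (is_deriveB (is_deriveM r1 r2) (is_deriveM i1 i2)) _.
  by rewrite /GRing.scale /=; ring.
rewrite (eq_fun (fun x => ImMc (phi x) (psi x))).
apply: is_derive_eq (is_deriveD (is_deriveM r1 i2) (is_deriveM i1 r2)) _.
by rewrite /GRing.scale /=; ring.
Qed.

Lemma cderivZ (k : R[i]) phi t d : cderiv phi t d ->
  cderiv (fun x => k * phi x) t (k * d).
Proof.
move=> dphi; apply: cderiv_eq (cderivM (cderiv_cst k t) dphi) _.
by rewrite mul0r add0r.
Qed.

End ComplexCurves.

Section ComplexIntegral.
Context {R : realType}.
Implicit Types (phi psi : R -> R[i]) (a b c : R).
Let mu := @lebesgue_measure R.

Definition cint a b phi : R[i] :=
  (\int[mu]_(t in `[a, b]) Re (phi t)) +i* (\int[mu]_(t in `[a, b]) Im (phi t)).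

Lemma continuous_itv_integrable (u : R -> R) a b :
  (forall t, a <= t <= b -> {for t, continuous u}) ->
  mu.-integrable `[a, b] (EFin \o u).
Proof.
move=> cu; apply: continuous_compact_integrable; first exact: segment_compact.
apply: continuous_in_subspaceT => t; rewrite inE/= in_itv/=; exact: cu.
Qed.

Lemma ccont_integrableRe phi a b : (forall t, a <= t <= b -> ccont phi t) ->
  mu.-integrable `[a, b] (EFin \o (fun t => Re (phi t))).
Proof. by move=> c; apply: continuous_itv_integrable => t /c[]. Qed.

Lemma ccont_integrableIm phi a b : (forall t, a <= t <= b -> ccont phi t) ->
  mu.-integrable `[a, b] (EFin \o (fun t => Im (phi t))).
Proof. by move=> c; apply: continuous_itv_integrable => t /c[]. Qed.

Lemma eq_cint a b phi psi : (forall t, a <= t <= b -> phi t = psi t) ->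
  cint a b phi = cint a b psi.
Proof.
by move=> e; congr (_ +i* _); apply: eq_Rintegral => t;
  rewrite inE/= in_itv/= => /e ->.
Qed.

Lemma cintD a b phi psi : (forall t, a <= t <= b -> ccont phi t) ->
  (forall t, a <= t <= b -> ccont psi t) ->
  cint a b (fun t => phi t + psi t) = cint a b phi + cint a b psi.
Proof.
move=> cp cq; apply: eq_ReIm; rewrite /= ?ReDc ?ImDc/=.
  under eq_Rintegral do rewrite ReDc.
  by rewrite RintegralD//; exact: ccont_integrableRe.
under eq_Rintegral do rewrite ImDc.
by rewrite RintegralD//; exact: ccont_integrableIm.
Qed.

Lemma cintB a b phi psi : (forall t, a <= t <= b -> ccont phi t) ->
  (forall t, a <= t <= b -> ccont psi t) ->
  cint a b (fun t => phi t - psi t) = cint a b phi - cint a b psi.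
Proof.
move=> cp cq; apply: eq_ReIm; rewrite /= ?ReDc ?ReNc ?ImNc ?ImDc/=.
  under eq_Rintegral do rewrite ReDc ReNc.
  by rewrite RintegralB//; exact: ccont_integrableRe.
under eq_Rintegral do rewrite ImDc ImNc.
by rewrite RintegralB//; exact: ccont_integrableIm.
Qed.

Lemma cintZ a b (k : R[i]) phi : (forall t, a <= t <= b -> ccont phi t) ->
  cint a b (fun t => k * phi t) = k * cint a b phi.
Proof.
move=> cp; have iR := ccont_integrableRe cp; have iI := ccont_integrableIm cp.
have iZ (r : R) (u : R -> R) : mu.-integrable `[a, b] (EFin \o u) ->
    mu.-integrable `[a, b] (EFin \o (fun t => r * u t)).
  by move=> iu; apply: (@integrableZl _ _ _ mu _ _ r (EFin \o u)).
apply: eq_ReIm; rewrite /= ?ReMc ?ImMc/=.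
  under eq_Rintegral do rewrite ReMc.
  by rewrite RintegralB ?RintegralZl//; exact: iZ.
under eq_Rintegral do rewrite ImMc.
by rewrite RintegralD ?RintegralZl//; exact: iZ.
Qed.

Lemma Rintegral_split (u : R -> R) a b c : a <= b -> b <= c ->
  mu.-integrable `[a, c] (EFin \o u) ->
  \int[mu]_(t in `[a, c]) u t
  = \int[mu]_(t in `[a, b]) u t + \int[mu]_(t in `[b, c]) u t.
Proof.
move=> ab bc iu; apply/eqP; rewrite addrC -subr_eq; apply/eqP.
rewrite (@Rintegral_itvB _ _ (BLeft a) (BRight c)) ?bnd_simp//.
rewrite Rintegral_itv_obnd_cbnd//.
apply: integrableS iu => //; apply: subset_itv; rewrite ?bnd_simp//.
Qed.

Lemma cint_split a b c phi : a <= b -> b <= c ->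
  (forall t, a <= t <= c -> ccont phi t) ->
  cint a c phi = cint a b phi + cint b c phi.
Proof.
move=> ab bc cp; apply: eq_ReIm; rewrite ?ReDc ?ImDc /=.
  by apply: Rintegral_split => //; exact: ccont_integrableRe.
by apply: Rintegral_split => //; exact: ccont_integrableIm.
Qed.

Lemma Rintegral_bound (u : R -> R) a b (M : R) : a <= b ->
  (forall t, a <= t <= b -> {for t, continuous u}) ->
  (forall t, a <= t <= b -> `|u t| <= M) ->
  `|\int[mu]_(t in `[a, b]) u t| <= M * (b - a).
Proof.
move=> ab cu uM; have iu := continuous_itv_integrable cu.
apply: (le_trans (le_normr_Rintegral _ iu)) => //.
have -> : M * (b - a) = \int[mu]_(t in `[a, b]) M.
  rewrite Rintegral_cst//= lebesgue_measure_itv/=.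
  by rewrite lte_fin; case: ltgtP ab => //= -> _; rewrite subrr.
apply: le_Rintegral => //.
- exact: integrable_norm.
- by apply: continuous_itv_integrable => t _; exact: cvg_cst.
Qed.

(* The factor 2 comes from bounding the real and imaginary parts separately. *)
Lemma cint_bound a b phi (M : R) : a <= b ->
  (forall t, a <= t <= b -> ccont phi t) ->
  (forall t, a <= t <= b -> normc (phi t) <= M) ->
  normc (cint a b phi) <= 2 * M * (b - a).
Proof.
move=> ab cp pM; apply: le_trans (normc_le_ReIm _) _ => /=.
rewrite -mulrA mulr_natl mulr2n; apply: lerD; apply: Rintegral_bound => //.
- by move=> t /cp[].
- by move=> t /pM; apply: le_trans; exact: Re_le_normc.
- by move=> t /cp[].
- by move=> t /pM; apply: le_trans; exact: Im_le_normc.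
Qed.

Lemma Rintegral_FTC (F f : R -> R) a b : a <= b ->
  (forall t, a <= t <= b -> is_derive t (1 : R) F (f t)) ->
  (forall t, a <= t <= b -> {for t, continuous f}) ->
  \int[mu]_(t in `[a, b]) f t = F b - F a.
Proof.
rewrite le_eqVlt => /predU1P[<- _ _|ab dF cf].
  by rewrite set_itv1 Rintegral_set1 subrr.
have cF t : a <= t <= b -> {for t, continuous F}.
  by move=> /dF; exact: is_derive_continuous.
rewrite /Rintegral (continuous_FTC2 (F := F) ab)//.
- apply: continuous_in_subspaceT => t; rewrite inE/= in_itv/=; exact: cf.
- split.
  + move=> t; rewrite in_itv/= => /andP[/ltW at_ /ltW tb].
    by have [] : is_derive t (1 : R) F (f t) by apply: dF; rewrite at_.
  + by apply: cvg_at_right_filter; apply: cF; rewrite lexx ltW.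
  + by apply: cvg_at_left_filter; apply: cF; rewrite lexx ltW.
- move=> t; rewrite in_itv/= => /andP[/ltW at_ /ltW tb].
  rewrite derive1E; have [_ //] : is_derive t (1 : R) F (f t).
  by apply: dF; rewrite at_.
Qed.

Lemma cint_FTC a b Phi phi : a <= b ->
  (forall t, a <= t <= b -> cderiv Phi t (phi t)) ->
  (forall t, a <= t <= b -> ccont phi t) ->
  cint a b phi = Phi b - Phi a.
Proof.
move=> ab d c; apply: eq_ReIm; rewrite ?ReDc ?ReNc ?ImDc ?ImNc /=.
  apply: (@Rintegral_FTC (fun t => Re (Phi t)) (fun t => Re (phi t))) => // t tab.
    by case: (d t tab).
  by case: (c t tab).
apply: (@Rintegral_FTC (fun t => Im (Phi t)) (fun t => Im (phi t))) => // t tab.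
  by case: (d t tab).
by case: (c t tab).
Qed.

End ComplexIntegral.

Arguments normc : simpl never.
Arguments cint : simpl never.

(** Every right end bounds every left end, so the supremum of the left ends lies in all the
    intervals. *)
Lemma nested_intervals_point {R : realType} (x l : nat -> R) :
  (forall n, 0 <= l n) -> (forall n, x n <= x n.+1) ->
  (forall n, x n.+1 + l n.+1 <= x n + l n) ->
  exists c, forall n, x n <= c <= x n + l n.
Proof.
move=> l0 xinc xdec.
have inc m k : x m <= x (m + k)%N.
  by elim: k => [|k IH]; rewrite ?addn0// addnS (le_trans IH).
have dec m k : x (m + k)%N + l (m + k)%N <= x m + l m.
  by elim: k => [|k IH]; rewrite ?addn0// addnS; apply: le_trans IH.
have ub m n : x m <= x n + l n.
  have [mn|nm] := leqP m n.
    have := inc m (n - m)%N; rewrite subnKC// => /le_trans; apply.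
    by rewrite lerDl.
  have := dec n (m - n)%N; rewrite (subnKC (ltnW nm)); apply: le_trans.
  by rewrite lerDl.
exists (sup (range x)) => n; apply/andP; split.
  apply: ub_le_sup; last by exists n.
  by exists (x 0%N + l 0%N) => _ [m _ <-].
apply: ge_sup; first by exists (x 0%N), 0%N.
by move=> _ [m _ <-].
Qed.

(** * Cauchy's theorem on the image of a rectangle *)

Section Goursat.
Context {R : realType} (Phi Phis Phit : R -> R -> R[i]) (S1 S2 T1 T2 L : R).

Let D (s t : R) : Prop := S1 <= s <= S2 /\ T1 <= t <= T2.

Context
  (dS : forall s t, D s t -> cderiv (fun x => Phi x t) s (Phis s t))
  (dT : forall s t, D s t -> cderiv (fun x => Phi s x) t (Phit s t))
  (cS : forall s t, D s t -> ccont (fun x => Phis x t) s)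
  (cT : forall s t, D s t -> ccont (fun x => Phit s x) t)
  (bS : forall s t, D s t -> normc (Phis s t) <= L)
  (bT : forall s t, D s t -> normc (Phit s t) <= L).

(** This is the contour integral of [K] along the image under [Phi] of the boundary of a parameter
    rectangle, run counterclockwise. Working with images lets one theorem cover the annular region
    between two circles. *)
Definition bint (K : R[i] -> R[i]) (s1 s2 t1 t2 : R) : R[i] :=
  cint s1 s2 (fun s => K (Phi s t1) * Phis s t1)
  + cint t1 t2 (fun t => K (Phi s2 t) * Phit s2 t)
  - cint s1 s2 (fun s => K (Phi s t2) * Phis s t2)
  - cint t1 t2 (fun t => K (Phi s1 t) * Phit s1 t).

Arguments bint : simpl never.

Definition subrect (s1 s2 t1 t2 : R) : Prop :=
  [/\ S1 <= s1, s1 <= s2, s2 <= S2, T1 <= t1 & t1 <= t2 <= T2].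

Definition cdiff_on (K : R[i] -> R[i]) : Prop :=
  forall s t, D s t -> cdiff K (Phi s t).

Lemma ccont_side_s K s t : cdiff_on K -> D s t ->
  ccont (fun x => K (Phi x t) * Phis x t) s.
Proof.
move=> dK Dst; apply: ccontM; last exact: cS.
by apply: (ccont_comp (phi := fun x => Phi x t)); [exact: dK|exact: cderiv_cont (dS Dst)].
Qed.

Lemma ccont_side_t K s t : cdiff_on K -> D s t ->
  ccont (fun x => K (Phi s x) * Phit s x) t.
Proof.
move=> dK Dst; apply: ccontM; last exact: cT.
by apply: (ccont_comp (phi := fun x => Phi s x)); [exact: dK|exact: cderiv_cont (dT Dst)].
Qed.

Lemma subrectP s1 s2 t1 t2 s t : subrect s1 s2 t1 t2 ->
  s1 <= s <= s2 -> t1 <= t <= t2 -> D s t.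
Proof.
move=> [h1 h2 h3 h4 /andP[h5 h6]] /andP[a b] /andP[c d]; split; apply/andP; split.
- exact: le_trans a.
- exact: le_trans b _.
- exact: le_trans c.
- exact: le_trans d _.
Qed.

Ltac inrect hr := solve [apply: (subrectP hr); rewrite ?lexx ?andbT //;
  case: hr => ? ? ? ? /andP[? ?] //; apply/andP; split => //; exact: lexx].
Ltac side hr := let x := fresh in let hx := fresh in move=> x hx;
  (apply: ccont_side_s => // || apply: ccont_side_t => //); inrect hr.

Lemma bintD K1 K2 s1 s2 t1 t2 : cdiff_on K1 -> cdiff_on K2 ->
  subrect s1 s2 t1 t2 ->
  bint (fun w => K1 w + K2 w) s1 s2 t1 t2
  = bint K1 s1 s2 t1 t2 + bint K2 s1 s2 t1 t2.
Proof.
move=> d1 d2 hr.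
have E a b (p q r : R -> R[i]) : cint a b (fun t => (p t + q t) * r t)
    = cint a b (fun t => p t * r t + q t * r t).
  by apply: eq_cint => t _; rewrite mulrDl.
rewrite /bint !(E _ _ _ _ (fun s => Phis s _)) !(E _ _ _ _ (fun t => Phit _ t)).
rewrite !cintD; try side hr.
ring.
Qed.

Lemma bint_split_s K s1 s2 s3 t1 t2 : cdiff_on K ->
  s1 <= s2 <= s3 -> subrect s1 s3 t1 t2 ->
  bint K s1 s3 t1 t2 = bint K s1 s2 t1 t2 + bint K s2 s3 t1 t2.
Proof.
move=> dK /andP[s12 s23] hr.
rewrite /bint (cint_split s12 s23); last side hr.
rewrite [X in _ - X - _ = _](cint_split s12 s23); last side hr.
ring.
Qed.

Lemma bint_split_t K s1 s2 t1 t2 t3 : cdiff_on K ->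
  t1 <= t2 <= t3 -> subrect s1 s2 t1 t3 ->
  bint K s1 s2 t1 t3 = bint K s1 s2 t1 t2 + bint K s1 s2 t2 t3.
Proof.
move=> dK /andP[s12 s23] hr.
rewrite /bint (cint_split s12 s23); last side hr.
rewrite [X in _ - X = _](cint_split s12 s23); last side hr.
ring.
Qed.

(** An affine function has the quadratic primitive [Psi], and the increments of [Psi] cancel around
    the closed boundary. *)
Lemma bint_affine (al be p : R[i]) s1 s2 t1 t2 : subrect s1 s2 t1 t2 ->
  bint (fun w => al + be * (w - p)) s1 s2 t1 t2 = 0.
Proof.
move=> hr; have [_ h2 _ _ /andP[h5 _]] := hr.
pose Psi (w : R[i]) := al * w + be / 2 * ((w - p) * (w - p)).
have dPsi (phi : R -> R[i]) t d : cderiv phi t d ->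
    cderiv (fun x => Psi (phi x)) t ((al + be * (phi t - p)) * d).
  move=> dphi; have dp : cderiv (fun x => phi x - p) t d.
    apply: cderiv_eq (cderivD dphi (cderiv_cst (- p) t)) _; exact: addr0.
  apply: cderiv_eq (cderivD (cderivZ al dphi) (cderivZ (be / 2) (cderivM dp dp))) _.
  have two : (2 : R[i]) != 0 by rewrite pnatr_eq0.
  by field.
have dK : cdiff_on (fun w => al + be * (w - p)).
  move=> s t _; apply: cdiffD; first exact: cdiff_cst.
  apply: cdiffM; first exact: cdiff_cst.
  exact: cdiff_subc.
have FS t : t1 <= t <= t2 ->
    cint s1 s2 (fun s => (al + be * (Phi s t - p)) * Phis s t)
    = Psi (Phi s2 t) - Psi (Phi s1 t).
  move=> ht; apply: (cint_FTC (Phi := fun x => Psi (Phi x t))) => // x hx.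
    by apply: (dPsi (fun x => Phi x t)); apply: dS; inrect hr.
  by apply: (ccont_side_s dK); inrect hr.
have FT s : s1 <= s <= s2 ->
    cint t1 t2 (fun t => (al + be * (Phi s t - p)) * Phit s t)
    = Psi (Phi s t2) - Psi (Phi s t1).
  move=> hs; apply: (cint_FTC (Phi := fun x => Psi (Phi s x))) => // x hx.
    by apply: (dPsi (fun x => Phi s x)); apply: dT; inrect hr.
  by apply: (ccont_side_t dK); inrect hr.
rewrite /bint !FS ?FT ?lexx ?h2 ?h5//; ring.
Qed.

Lemma bint_bound K (M : R) s1 s2 t1 t2 : cdiff_on K -> subrect s1 s2 t1 t2 ->
  (forall s t, s1 <= s <= s2 -> t1 <= t <= t2 -> normc (K (Phi s t)) <= M) ->
  normc (bint K s1 s2 t1 t2) <= 4 * (M * L) * ((s2 - s1) + (t2 - t1)).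
Proof.
move=> dK hr KM; have [_ h2 _ _ /andP[h5 _]] := hr.
have HS t : t1 <= t <= t2 ->
    normc (cint s1 s2 (fun s => K (Phi s t) * Phis s t)) <= 2 * (M * L) * (s2 - s1).
  move=> ht; apply: cint_bound => //; first by move=> s hs; apply: ccont_side_s => //; inrect hr.
  move=> s hs; rewrite normcM ler_pM ?normc_ge0//.
    exact: KM.
  by apply: bS; inrect hr.
have HT s : s1 <= s <= s2 ->
    normc (cint t1 t2 (fun t => K (Phi s t) * Phit s t)) <= 2 * (M * L) * (t2 - t1).
  move=> hs; apply: cint_bound => //; first by move=> t ht; apply: ccont_side_t => //; inrect hr.
  move=> t ht; rewrite normcM ler_pM ?normc_ge0//.
    exact: KM.
  by apply: bT; inrect hr.
apply: le_trans (normcB_le _ _) _.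
apply: le_trans (lerD (normcB_le _ _) (lexx _)) _.
apply: le_trans (lerD (lerD (normcD_le _ _) (lexx _)) (lexx _)) _.
have a1 := HS t1; have a2 := HS t2; have b1 := HT s1; have b2 := HT s2.
apply: le_trans (lerD (lerD (lerD (a1 _) (b2 _)) (a2 _)) (b1 _)) _;
  rewrite ?lexx ?h2 ?h5//.
rewrite le_eqVlt; apply/orP; left; apply/eqP; ring.
Qed.

(** Each partial derivative is integrated along a side parallel to an axis; the factor 2 is that of
    [cint_bound]. *)
Lemma homotopy_lipschitz s t s' t' : D s t -> D s' t' ->
  normc (Phi s t - Phi s' t') <= 2 * L * (`|s - s'| + `|t - t'|).
Proof.
have mid lo hi x y z : lo <= x -> y <= hi -> x <= z <= y -> lo <= z <= hi.
  by move=> lx yh /andP[xz zy]; rewrite (le_trans lx)// (le_trans zy).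
have HS x y u : D x u -> D y u -> x <= y ->
    normc (Phi y u - Phi x u) <= 2 * L * (y - x).
  move=> [/andP[Sx _] hu] [/andP[_ yS] _] xy.
  have Du z : x <= z <= y -> D z u by move=> hz; split=> //; exact: mid hz.
  rewrite -(cint_FTC (Phi := fun x => Phi x u) (phi := fun x => Phis x u) xy).
  - by apply: cint_bound => // z /Du; [exact: cS|exact: bS].
  - by move=> z /Du/dS.
  - by move=> z /Du/cS.
have HT x y u : D u x -> D u y -> x <= y ->
    normc (Phi u y - Phi u x) <= 2 * L * (y - x).
  move=> [hu /andP[Tx _]] [_ /andP[_ yT]] xy.
  have Du z : x <= z <= y -> D u z by move=> hz; split=> //; exact: mid hz.
  rewrite -(cint_FTC (Phi := fun x => Phi u x) (phi := fun x => Phit u x) xy).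
  - by apply: cint_bound => // z /Du; [exact: cT|exact: bT].
  - by move=> z /Du/dT.
  - by move=> z /Du/cT.
move=> D1 D2; have D3 : D s' t by case: D1; case: D2.
rewrite -(subrK (Phi s' t) (Phi s t)) -addrA mulrDr.
apply: le_trans (normcD_le _ _) _; apply: lerD.
  have [ss|ss] := leP s' s; first by rewrite ger0_norm ?subr_ge0//; exact: HS.
  by rewrite ltr0_norm ?subr_lt0// opprB normcBC; apply: HS => //; exact: ltW.
have [ss|ss] := leP t' t; first by rewrite ger0_norm ?subr_ge0//; exact: HT.
by rewrite ltr0_norm ?subr_lt0// opprB normcBC; apply: HT => //; exact: ltW.
Qed.

(** Goursat's bisection, carried out in the parameter rectangle. Around the limit point [H] is
    affine up to [e' |w - p|]; the affine part integrates to 0, while perimeter times distance to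
    [p] shrinks like [4^(-n)], the rate at which the bad quarters may decrease. *)
Lemma goursat H : cdiff_on H -> S1 <= S2 -> T1 <= T2 -> bint H S1 S2 T1 T2 = 0.
Proof.
move=> dH hS hT; apply/eqP; rewrite -normc_eq0 eq_le normc_ge0 andbT leNgt.
(* Half of the norm, so that the strict bound [e / 4 ^+ n] already holds for the full rectangle,
   [n = 0]. *)
apply/negP => n0; pose e := normc (bint H S1 S2 T1 T2) / 2.
have e0 : 0 < e by rewrite divr_gt0.
pose sg n := (S2 - S1) / 2 ^+ n; pose ta n := (T2 - T1) / 2 ^+ n.
have P2 n : (2 : R) ^+ n != 0 by rewrite expf_neq0.
have sgS n : sg n = sg n.+1 + sg n.+1 by rewrite /sg exprS; field.
have taS n : ta n = ta n.+1 + ta n.+1 by rewrite /ta exprS; field.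
have sg0 n : 0 <= sg n by rewrite divr_ge0 ?subr_ge0// exprn_ge0.
have ta0 n : 0 <= ta n by rewrite divr_ge0 ?subr_ge0// exprn_ge0.
pose bad n (p : R * R) := subrect p.1 (p.1 + sg n) p.2 (p.2 + ta n) /\
  e / 4 ^+ n < normc (bint H p.1 (p.1 + sg n) p.2 (p.2 + ta n)).
pose nested n (p q : R * R) := [/\ p.1 <= q.1, q.1 + sg n.+1 <= p.1 + sg n,
  p.2 <= q.2 & q.2 + ta n.+1 <= p.2 + ta n].
have step n p : bad n p -> exists q, bad n.+1 q /\ nested n p q.
  case: p => s t [/= hr hb]; have [h1 h2 h3 h4 /andP[h5 h6]] := hr.
  have sg1 := sg0 n.+1; have ta1 := ta0 n.+1.
  have sn := sgS n; have tn := taS n.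
  pose s' := s + sg n.+1; pose t' := t + ta n.+1.
  have sE : s + sg n = s' + sg n.+1 by rewrite sn addrA.
  have tE : t + ta n = t' + ta n.+1 by rewrite tn addrA.
  have ss' : s <= s' by rewrite lerDl.
  have tt' : t <= t' by rewrite lerDl.
  have s's : s' <= s + sg n by rewrite sE lerDl.
  have t't : t' <= t + ta n by rewrite tE lerDl.
  have s'1 := le_trans h1 ss'; have t'1 := le_trans h4 tt'.
  have s'2 := le_trans s's h3; have t'2 := le_trans t't h6.
  have r1 : subrect s s' t (t + ta n) by split => //; apply/andP.
  have r2 : subrect s' (s + sg n) t (t + ta n) by split => //; apply/andP.
  move: hb; rewrite (@bint_split_s H s s')//; last by apply/andP.
  rewrite (@bint_split_t H s s' t t')//; last by apply/andP.
  rewrite (@bint_split_t H s' _ t t')//; last by apply/andP.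
  set b1 := bint H s s' t t'; set b2 := bint H s s' t' _.
  set b3 := bint H s' _ t t'; set b4 := bint H s' _ t' _ => hb.
  have : 4 * (e / 4 ^+ n.+1) < normc b1 + normc b2 + (normc b3 + normc b4).
    apply: lt_le_trans (le_trans (normcD_le _ _) (lerD (normcD_le _ _) (normcD_le _ _))).
    apply: le_lt_trans hb; rewrite exprS le_eqVlt; apply/orP; left; apply/eqP.
    by field; rewrite expf_neq0.
  have [b1e _|b1e] := ltP (e / 4 ^+ n.+1) (normc b1).
    exists (s, t); split; last by split => //=; rewrite -/s' -/t'.
    by split => //=; rewrite -/s' -/t'; split => //; apply/andP.
  have [b2e _|b2e] := ltP (e / 4 ^+ n.+1) (normc b2).
    exists (s, t'); split; last by split => //=; rewrite -/s' -?tE.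
    by split => /=; rewrite -/s' -?tE//; split => //; apply/andP.
  have [b3e _|b3e] := ltP (e / 4 ^+ n.+1) (normc b3).
    exists (s', t); split; last by split => //=; rewrite -/t' -?sE.
    by split => /=; rewrite -/t' -?sE//; split => //; apply/andP.
  have [b4e _|b4e] := ltP (e / 4 ^+ n.+1) (normc b4).
    exists (s', t'); split; last by split => //=; rewrite -?sE -?tE.
    by split => /=; rewrite -?sE -?tE//; split => //; apply/andP.
  by move: b1e b2e b3e b4e; lra.
pose nxt n p := xget p [set q | bad n.+1 q /\ nested n p q].
have nxtP n p : bad n p -> bad n.+1 (nxt n p) /\ nested n p (nxt n p).
  move=> b; have [q hq] := step n p b.
  have := @xgetPex _ p [set q | bad n.+1 q /\ nested n p q].
  by apply; exists q.
pose u := fix u n := if n is m.+1 then nxt m (u m) else (S1, T1).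
have ub n : bad n (u n).
  elim: n => [|n IH] /=.
    have s1 : S1 + sg 0 = S2 by rewrite /sg expr0; field.
    have t1 : T1 + ta 0 = T2 by rewrite /ta expr0; field.
    rewrite /bad /= s1 t1; split; first by split => //; rewrite hT lexx.
    by rewrite expr0 divr1 ltr_pdivrMr//; move: n0; lra.
  by have [] := nxtP n (u n) IH.
have un n : nested n (u n) (u n.+1).
  by have [] := nxtP n (u n) (ub n).
have [c1 hc1] := @nested_intervals_point _ (fun n => (u n).1) sg sg0
  (fun n => let: And4 h _ _ _ := un n in h) (fun n => let: And4 _ h _ _ := un n in h).
have [c2 hc2] := @nested_intervals_point _ (fun n => (u n).2) ta ta0
  (fun n => let: And4 _ _ h _ := un n in h) (fun n => let: And4 _ _ _ h := un n in h).
have Dc : D c1 c2 by have [hr _] := ub 0%N; exact: subrectP hr (hc1 _) (hc2 _).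
have L0 : 0 <= L := le_trans (normc_ge0 _) (bS Dc).
have [d Hd] := dH _ _ Dc; set p := Phi c1 c2 in Hd.
pose W := (S2 - S1) + (T2 - T1); have W0 : 0 <= W by rewrite addr_ge0 ?subr_ge0.
(* The summand 1 keeps the denominator of [e'] positive when [L] or [W] is 0; the contradiction
   comes from [8 L^2 W^2 e' <= e]. *)
have B0 : 0 < 8 * L ^+ 2 * W ^+ 2 + 1.
  by rewrite ltr_wpDl// !mulr_ge0 ?sqr_ge0.
pose e' := e / (8 * L ^+ 2 * W ^+ 2 + 1).
have e'0 : 0 < e' by rewrite divr_gt0.
have [eta eta0 Heta] := Hd _ e'0.
have [n Hn] : exists n, 2 * L * (W / 2 ^+ n) < eta.
  have [n] : exists n : nat, 2 * L * W / eta < n%:R.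
    by exists (Num.truncn (2 * L * W / eta)).+1; exact: truncnS_gt.
  rewrite ltr_pdivrMr// => Hn; exists n; rewrite mulrA ltr_pdivrMr ?exprn_gt0//.
  apply: lt_le_trans Hn _; rewrite mulrC ler_pM2l// -natrX ler_nat.
  exact/ltnW/ltn_expl.
have [hr] := ub n; have sW : sg n + ta n = W / 2 ^+ n by rewrite -mulrDl.
pose aff w := H p + d * (w - p); pose rem w := H w - H p - d * (w - p).
have daff : cdiff_on aff.
  move=> s t _; apply: cdiffD; first exact: cdiff_cst.
  apply: cdiffM; first exact: cdiff_cst.
  exact: cdiff_subc.
have drem : cdiff_on rem.
  move=> s t Dst; apply: cdiffB.
    by apply: cdiffB; [exact: dH|exact: cdiff_cst].
  apply: cdiffM; first exact: cdiff_cst.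
  exact: cdiff_subc.
have -> : H = (fun w => aff w + rem w).
  by apply/funext => w; rewrite /aff /rem; ring.
rewrite bintD// bint_affine// add0r => /lt_le_trans.
move=> hlt.
have BB := @bint_bound rem (e' * (2 * L * (W / 2 ^+ n))) _ _ _ _ drem hr.
rewrite [_ + sg n - _]addrAC subrr add0r [_ + ta n - _]addrAC subrr add0r sW in BB.
suff /BB/hlt : forall s t, (u n).1 <= s <= (u n).1 + sg n ->
    (u n).2 <= t <= (u n).2 + ta n ->
    normc (rem (Phi s t)) <= e' * (2 * L * (W / 2 ^+ n)).
  apply/negP; rewrite -leNgt.
  have -> : 4 * (e' * (2 * L * (W / 2 ^+ n)) * L) * (W / 2 ^+ n)
      = (8 * L ^+ 2 * W ^+ 2) * e' / 4 ^+ n.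
    have -> : (4 : R) ^+ n = 2 ^+ n * 2 ^+ n by rewrite -exprMn; congr (_ ^+ _); ring.
    by field.
  apply: ler_wpM2r; first by rewrite invr_ge0 exprn_ge0.
  rewrite mulrC /e' mulrAC ler_pdivrMr// ler_pM2l//.
  by rewrite lerDl.
move=> s t hs ht; have Dst := subrectP hr hs ht.
have lip : normc (Phi s t - p) <= 2 * L * (W / 2 ^+ n).
  apply: le_trans (homotopy_lipschitz Dst Dc) _; apply: ler_wpM2l.
    by rewrite mulr_ge0.
  rewrite -sW; apply: lerD; rewrite ler_norml.
    by move: (hc1 n) hs => /andP[? ?] /andP[? ?]; lra.
  by move: (hc2 n) ht => /andP[? ?] /andP[? ?]; lra.
apply: le_trans (Heta _ (le_lt_trans lip Hn)) _.
by rewrite ler_wpM2l// ltW.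
Qed.

End Goursat.

(** * Cauchy's formula and its consequences *)

Section Circle.
Context {R : realType}.
Implicit Types (r t : R) (a z : R[i]) (phi : R -> R[i]).

Definition cis t : R[i] := cos t +i* sin t.

Definition circ r t : R[i] := (r * cos t) +i* (r * sin t).

Lemma circE r t : circ r t = r%:C * cis t.
Proof. by apply: eq_ReIm; rewrite ?ReMc ?ImMc /=; ring. Qed.

Lemma normc_cis t : normc (cis t) = 1.
Proof. by rewrite /normc /= cos2Dsin2 sqrtr1. Qed.

Lemma normc_circ r t : 0 <= r -> normc (circ r t) = r.
Proof. by move=> r0; rewrite circE normcM normc_cis normc_real mulr1 ger0_norm. Qed.

Lemma cis0 : cis 0 = 1. Proof. by rewrite /cis cos0 sin0. Qed.

Lemma cis2pi : cis (2 * pi) = 1.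
Proof. by rewrite /cis mulr_natl cos2pi sin2pi. Qed.

Lemma cderiv_cis t : cderiv cis t ('i * cis t).
Proof.
split; rewrite ?ReMc ?ImMc /= ?mul0r ?mul1r ?sub0r ?add0r.
  exact: is_derive_cos.
exact: is_derive_sin.
Qed.

Lemma ccont_cis t : ccont cis t.
Proof. exact: cderiv_cont (cderiv_cis t). Qed.

Lemma ccont_circ r t : ccont (circ r) t.
Proof.
have -> : circ r = (fun t => r%:C * cis t) by apply/funext => x; rewrite circE.
by apply: ccontM; [exact: ccont_cst|exact: ccont_cis].
Qed.

Lemma ccont_circB r a t : ccont (fun t => circ r t - a) t.
Proof. by apply: ccontB; [exact: ccont_circ|exact: ccont_cst]. Qed.

Lemma ccont_circ_lin r a t : ccont (fun t => 1 - circ r t * a) t.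
Proof.
apply: ccontB; first exact: ccont_cst.
by apply: ccontM; [exact: ccont_circ|exact: ccont_cst].
Qed.

Lemma twopi_gt0 : 0 < 2 * pi :> R.
Proof. by rewrite mulr_gt0// pi_gt0. Qed.

Lemma twopi_ge0 : 0 <= 2 * pi :> R.
Proof. exact/ltW/twopi_gt0. Qed.

(** Averaging in the parameter absorbs the factor [1 / (2 pi i)] of contour integrals: on a circle
    about 0, [dw / (i w)] is [dt]. *)
Definition cmean phi : R[i] := (2 * pi)^-1%:C * cint 0 (2 * pi) phi.

Lemma cint_cst (k : R[i]) (a b : R) : a <= b -> cint a b (fun=> k) = k * (b - a)%:C.
Proof.
move=> ab; rewrite (cint_FTC (Phi := fun t => k * t%:C) ab).
- by rewrite -mulrBr rmorphB.
- move=> t _; apply: cderiv_eq (cderivZ k (cderiv_real (is_derive_id t 1))) _.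
  exact: mulr1.
- by move=> t _; exact: ccont_cst.
Qed.

Lemma cmean_cst k : cmean (fun=> k) = k.
Proof.
rewrite /cmean cint_cst ?twopi_ge0// subr0 mulrCA -rmorphM mulVf ?mulr1//.
by rewrite gt_eqF ?twopi_gt0.
Qed.

Lemma eq_cmean phi psi : phi =1 psi -> cmean phi = cmean psi.
Proof. by move=> e; congr cmean; apply/funext. Qed.

Lemma cmeanD phi psi : (forall t, ccont phi t) -> (forall t, ccont psi t) ->
  cmean (fun t => phi t + psi t) = cmean phi + cmean psi.
Proof. by move=> cp cq; rewrite /cmean cintD// mulrDr. Qed.

Lemma cmeanB phi psi : (forall t, ccont phi t) -> (forall t, ccont psi t) ->
  cmean (fun t => phi t - psi t) = cmean phi - cmean psi.
Proof. by move=> cp cq; rewrite /cmean cintB// mulrBr. Qed.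

Lemma cmeanZ k phi : (forall t, ccont phi t) ->
  cmean (fun t => k * phi t) = k * cmean phi.
Proof. by move=> cp; rewrite /cmean cintZ// mulrCA. Qed.

Lemma ccont_sum n (F : 'I_n -> R -> R[i]) t : (forall i, ccont (F i) t) ->
  ccont (fun x => \sum_(i < n) F i x) t.
Proof.
elim: n F => [|n IH] F cF.
  under eq_fun do rewrite big_ord0; exact: ccont_cst.
under eq_fun do rewrite big_ord_recl.
by apply: ccontD => //; exact: IH.
Qed.

Lemma cmean_sum n (F : 'I_n -> R -> R[i]) : (forall i t, ccont (F i) t) ->
  cmean (fun t => \sum_(i < n) F i t) = \sum_(i < n) cmean (F i).
Proof.
elim: n F => [|n IH] F cF.
  by under eq_fun do rewrite big_ord0; rewrite big_ord0 cmean_cst.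
under eq_fun do rewrite big_ord_recl.
by rewrite cmeanD ?big_ord_recl ?IH// => t; exact: ccont_sum.
Qed.

Lemma cmean_bound phi (M : R) : (forall t, ccont phi t) ->
  (forall t, 0 <= t <= 2 * pi -> normc (phi t) <= M) -> normc (cmean phi) <= 2 * M.
Proof.
move=> cp pM; rewrite normcM normc_real ger0_norm ?invr_ge0 ?twopi_ge0//.
rewrite ler_pdivrMl ?twopi_gt0//.
have := cint_bound twopi_ge0 (fun t _ => cp t) pM.
by rewrite subr0 [2 * M * _]mulrC.
Qed.

Lemma circ_sub_ge r a t : 0 <= r -> r - normc a <= normc (circ r t - a).
Proof. by move=> r0; rewrite -{1}(normc_circ t r0) normc_sub_ge. Qed.

Lemma circ_neq r a t : normc a < r -> circ r t - a != 0.
Proof.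
move=> ar; rewrite -normc_gt0; apply: lt_le_trans (normc_sub_ge _ _).
by rewrite normc_circ ?subr_gt0// (le_trans (normc_ge0 a))// ltW.
Qed.

End Circle.

Section Cauchy.
Context {R : realType}.
Implicit Types (r rho t : R) (a z : R[i]) (g : R[i] -> R[i]).

Definition cdiff_disc g r := forall z, normc z <= r -> cdiff g z.

Lemma cdiff_cauchy_kernel a z : z - a != 0 -> cdiff (fun w => w / (w - a)) z.
Proof.
move=> za; apply: cdiffM; first exact: cdiff_id.
by apply: cdiffV => //; exact: cdiff_subc.
Qed.

Lemma ccont_circ_comp g r t : 0 <= r -> cdiff_disc g r ->
  ccont (fun t => g (circ r t)) t.
Proof.
move=> r0 dg; apply: (ccont_comp (phi := circ r)); last exact: ccont_circ.
by apply: dg; rewrite normc_circ.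
Qed.

Lemma ccont_cauchy g r a t : cdiff_disc g r -> normc a < r ->
  ccont (fun t => g (circ r t) * (circ r t / (circ r t - a))) t.
Proof.
move=> dg ar; have r0 : 0 <= r by rewrite (le_trans (normc_ge0 a))// ltW.
apply: (ccont_comp (f := fun w => g w * (w / (w - a))) (phi := circ r));
  last exact: ccont_circ.
apply: cdiffM; first by apply: dg; rewrite normc_circ.
by apply: cdiff_cauchy_kernel; exact: circ_neq.
Qed.

Lemma ccont_small_circle g r a (p : R) t : cdiff_disc g r ->
  0 < p -> p <= r - normc a -> ccont (fun t => g (a + p%:C * cis t)) t.
Proof.
move=> dg p0 pr; apply: (ccont_comp (phi := fun t => a + p%:C * cis t)).
  apply: dg; apply: le_trans (normcD_le _ _) _.
  by rewrite normcM normc_cis normc_real (ger0_norm (ltW p0)); lra.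
apply: ccontD; first exact: ccont_cst.
by apply: ccontM; [exact: ccont_cst|exact: ccont_cis].
Qed.

(** The circles of radius [r] about 0 and [p] about [a] are joined by a homotopy that moves centre
    and radius linearly; [g w / (w - a)] is differentiable along it, so [goursat] equates the two
    integrals. *)
Lemma cauchy_small_circle g r a (p : R) : cdiff_disc g r ->
  0 < p -> p <= r - normc a ->
  cint 0 (2 * pi) (fun t => g (circ r t) * (circ r t / (circ r t - a)))
  = cint 0 (2 * pi) (fun t => g (a + p%:C * cis t)).
Proof.
move=> dg p0 pr; have a0 := normc_ge0 a.
have r0 : 0 < r by lra.
have ar : normc a < r by lra.
pose A (s : R) := (1 - s) * p + s * r.
pose Phi s t := (1 - s)%:C * a + (A s)%:C * cis t.
pose Phis (s : R) t := - a + (r - p)%:C * cis t.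
pose Phit s t := (A s)%:C * ('i * cis t).
have A0 s : 0 <= s <= 1 -> 0 < A s.
  move=> /andP[s0 s1]; rewrite /A.
  have := mulr_ge0 s0 (ltW r0); have [->|sn1] := eqVneq s 1; first by lra.
  have : 0 < (1 - s) * p by rewrite mulr_gt0// subr_gt0 lt_neqAle sn1.
  lra.
have nA s t : 0 <= s <= 1 -> normc ((A s)%:C * cis t) = A s.
  by move=> /A0 /ltW h; rewrite normcM normc_cis normc_real mulr1 ger0_norm.
(* The distance to [a] is at least [A s - s |a| = p + s (r - |a| - p)], so the homotopy never meets
   the singularity. *)
have Phi_a s t : 0 <= s <= 1 -> p <= normc (Phi s t - a).
  move=> hs; have /andP[s0 s1] := hs.
  have -> : Phi s t - a = (A s)%:C * cis t - s%:C * a.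
    by rewrite /Phi rmorphB rmorph1; ring.
  apply: le_trans (normc_sub_ge _ _).
  rewrite nA// normcM normc_real ger0_norm// /A.
  have := mulr_ge0 s0 (_ : 0 <= r - normc a - p); rewrite subr_ge0 => /(_ pr).
  lra.
have Phi_r s t : 0 <= s <= 1 -> normc (Phi s t) <= r.
  move=> hs; have /andP[s0 s1] := hs.
  apply: le_trans (normcD_le _ _) _; rewrite nA// normcM normc_real.
  rewrite ger0_norm ?subr_ge0// /A.
  have := mulr_ge0 (_ : 0 <= 1 - s) (_ : 0 <= r - normc a - p).
  by rewrite !subr_ge0 => /(_ s1 pr); lra.
pose H w := g w / (w - a).
have dH : @cdiff_on R Phi 0 1 0 (2 * pi) H.
  move=> s t [hs _]; apply: cdiffM; first by apply: dg; exact: Phi_r.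
  apply: cdiffV; first by rewrite -normc_gt0 (lt_le_trans p0)//; exact: Phi_a.
  exact: cdiff_subc.
have dA (s : R) : is_derive s (1 : R) A (r - p).
  have -> : A = (fun s => p + s * (r - p)) by apply/funext => x; rewrite /A; ring.
  apply: is_derive_eq; rewrite /GRing.scale/=; ring.
have d1s (s : R) : is_derive s (1 : R) (fun s : R => 1 - s) (- 1).
  apply: is_derive_eq; rewrite /GRing.scale/=; ring.
have := @goursat R Phi Phis Phit 0 1 0 (2 * pi) (normc a + r + p) _ _ _ _ _ _ H dH ler01
  twopi_ge0.
rewrite /bint.
(* The sides [t = 0] and [t = 2 * pi] have the same image, hence cancel in [bint]; only the two
   circles remain. *)
have E1 : cint 0 1 (fun s => H (Phi s (2 * pi)) * Phis s (2 * pi))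
    = cint 0 1 (fun s => H (Phi s 0) * Phis s 0).
  by rewrite /Phi /Phis cis2pi cis0.
have E2 : cint 0 (2 * pi) (fun t => H (Phi 1 t) * Phit 1 t)
    = 'i * cint 0 (2 * pi) (fun t => g (circ r t) * (circ r t / (circ r t - a))).
  rewrite -cintZ; last by move=> t _; exact: ccont_cauchy.
  apply: eq_cint => t _; rewrite /H /Phit /Phi /A circE subrr !mul0r !mul1r !add0r.
  by ring.
have cg t := ccont_small_circle t dg p0 pr.
have E3 : cint 0 (2 * pi) (fun t => H (Phi 0 t) * Phit 0 t)
    = 'i * cint 0 (2 * pi) (fun t => g (a + p%:C * cis t)).
  rewrite -cintZ; last by [].
  apply: eq_cint => t _; rewrite /H /Phit /Phi /A subr0 mul0r !mul1r addr0 addrAC.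
  rewrite subrr add0r; have c0 : cis t != 0 by rewrite -normc_gt0 normc_cis.
  have pC : p%:C != 0 by rewrite -normc_gt0 normc_real normr_gt0 gt_eqF.
  by field; apply/andP.
rewrite E1 E2 E3 [X in X - _ = _]addrC addKr => E.
suff /subr0_eq/mulfI : 'i * cint 0 (2 * pi) (fun t => g (circ r t) * (circ r t / (circ r t - a)))
   - 'i * cint 0 (2 * pi) (fun t => g (a + p%:C * cis t)) = 0.
  by apply; rewrite -normc_gt0 normc_i.
apply: E.
- move=> s t _; apply: cderiv_eq (cderivD (cderivM (cderiv_real (d1s s)) (cderiv_cst a s))
    (cderivM (cderiv_real (dA s)) (cderiv_cst (cis t) s))) _.
  by rewrite /Phis rmorphN rmorph1; ring.
- move=> s t _; apply: cderiv_eq (cderivD (cderiv_cst _ t) (cderivZ (A s)%:C (cderiv_cis t))) _.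
  by rewrite add0r.
- by move=> s t _; exact: ccont_cst.
- move=> s t _; apply: ccontM; first exact: ccont_cst.
  by apply: ccontM; [exact: ccont_cst|exact: ccont_cis].
- move=> s t _; apply: le_trans (normcD_le _ _) _.
  rewrite normc_opp normcM normc_cis normc_real mulr1 -addrA lerD2l ger0_norm; lra.
- move=> s t [hs _]; rewrite /Phit mulrCA normcM nA//.
  rewrite normc_i mul1r /A; case/andP: hs => s0 s1.
  have := mulr_ge0 (_ : 0 <= 1 - s) (ltW r0); have := mulr_ge0 s0 (ltW p0).
  by rewrite subr_ge0 => ? /(_ s1); lra.
Qed.

(** The integral does not depend on the small circle about [a], and by continuity of [g] its mean
    differs from [g a] by at most any given [e]. *)
Lemma cauchy_formula g r a : cdiff_disc g r -> normc a < r ->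
  cmean (fun t => g (circ r t) * (circ r t / (circ r t - a))) = g a.
Proof.
move=> dg ar; apply/subr0_eq/eqP; rewrite -normc_eq0 eq_le normc_ge0 andbT.
apply/ler_addgt0Pr => e e0; rewrite add0r.
have da : cdiff g a by apply: dg; exact: ltW.
have [d hd] := da; have e2 : 0 < e / 2 by rewrite divr_gt0.
have [eta eta0 Heta] := has_cderiv_cont hd e2.
pose p := Num.min (eta / 2) (r - normc a).
have p0 : 0 < p by rewrite lt_min divr_gt0//= subr_gt0.
have pr : p <= r - normc a by rewrite ge_min lexx orbT.
rewrite /cmean (cauchy_small_circle dg p0 pr).
have cg t := ccont_small_circle t dg p0 pr.
rewrite -/(cmean _) -[X in _ - X]cmean_cst -cmeanB//; last by move=> t; exact: ccont_cst.
have -> : e = 2 * (e / 2) by field.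
apply: cmean_bound => [t|t _]; first by apply: ccontB => //; exact: ccont_cst.
apply: Heta; rewrite addrC addKr normcM normc_cis normc_real mulr1 (ger0_norm (ltW p0)).
apply: le_lt_trans (_ : eta / 2 < eta); first by rewrite ge_min lexx.
by rewrite ltr_pdivrMr//; lra.
Qed.

(** Cauchy's formulas at [a] and 0 on a common circle have kernels that differ by [a / (w - a)], of
    size at most [|a| / (r - |a|)]. *)
Lemma liouville g (M : R) : (forall z, cdiff g z) -> (forall z, normc (g z) <= M) ->
  forall z, g z = g 0.
Proof.
move=> dg gM a; apply/subr0_eq/eqP; rewrite -normc_eq0 eq_le normc_ge0 andbT.
apply/ler_addgt0Pr => e e0; rewrite add0r.
have M0 : 0 <= M := le_trans (normc_ge0 _) (gM 0).
have a0 := normc_ge0 a.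
(* Chosen so that [2 M |a| / (r - |a|) <= e], where the 2 is the loss of [cmean_bound]. *)
pose r := normc a + 2 * (M * normc a) / e + 1.
have K0 : 0 <= 2 * (M * normc a) / e.
  by rewrite divr_ge0 ?(ltW e0)// mulr_ge0// mulr_ge0.
have ar : normc a < r by rewrite /r; lra.
have r0 : normc (0 : R[i]) < r by rewrite normc0; lra.
have dr : cdiff_disc g r by move=> z _; exact: dg.
rewrite -(cauchy_formula dr ar) -(cauchy_formula dr r0) -cmeanB; try by
  move=> t; exact: ccont_cauchy.
have -> : e = 2 * (M * (normc a / (r - normc a))) + (e - 2 * (M * (normc a / (r - normc a)))).
  by rewrite addrCA subrr addr0.
rewrite ler_wpDr//.
  have E : e * (r - normc a) = 2 * (M * normc a) + e.
    by rewrite /r; field; rewrite gt_eqF.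
  rewrite subr_ge0 !mulrA ler_pdivrMr ?subr_gt0// E -mulrA.
  by rewrite lerDl ltW.
apply: cmean_bound => [t|t _]; first by apply: ccontB; exact: ccont_cauchy.
rewrite -mulrBr normcM ler_pM ?normc_ge0//.
have c0 := circ_neq t r0; have ca := circ_neq t ar.
rewrite subr0 in c0 *.
have -> : circ r t / (circ r t - a) - circ r t / circ r t = a / (circ r t - a).
  by field; apply/andP.
rewrite normcM normcV ler_wpM2l// lef_pV2 ?posrE ?subr_gt0 ?normc_gt0//.
by apply: le_trans (normc_sub_ge _ _); rewrite normc_circ//; lra.
Qed.

End Cauchy.

(** * Means over circles and the Poisson formula *)

Section CircleMean.
Context {R : realType}.
Implicit Types (u v : R -> R).
Let mu := @lebesgue_measure R.

Definition rint u : Prop := mu.-integrable `[0, 2 * pi] (EFin \o u).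

Definition rmean u : R := (2 * pi)^-1 * \int[mu]_(t in `[0, 2 * pi]) u t.

Lemma Re_cmean phi : Re (cmean phi) = rmean (fun t => Re (phi t)).
Proof. by rewrite /cmean ReMc /= mul0r subr0. Qed.

Lemma eq_rmean u v : (forall t, u t = v t) -> rmean u = rmean v.
Proof. by move=> e; congr (_ * _); apply: eq_Rintegral => t _. Qed.

Lemma eq_rint u v : (forall t, u t = v t) -> rint u -> rint v.
Proof. by move=> e; rewrite /rint (_ : v = u)//; apply/funext => t. Qed.

Lemma rint_cont u : (forall t : R, continuous_at t u) -> rint u.
Proof. by move=> cu; apply: continuous_itv_integrable => t _; exact: cu. Qed.

Lemma rint_cst (k : R) : rint (fun=> k).
Proof. by apply: rint_cont => t; exact: cvg_cst. Qed.

Lemma rintD u v : rint u -> rint v -> rint (fun t => u t + v t).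
Proof. by move=> iu iv; apply: (@integrableD _ _ _ mu _ _ (EFin \o u) (EFin \o v)). Qed.

Lemma rintB u v : rint u -> rint v -> rint (fun t => u t - v t).
Proof. by move=> iu iv; apply: (@integrableB _ _ _ mu _ _ (EFin \o u) (EFin \o v)). Qed.

Lemma rintZ (k : R) u : rint u -> rint (fun t => k * u t).
Proof.
by move=> iu; apply: (@integrableZl _ _ _ mu _ _ k (EFin \o u)).
Qed.

Lemma rint_abs u : rint u -> rint (fun t => `|u t|).
Proof. exact: integrable_norm. Qed.

Lemma rint_sum (I : Type) (s : seq I) (F : I -> R -> R) :
  (forall i, rint (F i)) -> rint (fun t => \sum_(i <- s) F i t).
Proof.
move=> H; elim: s => [|i s IH].
  by apply: eq_rint (rint_cst 0) => t; rewrite big_nil.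
by apply: eq_rint (rintD (H i) IH) => t; rewrite big_cons.
Qed.

Lemma twopi_inv_ge0 : 0 <= (2 * pi)^-1 :> R.
Proof. by rewrite invr_ge0 twopi_ge0. Qed.

Lemma rmean_cst (k : R) : rmean (fun=> k) = k.
Proof.
rewrite /rmean Rintegral_cst//= lebesgue_measure_itv/= lte_fin twopi_gt0/= subr0.
by rewrite mulrCA mulVf ?mulr1// gt_eqF ?twopi_gt0.
Qed.

Lemma rmeanD u v : rint u -> rint v -> rmean (fun t => u t + v t) = rmean u + rmean v.
Proof. by move=> iu iv; rewrite /rmean RintegralD// mulrDr. Qed.

Lemma rmeanB u v : rint u -> rint v -> rmean (fun t => u t - v t) = rmean u - rmean v.
Proof. by move=> iu iv; rewrite /rmean RintegralB// mulrBr. Qed.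

Lemma rmeanZ (k : R) u : rint u -> rmean (fun t => k * u t) = k * rmean u.
Proof. by move=> iu; rewrite /rmean RintegralZl// mulrCA. Qed.

Lemma rmean_sum (I : Type) (s : seq I) (F : I -> R -> R) :
  (forall i, rint (F i)) ->
  rmean (fun t => \sum_(i <- s) F i t) = \sum_(i <- s) rmean (F i).
Proof.
move=> H; elim: s => [|i s IH].
  by rewrite big_nil -[RHS](rmean_cst 0); apply: eq_rmean => t; rewrite big_nil.
rewrite big_cons -IH -rmeanD//; last exact: rint_sum.
by apply: eq_rmean => t; rewrite big_cons.
Qed.

Lemma le_rmean u v : rint u -> rint v -> (forall t, u t <= v t) -> rmean u <= rmean v.
Proof.
move=> iu iv uv; rewrite ler_wpM2l ?twopi_inv_ge0//.
by apply: le_Rintegral => // t _; exact: uv.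
Qed.

Lemma rmean_ge0 u : (forall t, 0 <= u t) -> 0 <= rmean u.
Proof.
by move=> u0; rewrite mulr_ge0 ?twopi_inv_ge0// Rintegral_ge0// => t _; exact: u0.
Qed.

Lemma le_norm_rmean u : rint u -> `|rmean u| <= rmean (fun t => `|u t|).
Proof.
move=> iu; rewrite normrM ger0_norm ?twopi_inv_ge0// ler_wpM2l ?twopi_inv_ge0//.
exact: le_normr_Rintegral.
Qed.

End CircleMean.

Section PoissonKernel.
Context {R : realType} (rho : R).
Implicit Types (z w : R[i]) (t : R).

Definition pois z t : R := (rho ^+ 2 - normc z ^+ 2) / normc (circ rho t - z) ^+ 2.

Lemma rho_gt0 z : normc z < rho -> 0 < rho.
Proof. exact/le_lt_trans/normc_ge0. Qed.

Lemma sqr_sub_gt0 z : normc z < rho -> 0 < rho ^+ 2 - normc z ^+ 2.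
Proof.
move=> zr; have r0 := rho_gt0 zr; rewrite subr_sqr mulr_gt0 ?subr_gt0//.
by rewrite ltr_wpDr// normc_ge0.
Qed.

Lemma pois_ge0 z t : normc z < rho -> 0 <= pois z t.
Proof. by move=> zr; rewrite divr_ge0 ?sqr_ge0// ltW// sqr_sub_gt0. Qed.

(** On the circle [|zeta - z| >= rho - |z|]. Together with [pois_ge] this is Harnack's bound; it
    confines the kernel to [[1/3, 3]] when [|z| <= rho / 2]. *)
Lemma pois_le z t : normc z < rho ->
  pois z t <= (rho + normc z) / (rho - normc z).
Proof.
move=> zr; have r0 := rho_gt0 zr; have d0 : 0 < rho - normc z by rewrite subr_gt0.
have dc := circ_sub_ge z t (ltW r0).
have c0 := lt_le_trans d0 dc.
have s0 : 0 <= rho + normc z by rewrite addr_ge0 ?normc_ge0 ?(ltW r0).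
rewrite /pois ler_pdivrMr ?exprn_gt0// mulrAC ler_pdivlMr//.
rewrite (_ : (_ - _) * _ = (rho + normc z) * (rho - normc z) ^+ 2); last by ring.
by rewrite ler_wpM2l// ler_pXn2r ?nnegrE ?(ltW d0) ?normc_ge0.
Qed.

Lemma pois_ge z t : normc z < rho ->
  (rho - normc z) / (rho + normc z) <= pois z t.
Proof.
move=> zr; have r0 := rho_gt0 zr; have z0 := normc_ge0 z.
have s0 : 0 < rho + normc z by rewrite ltr_wpDr.
have d0 : 0 < rho - normc z by rewrite subr_gt0.
have dc : normc (circ rho t - z) <= rho + normc z.
  by apply: le_trans (normcB_le _ _) _; rewrite normc_circ// ltW.
have c0 : 0 < normc (circ rho t - z) by rewrite normc_gt0 circ_neq.
rewrite /pois ler_pdivlMr ?exprn_gt0// mulrAC ler_pdivrMr//.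
rewrite (_ : (_ - _) * (_ + _) = (rho - normc z) * (rho + normc z) ^+ 2); last by ring.
by rewrite ler_wpM2l ?(ltW d0)// ler_pXn2r ?nnegrE ?(ltW s0) ?normc_ge0.
Qed.

(** The first term is the Cauchy kernel at [z]. The second is the Cauchy kernel of the reflected
    point [rho^2 / conj z], which lies outside the disc, so it is a holomorphic factor there. *)
Lemma poisE z t : normc z < rho ->
  (pois z t)%:C = circ rho t / (circ rho t - z)
    - circ rho t * z^* / (circ rho t * z^* - (rho ^+ 2)%:C).
Proof.
move=> zr; have c0 := circ_neq t zr; have r0 := rho_gt0 zr.
set x := circ rho t in c0 *.
have xx : x * x^* = (rho ^+ 2)%:C by rewrite mul_conjc normc_circ// ltW.
have x0 : x != 0 by rewrite -normc_gt0 normc_circ// ltW.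
have cc : (x - z)^* != 0 by rewrite conjc_eq0.
have E : x^* - z^* != 0 by rewrite -rmorphB.
have zz : z * z^* = (normc z ^+ 2)%:C := mul_conjc z.
have F : (x - z) * (x^* - z^*) = (normc (x - z) ^+ 2)%:C by rewrite -rmorphB mul_conjc.
rewrite /pois rmorphM rmorphB fmorphV /= -/x -F -xx -zz.
clear zz F xx cc; move: E; generalize (z^*); generalize (x^*) => x' z' E.
field; apply/and3P; split => //.
by rewrite -mulrBr mulf_neq0// -opprB oppr_eq0.
Qed.

Lemma pois_Re z t : normc z < rho ->
  pois z t = Re ((circ rho t + z) / (circ rho t - z)).
Proof.
move=> zr; have c0 := circ_neq t zr; have r0 := rho_gt0 zr.
have E : (circ rho t + z) / (circ rho t - z) =
    (circ rho t + z) * (circ rho t - z)^* * ((normc (circ rho t - z) ^+ 2)^-1)%:C.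
  rewrite fmorphV /= -mul_conjc; have : (circ rho t - z)^* != 0 by rewrite conjc_eq0.
  by generalize ((circ rho t - z)^*) => y y0; field; apply/andP.
have n2 : rho ^+ 2 = normc (circ rho t) ^+ 2 by rewrite normc_circ// ltW.
rewrite E ReMc /= mulr0 subr0 /pois n2; congr (_ * _).
by rewrite !sqr_normc_ReIm; case: (circ rho t) => a b; case: z {zr c0 E} => c d /=; ring.
Qed.

Lemma pois_dist z w t (s : R) : normc z <= s -> normc w <= s -> s < rho ->
  `|pois z t - pois w t| <= 2 * rho * normc (z - w) / (rho - s) ^+ 2.
Proof.
move=> zs ws sr; have zr := le_lt_trans zs sr; have wr := le_lt_trans ws sr.
have r0 := rho_gt0 zr; have d0 : 0 < rho - s by rewrite subr_gt0.
rewrite !pois_Re// -ReNc -ReDc; apply: le_trans (Re_le_normc _) _.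
have cz := circ_neq t zr; have cw := circ_neq t wr.
have -> : (circ rho t + z) / (circ rho t - z) - (circ rho t + w) / (circ rho t - w)
    = 2%:R * circ rho t * (z - w) / ((circ rho t - z) * (circ rho t - w)).
  by field; apply/andP.
have n2 : normc (2%:R : R[i]) = 2.
  by rewrite -(rmorph_nat (real_complex R)) normc_real ger0_norm.
rewrite 3!normcM normcV n2 normc_circ ?(ltW r0)// ler_wpM2l//.
  by rewrite !mulr_ge0 ?normc_ge0// ltW.
have dz : rho - s <= normc (circ rho t - z).
  by apply: le_trans (circ_sub_ge _ _ (ltW r0)); lra.
have dw : rho - s <= normc (circ rho t - w).
  by apply: le_trans (circ_sub_ge _ _ (ltW r0)); lra.
rewrite lef_pV2 ?posrE ?exprn_gt0// normcM ?mulr_gt0 ?normc_gt0//.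
by rewrite expr2 ler_pM// ltW.
Qed.

Lemma pois_cont z t : normc z < rho -> continuous_at t (pois z).
Proof.
move=> zr.
have -> : pois z = (fun t => Re ((circ rho t + z) / (circ rho t - z))).
  by apply/funext => x; rewrite pois_Re.
have [//] : ccont (fun t => (circ rho t + z) / (circ rho t - z)) t.
apply: (ccont_comp (f := fun x => (x + z) / (x - z))); last exact: ccont_circ.
apply: cdiffM; first by apply: cdiffD; [exact: cdiff_id|exact: cdiff_cst].
apply: cdiffV; first exact: circ_neq.
exact: cdiff_subc.
Qed.

(** By [poisE] the Poisson mean is Cauchy's formula at [z] minus the mean of [k], and the latter is
    [k 0 = 0] by Cauchy's formula at the centre. *)
Lemma poisson_holomorphic h z : cdiff_disc h rho -> normc z < rho ->
  Re (h z) = rmean (fun t => Re (h (circ rho t)) * pois z t).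
Proof.
move=> dh zr; have r0 := rho_gt0 zr.
pose k w := h w * (w * z^* / (w * z^* - (rho ^+ 2)%:C)).
have dk : cdiff_disc k rho.
  move=> w wr; have wz : w * z^* - (rho ^+ 2)%:C != 0.
    rewrite -normc_gt0 normcBC; apply: lt_le_trans (normc_sub_ge _ _).
    rewrite normcM normc_conj normc_real ger0_norm ?exprn_ge0 ?(ltW r0)// subr_gt0.
    apply: le_lt_trans (_ : rho * normc z < _).
      by rewrite ler_wpM2r ?normc_ge0.
    by rewrite expr2 ltr_pM2l.
  apply: cdiffM; first exact: dh.
  have dm : cdiff (fun w => w * z^*) w.
    by apply: cdiffM; [exact: cdiff_id|exact: cdiff_cst].
  by apply: cdiffM => //; apply: cdiffV => //; apply: cdiffB => //; exact: cdiff_cst.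
have zero : normc (0 : R[i]) < rho by rewrite normc0.
have K0 : cmean (fun t => k (circ rho t)) = 0.
  rewrite -[RHS](_ : k 0 = 0); last by rewrite /k !mul0r mulr0.
  rewrite -(cauchy_formula dk zero); apply: eq_cmean => t.
  have c0 := circ_neq t zero; rewrite subr0 in c0 *.
  by rewrite divff// mulr1.
rewrite -(cauchy_formula dh zr) -[cmean _]subr0 -K0 -cmeanB.
- rewrite Re_cmean; apply: eq_rmean => t.
  by rewrite /k -mulrBr -poisE// ReMc /= mulr0 subr0.
- by move=> t; exact: ccont_cauchy.
- by move=> t; apply: ccont_circ_comp => //; exact: ltW.
Qed.

Lemma rmean_pois z : normc z < rho -> rmean (pois z) = 1.
Proof.
move=> zr; have dh : cdiff_disc (fun=> 1 : R[i]) rho by move=> w _; exact: cdiff_cst.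
have := poisson_holomorphic dh zr; rewrite /= => ->.
by apply: eq_rmean => t; rewrite mul1r.
Qed.

Lemma rint_pois z : normc z < rho -> rint (pois z).
Proof. by move=> zr; apply: rint_cont => t; exact: pois_cont. Qed.

Lemma rintM_pois (u : R -> R) z : normc z < rho -> (forall t : R, continuous_at t u) ->
  rint (fun t => u t * pois z t).
Proof.
move=> zr cu; apply: rint_cont => t.
by apply: continuousM; [exact: cu|exact: pois_cont].
Qed.

Lemma rmean_pois_dist (u v : R -> R) z (e : R) : normc z < rho ->
  (forall t : R, continuous_at t u) -> (forall t : R, continuous_at t v) ->
  (forall t, `|u t - v t| <= e) ->
  `|rmean (fun t => u t * pois z t) - rmean (fun t => v t * pois z t)| <= e.
Proof.
move=> zr cu cv uv.
have iu := rintM_pois zr cu; have iv := rintM_pois zr cv.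
rewrite -rmeanB//; apply: le_trans (le_norm_rmean (rintB iu iv)) _.
rewrite -[e]mulr1 -[1](rmean_pois zr) -rmeanZ; last exact: rint_pois.
apply: le_rmean; first exact/rint_abs/rintB.
  by apply: rintZ; exact: rint_pois.
move=> t; rewrite -mulrBl normrM (ger0_norm (pois_ge0 _ zr)).
by rewrite ler_wpM2r ?pois_ge0.
Qed.

End PoissonKernel.

(** * Polynomial approximation and the logarithm of the modulus *)

Section PolynomialApproximation.
Context {R : realType}.
Implicit Types (g : R[i] -> R[i]).

Lemma geometric_small (K q e : R) : 0 <= q < 1 -> 0 < e -> exists N, K * q ^+ N <= e.
Proof.
move=> /andP[q0 q1] e0.
have nq : `|q| < 1 by rewrite ger0_norm.
have /cvgrPdist_le /(_ _ e0) [N _ HN] := cvg_geometric K nq.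
exists N; have := HN N (leqnn N); rewrite /geometric /= sub0r normrN.
by apply: le_trans; exact: ler_norm.
Qed.

Lemma circle_bounded g r : 0 <= r -> cdiff_disc g r ->
  exists M : R, forall t, 0 <= t <= 2 * pi -> normc (g (circ r t)) <= M.
Proof.
move=> r0 dg.
have c : {within `[0, 2 * pi], continuous (fun t => normc (g (circ r t)))}.
  apply: continuous_in_subspaceT => t _; apply: ccont_normc.
  exact: ccont_circ_comp.
have [t _ Ht] := EVT_max twopi_ge0 c; exists (normc (g (circ r t))) => x x2.
by apply: Ht; rewrite in_itv.
Qed.

(** The polynomial is a Taylor polynomial at 0, obtained by expanding the Cauchy kernel on the
    larger circle in powers of [z / zeta]. The remainder carries the factor [(z / zeta)^N], at most
    [(rho / r)^N] in modulus, which makes it uniformly small. *)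
Lemma poly_approx g r rho (e : R) : cdiff_disc g r -> 0 <= rho < r -> 0 < e ->
  exists p : {poly R[i]}, forall z, normc z <= rho -> normc (g z - p.[z]) <= e.
Proof.
move=> dg /andP[rho0 rr] e0; have r0 : 0 < r := le_lt_trans rho0 rr.
have [M HM] := circle_bounded (ltW r0) dg.
have M0 : 0 <= M by apply: le_trans (HM 0 _); rewrite ?normc_ge0// lexx twopi_ge0.
have d0 : 0 < r - rho by rewrite subr_gt0.
have q01 : 0 <= rho / r < 1 by rewrite divr_ge0 ?(ltW r0)//= ltr_pdivrMr// mul1r.
have [N HN] := geometric_small (2 * (M * (r / (r - rho)))) q01 e0.
pose co n := cmean (fun t => g (circ r t) * (circ r t)^-1 ^+ n).
have cn t : circ r t != 0 by have := @circ_neq _ r 0 t; rewrite normc0 subr0; exact.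
have cterm n t : ccont (fun t => g (circ r t) * (circ r t)^-1 ^+ n) t.
  apply: ccontM; first by apply: ccont_circ_comp => //; exact: ltW.
  apply: (ccont_comp (f := fun w => w^-1 ^+ n) (phi := circ r)); last exact: ccont_circ.
  have -> : (fun w : R[i] => w^-1 ^+ n) = (fun w => (w ^+ n)^-1).
    by apply/funext => w; rewrite exprVn.
  by apply: cdiffV; [rewrite expf_neq0|exact: cdiffX].
exists (\poly_(i < N) co i) => z zr.
have zr' : normc z < r := le_lt_trans zr rr.
rewrite horner_poly -(cauchy_formula dg zr').
under eq_bigr do rewrite mulrC -cmeanZ//.
rewrite -cmean_sum; last first.
  by move=> i t; apply: ccontM; [exact: ccont_cst|exact: cterm].
rewrite -cmeanB; first last.
- by move=> t; apply: ccont_sum => i; apply: ccontM; [exact: ccont_cst|exact: cterm].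
- by move=> t; exact: ccont_cauchy.
apply: le_trans HN; rewrite -!mulrA; apply: cmean_bound.
  move=> t; apply: ccontB; first exact: ccont_cauchy.
  by apply: ccont_sum => i; apply: ccontM; [exact: ccont_cst|exact: cterm].
move=> t ht; have c0 := cn t; have cz := circ_neq t zr'.
have -> : g (circ r t) * (circ r t / (circ r t - z))
    - \sum_(i < N) z ^+ i * (g (circ r t) * (circ r t)^-1 ^+ i)
    = g (circ r t) * (circ r t / (circ r t - z)) * (z / circ r t) ^+ N.
  under eq_bigr do rewrite mulrCA -exprMn.
  rewrite -mulr_sumr; set y := z / circ r t.
  have E : circ r t / (circ r t - z) * (1 - y) = 1 by rewrite /y; field; apply/andP.
  have S : \sum_(i < N) y ^+ i = circ r t / (circ r t - z) * (1 - y ^+ N).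
    rewrite -[X in _ * X]opprB subrX1 -mulNr opprB mulrA E mul1r.
    by apply: eq_bigr.
  by rewrite S; ring.
rewrite -mulrA !normcM normcX normcM !normcV normc_circ ?(ltW r0)// -!mulrA.
apply: ler_pM; rewrite ?normc_ge0 ?HM//.
  by rewrite !mulr_ge0 ?invr_ge0 ?exprn_ge0 ?normc_ge0 ?divr_ge0 ?(ltW r0)// ?normc_ge0.
apply: ler_wpM2l; first exact: ltW.
apply: ler_pM.
- by rewrite invr_ge0 normc_ge0.
- by rewrite exprn_ge0 // divr_ge0 ?normc_ge0 ?(ltW r0).
- rewrite lef_pV2 ?posrE ?normc_gt0//; apply: le_trans (normc_sub_ge _ _).
  by rewrite normc_circ ?(ltW r0)//; lra.
- rewrite lerXn2r ?nnegrE ?divr_ge0 ?normc_ge0 ?(ltW r0)//.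
  by rewrite ler_pM2r ?invr_gt0.
Qed.

End PolynomialApproximation.

Section LogModulus.
Context {R : realType}.
Implicit Types (x z a u : R[i]) (t : R).

(** Writing [ln |phi|] as half the logarithm of [Re^2 + Im^2] gives the real part of the logarithmic
    derivative without any branch of the complex logarithm. *)
Lemma is_derive_ln_normc (phi : R -> R[i]) t d : cderiv phi t d -> phi t != 0 ->
  is_derive t (1 : R) (fun s => ln (normc (phi s))) (Re (d / phi t)).
Proof.
move=> [dR dI] p0; pose n2 s := Re (phi s) ^+ 2 + Im (phi s) ^+ 2.
have n20 : 0 < n2 t by rewrite /n2 -sqr_normc_ReIm exprn_gt0// normc_gt0.
have -> : (fun s => ln (normc (phi s))) = (fun s => 2^-1 * ln (n2 s)).
  apply/funext => s; rewrite /n2 -sqr_normc_ReIm.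
  have [->|s0] := eqVneq (phi s) 0; first by rewrite normc0 expr0n /= ln0 // mulr0.
  by rewrite lnXn ?normc_gt0// -[X in 2^-1 * X]mulr_natl mulrA mulVf// mul1r.
have dn : is_derive t (1 : R) n2 (2 * (Re d * Re (phi t) + Im d * Im (phi t))).
  have -> : n2 = (fun s => Re (phi s) * Re (phi s) + Im (phi s) * Im (phi s)).
    by apply/funext => s; rewrite /n2 !expr2.
  apply: is_derive_eq (is_deriveD (is_deriveM dR dR) (is_deriveM dI dI)) _.
  by rewrite /GRing.scale /=; ring.
have dl := is_derive1_comp (is_derive1_ln n20) dn.
apply: is_derive_eq (is_deriveZ 2^-1 dl) _; rewrite /GRing.scale /=.
move: n20; rewrite /n2; case: (phi t) p0 => p q p0 /=; case: d {dR dI dn dl} => d e /=.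
rewrite /= => n20; have := gt_eqF n20 => n0; field.
by rewrite n0.
Qed.

(** The Taylor polynomial of degree [N] at 0 of [log (1 - x)]. *)
Definition logtaylor N x : R[i] := - \sum_(i < N) x ^+ i.+1 / i.+1%:R.

Lemma cdiff_logtaylor N z u : cdiff (fun w => logtaylor N (w * u)) z.
Proof.
have -> : (fun w => logtaylor N (w * u))
    = (fun w => \sum_(i < N) w ^+ i.+1 * (- (u ^+ i.+1 / i.+1%:R))).
  apply/funext => w; rewrite /logtaylor -sumrN; apply: eq_bigr => i _.
  by rewrite exprMn mulrN mulrA.
by apply: cdiff_sum => i; apply: cdiffM; [exact: cdiffX|exact: cdiff_cst].
Qed.

Lemma cderivX (phi : R -> R[i]) t d n : cderiv phi t d ->
  cderiv (fun s => phi s ^+ n.+1) t (n.+1%:R * phi t ^+ n * d).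
Proof.
move=> dp; elim: n => [|n IH].
  by apply: cderiv_eq dp _; rewrite expr0 !mul1r.
have -> : (fun s => phi s ^+ n.+2) = (fun s => phi s * phi s ^+ n.+1).
  by apply/funext => s; rewrite exprS.
apply: cderiv_eq (cderivM dp IH) _.
by rewrite [n.+2%:R]mulrS exprS; ring.
Qed.

Lemma cderiv_sum n (F : 'I_n -> R -> R[i]) t (d : 'I_n -> R[i]) :
  (forall i, cderiv (F i) t (d i)) ->
  cderiv (fun s => \sum_(i < n) F i s) t (\sum_(i < n) d i).
Proof.
elim: n F d => [|n IH] F d H.
  by under eq_fun do rewrite big_ord0; rewrite big_ord0; exact: cderiv_cst.
under eq_fun do rewrite big_ord_recl.
by rewrite big_ord_recl; apply: cderivD => //; exact: IH.
Qed.

(** Mean value theorem along the segment from 0 to [x]: summing the geometric series leaves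
    [- Re (x (s x)^N / (1 - s x))] as derivative of the difference. *)
Lemma log_approx N x (q : R) : normc x <= q -> q < 1 ->
  `|ln (normc (1 - x)) - Re (logtaylor N x)| <= q ^+ N.+1 / (1 - q).
Proof.
move=> xq q1; have q0 : 0 <= q := le_trans (normc_ge0 _) xq.
have sx (s : R) : 0 <= s <= 1 -> normc (s%:C * x) <= q.
  move=> /andP[s0 s1]; rewrite normcM normc_real ger0_norm//.
  by apply: le_trans xq; rewrite ler_piMl ?normc_ge0.
have n1 (s : R) : 0 <= s <= 1 -> 1 - q <= normc (1 - s%:C * x).
  move=> hs; apply: le_trans (normc_sub_ge _ _).
  by rewrite normc1; have := sx s hs; lra.
have n0 (s : R) : 0 <= s <= 1 -> 1 - s%:C * x != 0.
  by move=> /n1 h; rewrite -normc_gt0 (lt_le_trans _ h)// subr_gt0.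
pose D s := ln (normc (1 - s%:C * x)) - Re (logtaylor N (s%:C * x)).
pose D' s := - Re (x * (s%:C * x) ^+ N / (1 - s%:C * x)).
have dD (s : R) : 0 <= s <= 1 -> is_derive s (1 : R) D (D' s).
  move=> hs.
  have dx : cderiv (fun s => s%:C * x) s x.
    apply: cderiv_eq (cderivM (cderiv_real (is_derive_id s 1)) (cderiv_cst x s)) _.
    by rewrite mul1r mulr0 addr0.
  have d1 : cderiv (fun s => 1 - s%:C * x) s (- x).
    have -> : (fun s : R => 1 - s%:C * x) = (fun s => 1 + (-1) * (s%:C * x)).
      by apply/funext => y; rewrite mulN1r.
    apply: cderiv_eq (cderivD (cderiv_cst 1 s) (cderivZ (-1) dx)) _.
    by rewrite add0r mulN1r.
  have dl := is_derive_ln_normc d1 (n0 s hs).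
  have [dt _] : cderiv (fun s => logtaylor N (s%:C * x)) s
      (- \sum_(i < N) (s%:C * x) ^+ i * x).
    have -> : (fun s => logtaylor N (s%:C * x)) = (fun s => (-1) *
        \sum_(i < N) (i.+1%:R)^-1 * (s%:C * x) ^+ i.+1).
      apply/funext => y; rewrite mulN1r; congr (- _).
      by apply: eq_bigr => i _; rewrite mulrC.
    apply: cderiv_eq (cderivZ (-1) (cderiv_sum (fun i : 'I_N =>
      cderivZ (i.+1%:R)^-1 (cderivX i dx)))) _.
    rewrite mulN1r; congr (- _); apply: eq_bigr => i _.
    by rewrite -!mulrA mulKf// pnatr_eq0.
  apply: is_derive_eq (is_deriveB dl dt) _.
  rewrite /D' -!ReNc -ReDc; congr (Re _).
  rewrite opprK -mulr_suml; set y := s%:C * x.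
  have y1 : 1 - y != 0 := n0 s hs.
  have S : \sum_(i < N) y ^+ i = (1 - y ^+ N) / (1 - y).
    by apply: (mulfI y1); rewrite mulrCA divff// mulr1 -opprB mulNr -subrX1 opprB.
  by rewrite S; field.
have cD (s : R) : 0 <= s <= 1 -> {for s, continuous D}.
  by move=> /dD; exact: is_derive_continuous.
have [||c] := @MVT_segment R D D' 0 1 ler01.
- by move=> s; rewrite in_itv/= => /andP[/ltW ? /ltW ?]; apply: dD; apply/andP.
- apply: continuous_in_subspaceT => s; rewrite inE/= in_itv/=; exact: cD.
have -> : D 0 = 0.
  rewrite /D mul0r subr0 normc1 ln1 sub0r /logtaylor.
  by rewrite big1 ?oppr0// => i _; rewrite expr0n mul0r.
rewrite in_itv/= => hc; rewrite !subr0 mulr1 /D rmorph1 mul1r => ->.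
rewrite /D' normrN; apply: le_trans (Re_le_normc _) _.
rewrite 2!normcM normcV normcX exprS.
have q1' : 0 < 1 - q by rewrite subr_gt0.
apply: ler_pM; rewrite ?mulr_ge0 ?invr_ge0 ?exprn_ge0 ?normc_ge0//.
  apply: ler_pM; rewrite ?exprn_ge0 ?normc_ge0// lerXn2r ?nnegrE ?normc_ge0//.
  exact: sx.
by rewrite lef_pV2 ?posrE ?n1// (lt_le_trans q1')// n1.
Qed.

Lemma ccont_ln_normc (phi : R -> R[i]) t : ccont phi t -> phi t != 0 ->
  continuous_at t (fun s => ln (normc (phi s))).
Proof.
move=> cphi p0.
apply: (@continuous_comp _ _ _ (fun s => normc (phi s)) (@ln R)).
  exact: ccont_normc.
by apply: continuous_ln; rewrite normc_gt0.
Qed.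

(** Since [|z u| <= rho |u| < 1] on the closed disc, [ln |1 - z u|] is there a uniform limit of real
    parts of polynomials, for which Poisson's formula is known, and Poisson means respect uniform
    limits. *)
Lemma poisson_log1 rho z u : normc z < rho -> rho * normc u < 1 ->
  ln (normc (1 - z * u)) = rmean (fun t => ln (normc (1 - circ rho t * u)) * pois rho z t).
Proof.
move=> zr ur; have r0 := rho_gt0 zr; set q := rho * normc u in ur.
have q0 : 0 <= q by rewrite mulr_ge0 ?normc_ge0 ?(ltW r0).
apply/subr0_eq/eqP; rewrite -normr_eq0 eq_le normr_ge0 andbT.
apply/ler_addgt0Pr => e e0; rewrite add0r.
have q1 : 0 < 1 - q by rewrite subr_gt0.
have e2 : 0 < e / 2 * (1 - q) by rewrite mulr_gt0// divr_gt0.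
have [N HN] := geometric_small q (introT andP (conj q0 ur)) e2.
have err : q ^+ N.+1 / (1 - q) <= e / 2 by rewrite ler_pdivrMr// exprS.
have zq : normc (z * u) <= q by rewrite normcM ler_wpM2r ?normc_ge0// ltW.
have cq t : normc (circ rho t * u) <= q by rewrite normcM normc_circ ?(ltW r0).
have P := poisson_holomorphic (fun w _ => cdiff_logtaylor N w u) zr.
have A1 := log_approx N zq ur.
have A2 : `|rmean (fun t => ln (normc (1 - circ rho t * u)) * pois rho z t) -
    rmean (fun t => Re (logtaylor N (circ rho t * u)) * pois rho z t)|
    <= q ^+ N.+1 / (1 - q).
  apply: rmean_pois_dist => //.
  - move=> t; apply: (ccont_ln_normc (phi := fun t => 1 - circ rho t * u)).
      exact: ccont_circ_lin.
    rewrite -normc_gt0; apply: lt_le_trans (normc_sub_ge _ _); rewrite normc1.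
    by rewrite subr_gt0; apply: le_lt_trans ur.
  - move=> t; have [//] : ccont (fun t => logtaylor N (circ rho t * u)) t.
    apply: (ccont_comp (f := fun w => logtaylor N (w * u)) (phi := circ rho)).
      exact: cdiff_logtaylor.
    exact: ccont_circ.
  - by move=> t; exact: log_approx.
rewrite -(subrK (Re (logtaylor N (z * u))) (ln _)) -addrA [X in _ + (X - _)]P.
rewrite [e]splitr; apply: le_trans (ler_normD _ _) _; apply: lerD.
  exact: le_trans A1 err.
by rewrite distrC; exact: le_trans A2 err.
Qed.

(** The quotient is the inverse modulus of the Blaschke factor of the disc [|z| < rho] with zero
    [a]. *)
Definition green (rho : R) z a : R :=
  ln (normc ((rho ^+ 2)%:C - z * a^*) / (rho * normc (z - a))).

Lemma green_num_gt0 rho z a : normc z < rho -> normc a < rho ->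
  0 < normc ((rho ^+ 2)%:C - z * a^*).
Proof.
move=> zr ar; apply: lt_le_trans (normc_sub_ge _ _).
rewrite normc_real ger0_norm ?sqr_ge0// subr_gt0 normcM normc_conj.
by rewrite expr2 ltr_pM ?normc_ge0.
Qed.

Lemma ln_circ_cont rho a t : 0 < rho -> normc a != rho ->
  continuous_at t (fun t => ln (normc (circ rho t - a))).
Proof.
move=> r0 ar; apply: (ccont_ln_normc (phi := fun t => circ rho t - a)).
  exact: ccont_circB.
rewrite subr_eq0; apply: contra ar => /eqP <-.
by rewrite normc_circ// ltW.
Qed.

Lemma rmean_cstD_pois rho z (k : R) (u : R -> R) : normc z < rho ->
  rint (fun t => u t * pois rho z t) ->
  rmean (fun t => (k + u t) * pois rho z t) = k + rmean (fun t => u t * pois rho z t).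
Proof.
move=> zr iu; have ip := rint_pois zr.
rewrite -[X in _ = X + _]mulr1 -(rmean_pois zr) -rmeanZ// -rmeanD//; last exact: rintZ.
by apply: eq_rmean => t; rewrite mulrDl.
Qed.

(** Factoring out [a] leaves [1 - z / a], to which [poisson_log1] applies because
    [rho / |a| < 1]. *)
Lemma poisson_ln_outside rho z a : normc z < rho -> rho < normc a ->
  ln (normc (z - a)) = rmean (fun t => ln (normc (circ rho t - a)) * pois rho z t).
Proof.
move=> zr ra; have r0 := rho_gt0 zr; have a0 := lt_trans r0 ra.
have aN0 : a != 0 by rewrite -normc_gt0.
have ua : rho * normc a^-1 < 1 by rewrite normcV ltr_pdivrMr// mul1r.
have E w : normc w < normc a -> ln (normc (w - a)) = ln (normc a) + ln (normc (1 - w * a^-1)).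
  move=> wa; rewrite -lnM ?posrE//; last first.
    rewrite normc_gt0 subr_eq0; apply: contraL wa => /eqP/(congr1 ( *%R^~ a)).
    by rewrite mulfVK// mul1r => <-; rewrite ltxx.
  by rewrite -normcM -normc_opp; congr (ln (normc _)); field.
rewrite E ?(lt_trans zr)// (poisson_log1 zr ua) -rmean_cstD_pois//.
  by apply: eq_rmean => t; rewrite E// normc_circ ?(ltW r0).
apply: rintM_pois => // t.
apply: (ccont_ln_normc (phi := fun t => 1 - circ rho t * a^-1)).
  exact: ccont_circ_lin.
rewrite -normc_gt0; apply: lt_le_trans (normc_sub_ge _ _).
by rewrite normc1 subr_gt0 normcM normc_circ ?(ltW r0).
Qed.

(* On the circle |zeta| = rho, |zeta - a| equals |rho^2 - zeta a^*| / rho, whose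
   zero rho^2 / a^* lies outside the disc. *)
Lemma poisson_ln_inside rho z a : normc z < rho -> normc a < rho -> z != a ->
  ln (normc (z - a)) = rmean (fun t => ln (normc (circ rho t - a)) * pois rho z t)
    - green rho z a.
Proof.
move=> zr ar za; have r0 := rho_gt0 zr.
have r2 : ((rho ^+ 2)%:C : R[i]) != 0.
  by rewrite -normc_gt0 normc_real normr_gt0 expf_neq0// gt_eqF.
pose u := a^* / (rho ^+ 2)%:C.
have nu : normc u = normc a / rho ^+ 2.
  by rewrite normcM normcV normc_conj normc_real ger0_norm// exprn_ge0// ltW.
have ua : rho * normc u < 1.
  rewrite nu mulrA ltr_pdivrMr ?exprn_gt0// mul1r expr2.
  by rewrite ltr_pM2l.
have n1 w : normc w <= rho -> 0 < normc (1 - w * u).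
  move=> wr; apply: lt_le_trans (normc_sub_ge _ _).
  rewrite normc1 subr_gt0 normcM; apply: le_lt_trans ua.
  by rewrite ler_wpM2r ?normc_ge0.
have E t : ln (normc (circ rho t - a)) = ln rho + ln (normc (1 - circ rho t * u)).
  rewrite -lnM ?posrE ?n1 ?normc_circ ?(ltW r0)//; congr ln.
  set x := circ rho t; have nx : normc x = rho by rewrite normc_circ ?(ltW r0).
  have x0 : x != 0 by rewrite -normc_gt0 nx.
  have -> : 1 - x * u = x / (rho ^+ 2)%:C * (x - a)^*.
    rewrite rmorphB mulrBr mulrAC mul_conjc nx divff//; congr (_ - _).
    by rewrite /u; ring.
  rewrite 2!normcM normc_conj normcV nx normc_real ger0_norm ?exprn_ge0 ?(ltW r0)//.
  by field; rewrite gt_eqF.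
have M : rmean (fun t => ln (normc (circ rho t - a)) * pois rho z t)
    = ln rho + ln (normc (1 - z * u)).
  rewrite (poisson_log1 zr ua) -rmean_cstD_pois//.
    by apply: eq_rmean => t; rewrite E.
  apply: rintM_pois => // t.
  apply: (ccont_ln_normc (phi := fun t => 1 - circ rho t * u)).
    exact: ccont_circ_lin.
  by rewrite -normc_gt0 n1// normc_circ ?(ltW r0).
have za0 : 0 < normc (z - a) by rewrite normc_gt0 subr_eq0.
have n1z := n1 z (ltW zr).
rewrite M /green -lnM ?posrE//.
have -> : normc ((rho ^+ 2)%:C - z * a^*) = rho ^+ 2 * normc (1 - z * u).
  have -> : (rho ^+ 2)%:C - z * a^* = (rho ^+ 2)%:C * (1 - z * u).
    by rewrite /u mulrBr mulr1 [_ * (z * _)]mulrC -!mulrA mulVf// mulr1.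
  by rewrite normcM normc_real ger0_norm// exprn_ge0// ltW.
rewrite -ln_div ?posrE ?divr_gt0 ?mulr_gt0 ?exprn_gt0//; congr ln.
by field; rewrite !gt_eqF.
Qed.

End LogModulus.

(** * Estimates for the Green function of a disc *)

Section GreenEstimates.
Context {R : realType}.
Implicit Types (x y : R) (z w a c : R[i]).

Lemma ln_le_sub1 x : 0 < x -> ln x <= x - 1.
Proof.
move=> x0; have := @le_ln1Dx R (x - 1); rewrite [1 + _]addrC subrK; apply.
by rewrite ltrBrDl subrr.
Qed.

Lemma ln_dist_le x y (m : R) : 0 < m -> m <= x -> m <= y ->
  `|ln x - ln y| <= `|x - y| / m.
Proof.
move=> m0 mx my; have x0 := lt_le_trans m0 mx; have y0 := lt_le_trans m0 my.
have H (u v : R) : 0 < u -> 0 < v -> m <= v -> ln u - ln v <= `|u - v| / m.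
  move=> u0 v0 mv; rewrite -ln_div ?posrE//.
  have -> : u / v = 1 + (u - v) / v by field; rewrite gt_eqF.
  apply: le_trans (le_ln1Dx _) _.
    rewrite ltr_pdivlMr// mulN1r ltrBrDl subrr//.
  apply: le_trans (_ : `|u - v| / v <= _).
    by rewrite ler_wpM2r ?invr_ge0 ?(ltW v0)// ler_norm.
  by rewrite ler_wpM2l// lef_pV2 ?posrE.
rewrite ler_norml H// andbT lerNl opprB distrC.
exact: H.
Qed.

(** For [x <= 1], [ln (1 + x) <= x <= x^d]; for [x > 1], [ln (1 + x) <= 1 + ln x] and
    [d ln x <= x^d - 1]. This trades a logarithmic singularity for an integrable power. *)
Lemma ln1D_le_powR x (d : R) : 0 <= x -> 0 < d <= 1 -> ln (1 + x) <= x `^ d / d.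
Proof.
move=> x0 /andP[d0 d1]; rewrite ler_pdivlMr//.
have [x1|x1] := leP x 1.
  have [->|xN0] := eqVneq x 0.
    by rewrite addr0 ln1 mul0r powR_ge0.
  have xp : 0 < x by rewrite lt_neqAle eq_sym xN0.
  apply: le_trans (_ : x <= _); last by apply: ger1_powR; rewrite ?xp.
  apply: le_trans (_ : x * d <= _); last by rewrite ler_piMr.
  by rewrite ler_wpM2r ?(ltW d0)// le_ln1Dx//; lra.
have xp := lt_trans ltr01 x1.
have l2 : ln (1 + x) <= 1 + ln x.
  apply: le_trans (_ : ln (2 * x) <= _).
    by rewrite ler_ln ?posrE; lra.
  rewrite lnM ?posrE// lerD2r.
  have -> : 2 = 1 + 1 :> R by [].
  exact: le_ln1Dx.
have lp : d * ln x <= x `^ d - 1.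
  by rewrite -ln_powR ln_le_sub1// powR_gt0.
apply: le_trans (ler_wpM2r (ltW d0) l2) _; lra.
Qed.

Lemma ln_normc_sub_le x y (d : R) c : normc c != 0 -> 0 < d <= 1 ->
  0 < x -> 0 < y -> x <= y + normc c ->
  ln x - ln y <= normc c `^ d / d * y `^ (- d).
Proof.
move=> c0 hd x0 y0 xy; have cc := normc_ge0 c.
have cy : 0 <= normc c / y by rewrite divr_ge0// ltW.
have := ln1D_le_powR cy hd; rewrite powRM ?invr_ge0 ?(ltW y0)//.
rewrite -powR_inv1 ?(ltW y0)// -powRrM mulN1r mulrAC; apply: le_trans.
rewrite powR_inv1 ?(ltW y0)//.
rewrite -ln_div ?posrE// ler_ln ?posrE ?divr_gt0//.
  by rewrite ler_pdivrMr// mulrDl mul1r divfK ?gt_eqF.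
exact: ltr_wpDr.
Qed.

Section Disc.
Context (rho : R) (rho_pos : 0 < rho).

(** It vanishes to first order as [|a|] tends to [rho], like [ln (rho / |a|)]; sums of weights can
    thus be controlled by integrated counting functions at the same radius. *)
Definition weight a : R := 1 - normc a ^+ 2 / rho ^+ 2.

Definition greenX z a : R := (rho ^+ 2 - normc z ^+ 2) / normc (z - a) ^+ 2.

Lemma weight_gt0 a : normc a < rho -> 0 < weight a.
Proof.
move=> ar; rewrite subr_gt0 ltr_pdivrMr ?exprn_gt0// mul1r.
by rewrite ltrXn2r ?normc_ge0 ?nnegrE ?(ltW rho_pos).
Qed.

Lemma weight_le1 a : weight a <= 1.
Proof. by rewrite gerBl divr_ge0 ?sqr_ge0. Qed.

Lemma greenX_gt0 z a : normc z < rho -> z != a -> 0 < greenX z a.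
Proof.
move=> zr za; rewrite divr_gt0 ?exprn_gt0 ?normc_gt0 ?subr_eq0//.
exact: sqr_sub_gt0.
Qed.

(** From the identity [|rho^2 - z conj a|^2 = rho^2 |z - a|^2 + (rho^2 - |z|^2) (rho^2 - |a|^2)]; it
    exhibits the weight inside the Green function. *)
Lemma greenE z a : normc z < rho -> normc a < rho -> z != a ->
  green rho z a = 2^-1 * ln (1 + weight a * greenX z a).
Proof.
move=> zr ar za; have za0 : 0 < normc (z - a) by rewrite normc_gt0 subr_eq0.
have E : normc ((rho ^+ 2)%:C - z * a^*) ^+ 2 = rho ^+ 2 * normc (z - a) ^+ 2
    + (rho ^+ 2 - normc z ^+ 2) * (rho ^+ 2 - normc a ^+ 2).
  rewrite !sqr_normc_ReIm; case: z a {zr ar za za0} => p q [k l] /=; ring.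
have n0 := green_num_gt0 zr ar.
rewrite /green; set u := normc _ / _.
have u0 : 0 < u by rewrite divr_gt0// mulr_gt0.
have -> : 1 + weight a * greenX z a = u ^+ 2.
  rewrite /u /weight /greenX exprMn exprVn E; field.
  by rewrite !gt_eqF.
by rewrite lnXn// -[X in _ = 2^-1 * X]mulr_natl mulrA mulVf// mul1r.
Qed.

Lemma green_ge0 z a : normc z < rho -> normc a < rho -> z != a -> 0 <= green rho z a.
Proof.
move=> zr ar za; rewrite greenE// mulr_ge0// ln_ge0// lerDl ltW// mulr_gt0//.
  exact: weight_gt0.
exact: greenX_gt0.
Qed.

(** For [|z| <= rho / 2] the factor [greenX] is at least [(3/4) / (9/4) = 1/3], and
    [1 - 1 / (1 + x) <= ln (1 + x)] with [weight a <= 1] gives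
    [ln (1 + weight a / 3) >= weight a / 4]. This converts Green sums over zeros into weight
    sums. *)
Lemma green_ge_weight z a : normc z <= rho / 2 -> normc a < rho -> z != a ->
  weight a / 8 <= green rho z a.
Proof.
move=> z2 ar za; have r0 := rho_pos.
have zr : normc z < rho by lra.
have w0 := weight_gt0 ar; have w1 := weight_le1 a.
have za0 : 0 < normc (z - a) by rewrite normc_gt0 subr_eq0.
have X3 : 3^-1 <= greenX z a.
  rewrite /greenX ler_pdivlMr ?exprn_gt0//.
  have zle : normc (z - a) <= 3 / 2 * rho by have := normcB_le z a; lra.
  have : normc (z - a) ^+ 2 <= (3 / 2 * rho) ^+ 2 by rewrite lerXn2r ?nnegrE ?normc_ge0//; lra.
  have : normc z ^+ 2 <= (rho / 2) ^+ 2 by rewrite lerXn2r ?nnegrE ?normc_ge0//; lra.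
  have : (3 / 2 * rho) ^+ 2 = 9 / 4 * rho ^+ 2 by field.
  have : (rho / 2) ^+ 2 = 4^-1 * rho ^+ 2 by field.
  lra.
rewrite greenE//.
have w3 : 0 < 1 + weight a / 3 by lra.
apply: le_trans (_ : 2^-1 * ln (1 + weight a / 3) <= _); last first.
  rewrite ler_pM2l// ler_ln ?posrE//.
    by rewrite lerD2l ler_pM2l.
  by rewrite ltr_wpDr// ltW// mulr_gt0// greenX_gt0.
have i0 : 0 < (1 + weight a / 3)^-1 by rewrite invr_gt0.
have := ln_le_sub1 i0; rewrite lnV ?posrE// => H.
have : (1 + weight a / 3)^-1 <= 1 - weight a / 4.
  rewrite -[X in X <= _]mul1r ler_pdivrMr//.
  have := mulr_ge0 (ltW w0) (_ : 0 <= 1 - weight a); rewrite subr_ge0 => /(_ w1).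
  lra.
lra.
Qed.

(* For |a| near rho both Green functions are small multiples of the weight,
   which would be lost in the elementary estimate of the other case. *)
Lemma green_dist z w a (s eta d : R) : normc z <= s -> normc w <= s ->
  0 < eta <= 1 -> eta * rho <= rho - s -> 0 < d <= 1 -> normc (z - w) != 0 ->
  normc a < rho -> z != a -> w != a ->
  `|green rho z a - green rho w a| <= weight a *
    (98%:R * normc (z - w) / (eta ^+ 4 * rho)
     + 2 * (normc (z - w) `^ d / d) / eta *
         (normc (z - a) `^ (- d) + normc (w - a) `^ (- d))).
Proof.
move=> zs ws /andP[e0 e1] es hd c0 ar za wa; have r0 := rho_pos.
have er : 0 < eta * rho by rewrite mulr_gt0.
have zr : normc z < rho by lra.
have wr : normc w < rho by lra.
have w0 := weight_gt0 ar; have w1 := weight_le1 a.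
have za0 : 0 < normc (z - a) by rewrite normc_gt0 subr_eq0.
have wa0 : 0 < normc (w - a) by rewrite normc_gt0 subr_eq0.
have [d0 d1] := andP hd.
set c := normc (z - w) in c0 *; have cc : 0 <= c by exact: normc_ge0.
set K := c `^ d / d; have K0 : 0 <= K by rewrite divr_ge0 ?powR_ge0// ltW.
set kz := _ `^ (- d); set kw := _ `^ (- d).
have kz0 : 0 <= kz by exact: powR_ge0.
have kw0 : 0 <= kw by exact: powR_ge0.
have [near|far] := leP (normc a) ((s + rho) / 2).
  (* Here [|a| <= (1 - eta / 2) rho], so the weight is at least [eta / 2] and can be inserted as a
     factor in estimates that do not contain it. *)
  have wn : eta / 2 <= weight a.
    have : normc a / rho <= 1 - eta / 2.
      by rewrite ler_pdivrMr// mulrBl mul1r; lra.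
    move=> ale; have a0 : 0 <= normc a / rho by rewrite divr_ge0 ?normc_ge0 ?(ltW r0).
    rewrite /weight -expr_div_n.
    have : (normc a / rho) ^+ 2 <= normc a / rho.
      by rewrite expr2 ler_piMl//; lra.
    lra.
  have nz u : normc u <= s -> eta * rho * rho <= normc ((rho ^+ 2)%:C - u * a^*).
    move=> us; apply: le_trans (normc_sub_ge _ _).
    rewrite normc_real ger0_norm ?exprn_ge0 ?(ltW r0)// normcM normc_conj.
    have : normc u * normc a <= s * rho.
      by rewrite ler_pM ?normc_ge0 ?(ltW ar).
    have : eta * rho * rho <= (rho - s) * rho by rewrite ler_pM2r.
    rewrite expr2; lra.
  have err : 0 < eta * rho * rho by rewrite mulr_gt0.
  have L1 : `|ln (normc ((rho ^+ 2)%:C - z * a^*)) - ln (normc ((rho ^+ 2)%:C - w * a^*))|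
      <= c / (eta * rho).
    apply: le_trans (ln_dist_le err (nz _ zs) (nz _ ws)) _.
    rewrite ler_pdivrMr// mulrA divfK ?gt_eqF//.
    apply: le_trans (dist_normc _ _) _.
    have -> : (rho ^+ 2)%:C - z * a^* - ((rho ^+ 2)%:C - w * a^*) = (w - z) * a^* by ring.
    by rewrite normcM normc_conj normcBC ler_wpM2l// ltW.
  have cN : normc (z - w) != 0 by [].
  have L2 : `|ln (normc (z - a)) - ln (normc (w - a))| <= K * (kz + kw).
    have A1 : ln (normc (z - a)) - ln (normc (w - a)) <= K * kw.
      apply: ln_normc_sub_le => //.
      have -> : z - a = (w - a) + (z - w) by ring.
      exact: normcD_le.
    have A2 : ln (normc (w - a)) - ln (normc (z - a)) <= K * kz.
      apply: ln_normc_sub_le => //.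
      have -> : w - a = (z - a) - (z - w) by ring.
      exact: normcB_le.
    have := mulr_ge0 K0 kz0; have := mulr_ge0 K0 kw0; rewrite ler_norml; lra.
  have G u : normc u <= s -> 0 < normc (u - a) -> green rho u a
      = ln (normc ((rho ^+ 2)%:C - u * a^*)) - (ln rho + ln (normc (u - a))).
    move=> us ua; rewrite /green ln_div ?posrE ?mulr_gt0 ?(lt_le_trans err (nz _ us))//.
    by rewrite lnM ?posrE.
  rewrite !G//.
  have -> : forall p q x y l : R, p - (l + x) - (q - (l + y)) = (p - q) - (x - y).
    by move=> *; ring.
  apply: le_trans (ler_normB _ _) _; apply: le_trans (lerD L1 L2) _.
  have H1 : c / (eta * rho) <= (eta / 2) * (98%:R * c / (eta ^+ 4 * rho)).
    have -> : (eta / 2) * (98%:R * c / (eta ^+ 4 * rho)) = c / (eta * rho) * (49%:R / eta ^+ 2).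
      by field; rewrite !gt_eqF.
    rewrite ler_peMr ?divr_ge0 ?(ltW er)// ler_pdivlMr ?exprn_gt0// mul1r.
    have : eta ^+ 2 <= 1 by rewrite expr_le1 ?(ltW e0).
    lra.
  have H2 : K * (kz + kw) = (eta / 2) * (2 * K / eta * (kz + kw)).
    by field; rewrite gt_eqF.
  apply: le_trans (lerD H1 (lexx _)) _; rewrite H2 -mulrDr ler_wpM2r//.
  have T1 : 0 <= 98%:R * c / (eta ^+ 4 * rho).
    by rewrite divr_ge0 ?mulr_ge0// ?exprn_ge0 ?(ltW e0) ?(ltW r0).
  rewrite addr_ge0// mulr_ge0 ?addr_ge0// divr_ge0 ?(ltW e0)//.
  by rewrite mulr_ge0.
(* In the remaining case [a] is far from [z] and [w], so nothing is singular and only the dependence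
   on the weight matters. *)
have dz u : normc u <= s -> eta * rho / 2 <= normc (u - a).
  move=> us; have := normc_sub_ge a u; rewrite normcBC.
  by move: far es us; clear; lra.
set X := greenX z a; set Y := greenX w a.
have X0 : 0 < X by exact: greenX_gt0.
have Y0 : 0 < Y by exact: greenX_gt0.
have G : `|green rho z a - green rho w a| <= 2^-1 * (weight a * `|X - Y|).
  rewrite !greenE// -mulrBr normrM gtr0_norm// ler_pM2l//.
  apply: le_trans (ln_dist_le ltr01 _ _) _; rewrite ?lerDl ?(ltW (mulr_gt0 w0 _))//.
  by rewrite divr1 opprD addrACA subrr add0r -mulrBr normrM gtr0_norm.
apply: le_trans G _; rewrite mulrCA ler_wpM2l ?(ltW w0)//.
(* The numerator of [X - Y] is at most [(4 + 8) rho^3 c] and the denominator at least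
   [(eta rho / 2)^4], whence [192 = 12 * 16]; half of it, 96, is below the 98 of the statement. *)
have XY : `|X - Y| <= 192%:R * c / (eta ^+ 4 * rho).
  have XYE : X - Y = (rho ^+ 2 * (normc (w - a) ^+ 2 - normc (z - a) ^+ 2)
     + (normc w ^+ 2 - normc z ^+ 2) * normc (w - a) ^+ 2
     - normc w ^+ 2 * (normc (w - a) ^+ 2 - normc (z - a) ^+ 2))
     / (normc (z - a) ^+ 2 * normc (w - a) ^+ 2).
    by rewrite /X /Y /greenX; field; rewrite !gt_eqF.
  have two (u : R[i]) : normc u <= s -> normc (u - a) <= 2 * rho.
    by move=> us; have := normcB_le u a; lra.
  have B1 : `|normc (w - a) ^+ 2 - normc (z - a) ^+ 2| <= c * (4 * rho).
    rewrite subr_sqr normrM ler_pM//.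
      have -> : c = normc ((w - a) - (z - a)) by rewrite /c normcBC; congr normc; ring.
      exact: dist_normc.
    rewrite ger0_norm ?addr_ge0 ?normc_ge0//.
    by have := two _ zs; have := two _ ws; lra.
  have B2 : `|normc w ^+ 2 - normc z ^+ 2| <= c * (2 * rho).
    rewrite subr_sqr normrM ler_pM//.
      rewrite /c normcBC; exact: dist_normc.
    by rewrite ger0_norm ?addr_ge0 ?normc_ge0//; lra.
  have B3 : normc (w - a) ^+ 2 <= 4 * rho ^+ 2.
    have -> : 4 * rho ^+ 2 = (2 * rho) ^+ 2 by ring.
    by rewrite lerXn2r ?nnegrE ?normc_ge0 ?two//; lra.
  have B4 : (eta * rho / 2) ^+ 4 <= normc (z - a) ^+ 2 * normc (w - a) ^+ 2.
    rewrite -[4%N]/(2 + 2)%N exprD ler_pM ?exprn_ge0 ?divr_ge0 ?(ltW er)//.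
      by rewrite lerXn2r ?nnegrE ?normc_ge0 ?dz// divr_ge0// ltW.
    by rewrite lerXn2r ?nnegrE ?normc_ge0 ?dz// divr_ge0// ltW.
  have p0 : 0 < (eta * rho / 2) ^+ 4 by rewrite exprn_gt0// divr_gt0.
  have q0 := lt_le_trans p0 B4.
  rewrite XYE normrM [X in _ * X]gtr0_norm ?invr_gt0//.
  have -> : 192%:R * c / (eta ^+ 4 * rho) = (12%:R * rho ^+ 3 * c) / (eta * rho / 2) ^+ 4.
    by field; rewrite !gt_eqF.
  apply: ler_pM; rewrite ?normr_ge0 ?invr_ge0 ?(ltW q0)//; last by rewrite lef_pV2 ?posrE.
  have -> : forall p q b k : R, p * b + q - k * b = (p - k) * b + q by move=> *; ring.
  apply: le_trans (ler_normD _ _) _; rewrite normrM [X in _ + X]normrM.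
  have rw : `|rho ^+ 2 - normc w ^+ 2| <= rho ^+ 2.
    rewrite ger0_norm ?(ltW (sqr_sub_gt0 wr))//.
    by rewrite gerBl sqr_ge0.
  have C1 := ler_pM (normr_ge0 _) (normr_ge0 _) rw B1.
  rewrite [`|normc (w - a) ^+ 2|]ger0_norm ?sqr_ge0//.
  have C2 := ler_pM (normr_ge0 _) (sqr_ge0 _) B2 B3.
  apply: le_trans (lerD C1 C2) _.
  rewrite le_eqVlt; apply/orP; left; apply/eqP; ring.
apply: le_trans (ler_wpM2l (_ : 0 <= 2^-1) XY) _ => //.
have T0 : 0 <= 2 * K / eta * (kz + kw).
  by rewrite mulr_ge0 ?addr_ge0// divr_ge0 ?(ltW e0)// mulr_ge0.
have U0 : 0 <= c / (eta ^+ 4 * rho).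
  by rewrite divr_ge0// mulr_ge0 ?exprn_ge0 ?(ltW e0) ?(ltW r0).
rewrite -!mulrA in U0 *; rewrite -!mulrA in T0; lra.
Qed.

End Disc.

End GreenEstimates.

(** * Averages of negative powers of the distance to a point *)

Section SingularIntegral.
Context {R : realType} (d : R) (d01 : 0 < d < 1).
Let mu := @lebesgue_measure R.

Let d0 : 0 < d. Proof. by case/andP: d01. Qed.
Let d1 : d < 1. Proof. by case/andP: d01. Qed.
Let d1' : 0 < 1 - d. Proof. by rewrite subr_gt0. Qed.

Lemma is_derive_powR (x p : R) : 0 < x -> is_derive x (1 : R) (fun y => y `^ p) (p * x `^ (p - 1)).
Proof.
move=> x0; have xi : x \in `]0, +oo[ by rewrite in_itv/= x0.
apply: DeriveDef; first exact: (@derivable_powR R 1 p x xi).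
by rewrite -derive1E (@powR_derive1 R p x xi).
Qed.

Lemma is_derive_affine (s tau x : R) : is_derive x (1 : R) (fun y => s * (y - tau)) s.
Proof.
have -> : (fun y => s * (y - tau)) = (fun y => - (s * tau) + y * s).
  by apply/funext => y; ring.
by apply: is_derive_eq; rewrite /GRing.scale/=; ring.
Qed.

(** The integral of [x^(-d)] over []0, L]]. *)
Definition sing_bound (L : R) : R := L `^ (1 - d) / (1 - d).

(** The sign [s] treats segments to the right and to the left of [tau] at once; the integral is
    evaluated with the primitive [F]. *)
Lemma sing_segment (s tau a b L : R) : s = 1 \/ s = -1 -> a <= b ->
  (forall x, a <= x <= b -> 0 < s * (x - tau) <= L) ->
  (\int[mu]_(x in `[a, b]) (`|x - tau| `^ (- d))%:E <= (sing_bound L)%:E)%E.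
Proof.
move=> hs ab H.
have ss : s * s = 1 by case: hs => ->; rewrite ?mulrNN mulr1.
pose F x := (s / (1 - d)) * (s * (x - tau)) `^ (1 - d).
pose f x := (s * (x - tau)) `^ (- d).
have fE : {in `[a, b], forall x, `|x - tau| `^ (- d) = f x}.
  move=> x; rewrite in_itv/= => /H /andP[p _]; rewrite /f; congr (_ `^ _).
  case: hs p => -> p; first by rewrite mul1r gtr0_norm// -[X in 0 < X]mul1r.
  by rewrite mulN1r ltr0_norm// -oppr_gt0 -mulN1r.
have dF x : a <= x <= b -> is_derive x (1 : R) F (f x).
  move=> /H /andP[p _].
  have du := is_derive_affine s tau x.
  have dc := is_deriveZ (s / (1 - d)) (@is_derive1_comp R (fun y => y `^ (1 - d))
    (fun y => s * (y - tau)) x _ _ (is_derive_powR (1 - d) p) du).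
  apply: is_derive_eq dc _; rewrite /GRing.scale/= /f.
  have -> : 1 - d - 1 = - d by ring.
  have -> : s / (1 - d) * ((1 - d) * (s * (x - tau)) `^ (- d) * s)
     = (s * s) * (s * (x - tau)) `^ (- d) by field; rewrite gt_eqF.
  by rewrite ss mul1r.
have cf x : a <= x <= b -> {for x, continuous f}.
  move=> /H /andP[p _].
  have du := is_derive_affine s tau x.
  have dc := @is_derive1_comp R (fun y => y `^ (- d)) (fun y => s * (y - tau)) x _ _
    (is_derive_powR (- d) p) du.
  exact: is_derive_continuous dc.
have i_f := continuous_itv_integrable cf.
have -> : (\int[mu]_(x in `[a, b]) (`|x - tau| `^ (- d))%:E
    = \int[mu]_(x in `[a, b]) (f x)%:E)%E.
  by apply: eq_integral => x; rewrite inE => xab; rewrite fE.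
rewrite -[X in (X <= _)%E]fineK; last exact: integrable_fin_num.
rewrite lee_fin -[X in X <= _]/(\int[mu]_(x in `[a, b]) f x)%R.
rewrite (Rintegral_FTC ab dF cf) /F /sing_bound.
have PL x : a <= x <= b -> 0 <= (s * (x - tau)) `^ (1 - d) / (1 - d) <= L `^ (1 - d) / (1 - d).
  move=> /H /andP[p q]; rewrite divr_ge0 ?powR_ge0 ?(ltW d1')//= ler_pM2r ?invr_gt0//.
  by apply: ge0_ler_powR; rewrite ?nnegrE ?(ltW d1') ?(ltW p)// (le_trans (ltW p)).
have /andP[pa qa] := PL a (introT andP (conj (lexx a) ab)).
have /andP[pb qb] := PL b (introT andP (conj ab (lexx b))).
case: hs PL pa qa pb qb => -> PL; rewrite ?mul1r ?mulN1r => pa qa pb qb.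
  by rewrite ![(1 - d)^-1 * _]mulrC; lra.
by rewrite !mulNr ![(1 - d)^-1 * _]mulrC; lra.
Qed.

Lemma measurable_sing (tau : R) (D : set (measurableTypeR R)) : measurable D ->
  measurable_fun D (fun x : measurableTypeR R => `|x - tau| `^ (- d)).
Proof.
move=> mD; apply: measurable_funTS.
apply: (measurableT_comp (measurable_powR (- d))).
by apply: measurableT_comp => //; exact: measurable_funB.
Qed.

Lemma sing_limit (tau L : R) (F : (set (measurableTypeR R))^nat) : (forall n, measurable (F n)) ->
  nondecreasing_seq F ->
  (forall n, (\int[mu]_(x in F n) (`|x - tau| `^ (- d))%:E <= (sing_bound L)%:E)%E) ->
  (\int[mu]_(x in \bigcup_n F n) (`|x - tau| `^ (- d))%:E <= (sing_bound L)%:E)%E.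
Proof.
move=> mF ndF FL.
have c : (\int[mu]_(x in F n) (`|x - tau| `^ (- d))%:E)%E @[n --> \oo]
    --> (\int[mu]_(x in \bigcup_n F n) (`|x - tau| `^ (- d))%:E)%E.
  apply: (@ge0_nondecreasing_set_cvg_integral _ _ _ F) => // n.
  by apply/measurable_EFinP; apply: measurable_sing; exact: mF.
rewrite -(cvg_lim _ c)//; apply: lime_le; first exact: cvgP c.
exact: nearW.
Qed.

(** Segments that stay away from [tau] increase to the two punctured sides, so monotone convergence
    carries the bound over; the point [tau] itself has measure 0. *)
Lemma sing_integral (tau L a b : R) : 0 < L -> tau - L <= a -> b <= tau + L ->
  (\int[mu]_(x in `[a, b]) (`|x - tau| `^ (- d))%:E <= (2 * sing_bound L)%:E)%E.
Proof.
move=> L0 ha hb.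
pose F n : set (measurableTypeR R) := `[tau + L / n.+1%:R, tau + L]%classic.
pose G n : set (measurableTypeR R) := `[tau - L, tau - L / n.+1%:R]%classic.
have Ln n : 0 < L / n.+1%:R <= L.
  by rewrite divr_gt0//= ler_pdivrMr// ler_peMr ?(ltW L0)// ler1n.
have Lmono m n : (m <= n)%N -> L / n.+1%:R <= L / m.+1%:R.
  by move=> mn; rewrite ler_pM2l// lef_pV2 ?posrE// ler_nat ltnS.
have ndF : nondecreasing_seq F.
  move=> m n mn; apply/subsetPset => x; rewrite /F /= !in_itv/= => /andP[p ->].
  by rewrite andbT (le_trans _ p)// lerD2l Lmono.
have ndG : nondecreasing_seq G.
  move=> m n mn; apply/subsetPset => x; rewrite /G /= !in_itv/= => /andP[-> p].
  by rewrite (le_trans p)// lerD2l lerN2 Lmono.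
have BF : (\int[mu]_(x in \bigcup_n F n) (`|x - tau| `^ (- d))%:E <= (sing_bound L)%:E)%E.
  apply: sing_limit => // [n|n]; first exact: measurable_itv.
  have := Ln n; set y := L / _ => /andP[p q].
  apply: (@sing_segment 1); [by left|by rewrite lerD2l|].
  by move=> x; rewrite -/y => /andP[u v]; apply/andP; split; lra.
have BG : (\int[mu]_(x in \bigcup_n G n) (`|x - tau| `^ (- d))%:E <= (sing_bound L)%:E)%E.
  apply: sing_limit => // [n|n]; first exact: measurable_itv.
  have := Ln n; set y := L / _ => /andP[p q].
  apply: (@sing_segment (-1)); [by right|by rewrite lerD2l lerN2|].
  by move=> x; rewrite -/y => /andP[u v]; apply/andP; split; lra.
have mF : measurable (\bigcup_n F n) by apply: bigcup_measurable => n _; exact: measurable_itv.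
have mG : measurable (\bigcup_n G n) by apply: bigcup_measurable => n _; exact: measurable_itv.
have k0 x : (0 <= (`|x - tau| `^ (- d))%:E)%E by rewrite lee_fin powR_ge0.
have sub : `[a, b]%classic `<=` (\bigcup_n F n `|` \bigcup_n G n) `|` [set tau].
  move=> x /=; rewrite in_itv/= => /andP[ax xb].
  have small y : 0 < y -> exists n, L / n.+1%:R <= y.
    move=> y0; exists (Num.truncn (L / y)).
    rewrite ler_pdivrMr// mulrC -ler_pdivrMr//; apply: ltW; exact: truncnS_gt.
  have [xt|xt|->] := ltgtP x tau; last by right.
  - left; right; have [n hn] := small (tau - x) (ltac:(by rewrite subr_gt0)).
    move: hn; set y := L / _ => hn.
    by exists n => //; rewrite /G /= in_itv/= -/y; apply/andP; split; lra.
  - left; left; have [n hn] := small (x - tau) (ltac:(by rewrite subr_gt0)).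
    move: hn; set y := L / _ => hn.
    by exists n => //; rewrite /F /= in_itv/= -/y; apply/andP; split; lra.
have mU : measurable (\bigcup_n F n `|` \bigcup_n G n) by exact: measurableU.
have le1 : (\int[mu]_(x in `[a, b]) (`|x - tau| `^ (- d))%:E <=
    \int[mu]_(x in (\bigcup_n F n `|` \bigcup_n G n) `|` [set tau]) (`|x - tau| `^ (- d))%:E)%E.
  apply: ge0_subset_integral => //.
  - exact: measurableU.
  - by apply/measurable_EFinP; apply: measurable_sing; exact: measurableU.
apply: (le_trans le1).
have dFG : [disjoint \bigcup_n F n & \bigcup_n G n].
  apply/disj_setPS => x [[n _ +] [m _]]; rewrite /F /G /= !in_itv/=.
  have := Ln n; have := Ln m; set y := L / _; set y' := L / _.
  by move=> /andP[? _] /andP[? _]; rewrite -/y -/y' => /andP[? _] /andP[_ ?]; lra.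
have dt : [disjoint \bigcup_n F n `|` \bigcup_n G n & [set tau]].
  apply/disj_setPS => x [+ /= xt]; rewrite {}xt => -[] [n _]; rewrite /F /G /= !in_itv/=.
    by have := Ln n; set y := L / _ => /andP[? _]; rewrite -/y => /andP[? _]; lra.
  by have := Ln n; set y := L / _ => /andP[? _]; rewrite -/y => /andP[_ ?]; lra.
rewrite ge0_integral_setU//; last first.
  by apply/measurable_EFinP; apply: measurable_sing; exact: measurableU.
rewrite integral_set1 adde0 ge0_integral_setU//; last first.
  by apply/measurable_EFinP; apply: measurable_sing.
by rewrite mulr_natl mulr2n EFinD leeD.
Qed.

End SingularIntegral.

Section CirclePowerMean.
Context {R : realType}.
Let mu := @lebesgue_measure R.

(** Up to [pi / 4] the cosine is at least 1/2 and the mean value theorem applies; beyond,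
    [sin y >= sin (pi / 4) >= 1/2 >= y / 4] because [pi / 2 < 2]. *)
Lemma sin_ge_quarter (y : R) : 0 <= y <= pi / 2 -> y / 4 <= sin y.
Proof.
move=> /andP[y0 y2]; have pp := pi_gt0 R; have p2 := pihalf_lt2 R.
have c4 : cos (pi / 4) ^+ 2 = 2^-1 :> R.
  have := cos_mulr2n (pi / 4 : R); rewrite -mulrnAl -[pi *+ 2]mulr_natl.
  have -> : 2 * pi / 4 = pi / 2 :> R by field.
  by rewrite cos_pihalf -mulr_natl; lra.
have s4 : sin (pi / 4) ^+ 2 = 2^-1 :> R.
  by have := cos2Dsin2 (pi / 4 : R); lra.
have half (u : R) : 0 <= u -> u ^+ 2 = 2^-1 -> 2^-1 <= u.
  move=> u0 u2; rewrite -(@ler_pXn2r _ 2)// ?nnegrE// u2 expr2; lra.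
have cg : 2^-1 <= cos (pi / 4) :> R by apply: half => //; apply: cos_ge0_pihalf; lra.
have sg : 2^-1 <= sin (pi / 4) :> R by apply: half => //; apply: sin_ge0_pi; lra.
have [y4|y4] := leP y (pi / 4).
  have [c hc] : exists2 c, c \in `[0, y] & sin y - sin 0 = cos c * (y - 0).
    apply: MVT_segment => //.
    by apply: continuous_subspaceT => x; exact: continuous_sin.
  rewrite sin0 !subr0 => ->; move: hc; rewrite in_itv/= => /andP[c0 cy].
  have : 2^-1 <= cos c.
    apply: le_trans cg _; have := @ltr_cos R (pi / 4) c.
    rewrite !in_itv/= => /(_ _ _)H; rewrite leNgt H ?leNgt; try lra.
  by move=> h; rewrite mulrC; apply: le_trans (_ : 2^-1 * y <= _); [lra|rewrite ler_wpM2r].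
apply: le_trans (_ : 2^-1 <= _); first lra.
apply: le_trans sg _; have := @ltr_sin R y (pi / 4).
rewrite !in_itv/= => H; rewrite leNgt H; lra.
Qed.

Lemma chord_ge (t tau : R) : `|t - tau| <= pi -> `|t - tau| / 4 <= normc (cis t - cis tau).
Proof.
move=> h; set x := t - tau in h *.
have E : normc (cis t - cis tau) ^+ 2 = (2 * sin (`|x| / 2)) ^+ 2.
  have -> : (2 * sin (`|x| / 2)) ^+ 2 = 2 * (1 - cos x) :> R.
    have := cos_mulr2n (`|x| / 2); rewrite -mulrnAl -[`|x| *+ 2]mulr_natr mulfK//.
    rewrite cos_norm => ->; have := cos2Dsin2 (`|x| / 2); rewrite -mulr_natl exprMn; lra.
  rewrite sqr_normc_ReIm /= /x cosB.
  have := cos2Dsin2 t; have := cos2Dsin2 tau; rewrite !sqrrB; lra.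
have s0 : 0 <= sin (`|x| / 2) by apply: sin_ge0_pi; have := normr_ge0 x; have := pi_gt0 R; lra.
have -> : normc (cis t - cis tau) = 2 * sin (`|x| / 2).
  by apply/eqP; rewrite -(@eqrXn2 _ 2) ?normc_ge0 ?mulr_ge0// E.
have : `|x| / 2 / 4 <= sin (`|x| / 2) by apply: sin_ge_quarter; have := normr_ge0 x; lra.
lra.
Qed.

(** The parameter [tau] minimises the distance to [a] on the arc. Then [|circ r t - circ r tau| <= 2
    |circ r t - a|], so the chord bound yields [|circ r t - a| >= r |t - tau| / 8] wherever [a]
    lies. The arc has length at most [pi] so that [chord_ge] applies. *)
Lemma arc_power_bound (d r lo hi : R) (a : R[i]) : 0 < d -> 0 < r -> lo <= hi ->
  hi - lo <= pi -> exists2 tau, lo <= tau <= hi & forall t, lo <= t <= hi -> t != tau ->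
    normc (circ r t - a) `^ (- d) <= (r / 8) `^ (- d) * `|t - tau| `^ (- d).
Proof.
move=> d0 r0 lh hlo.
have c : {within `[lo, hi], continuous (fun t => normc (circ r t - a))}.
  apply: continuous_in_subspaceT => t _; apply: ccont_normc.
  exact: ccont_circB.
have [tau] := EVT_min lh c; rewrite in_itv/= => htau Hmin.
exists tau => // t ht tN; have /andP[t1 t2] := ht; have /andP[u1 u2] := htau.
have x0 : 0 < `|t - tau| by rewrite normr_gt0 subr_eq0.
have cb : r / 8 * `|t - tau| <= normc (circ r t - a).
  have m := Hmin t; rewrite in_itv/= in m; have {}m := m ht.
  have ch : `|t - tau| / 4 <= normc (cis t - cis tau).
    by apply: chord_ge; rewrite ler_norml; lra.
  have : normc (circ r t - circ r tau) <= normc (circ r t - a) + normc (circ r tau - a).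
    have -> : circ r t - circ r tau = (circ r t - a) - (circ r tau - a) by ring.
    exact: normcB_le.
  rewrite !circE -mulrBr normcM normc_real gtr0_norm// => h.
  have := ler_wpM2l (ltW r0) ch; rewrite !circE in m h *; lra.
have p0 : 0 < r / 8 * `|t - tau| by rewrite mulr_gt0 ?divr_gt0.
rewrite -powRM ?(ltW x0) ?divr_ge0 ?(ltW r0)// !powRN lef_pV2 ?posrE ?powR_gt0//.
  by apply: ge0_ler_powR; rewrite ?nnegrE ?(ltW d0) ?(ltW p0)// normc_ge0.
exact: lt_le_trans cb.
Qed.

Lemma measurable_circ_power (d r : R) (a : R[i]) (D : set (measurableTypeR R)) :
  measurable D ->
  measurable_fun D (fun t : measurableTypeR R => normc (circ r t - a) `^ (- d)).
Proof.
move=> mD; apply: measurable_funTS; apply: (measurableT_comp (measurable_powR (- d))).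
apply: continuous_measurable_fun => t; apply: ccont_normc.
exact: ccont_circB.
Qed.

Lemma circle_power_mean (d : R) : 0 < d < 1 -> exists2 C : R, 0 <= C &
  forall (r : R) (a : R[i]), 0 < r ->
    rint (fun t => normc (circ r t - a) `^ (- d)) /\
    rmean (fun t => normc (circ r t - a) `^ (- d)) <= C * r `^ (- d).
Proof.
move=> d01; have [d0 d1] := andP d01; have pp := pi_gt0 R.
pose B := 2 * sing_bound d (2 * pi).
have B0 : 0 <= B by rewrite mulr_ge0// divr_ge0 ?powR_ge0// subr_ge0 ltW.
exists ((2 * pi)^-1 * (8^-1 `^ (- d) * (B + B))).
  by rewrite !mulr_ge0 ?addr_ge0 ?powR_ge0 ?twopi_inv_ge0.
move=> r a r0; set k := fun t => _ `^ _.
have [t1 ht1 H1] := @arc_power_bound d r 0 pi a d0 r0 (ltW pp) (ltac:(lra)).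
have [t2 ht2 H2] := @arc_power_bound d r pi (2 * pi) a d0 r0 (ltac:(lra)) (ltac:(lra)).
pose K := (r / 8) `^ (- d); have K0 : 0 <= K by exact: powR_ge0.
pose s tau (t : measurableTypeR R) := `|t - tau| `^ (- d).
have ms tau : measurable_fun `[0, 2 * pi] (EFin \o s tau).
  by apply/measurable_EFinP; apply: measurable_sing.
have mk : measurable_fun `[0, 2 * pi] (EFin \o k).
  by apply/measurable_EFinP; apply: measurable_circ_power.
have I : (\int[mu]_(t in `[0%R, (2 * pi)%R]) (k t)%:E <= (K * (B + B))%:E)%E.
  apply: (@le_trans _ _ (\int[mu]_(t in `[0%R, (2 * pi)%R])
      (K%:E * ((s t1 t)%:E + (s t2 t)%:E)))%E).
    (* Only almost everywhere: a negative power of 0 has the default value 0, so the comparison may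
       fail at [t1] and [t2]. *)
    apply: ae_ge0_le_integral => //.
    - by move=> t _; rewrite lee_fin powR_ge0.
    - move=> t _; by rewrite -EFinD -EFinM lee_fin mulr_ge0 ?addr_ge0 ?powR_ge0.
    - by apply: measurable_funeM; apply: emeasurable_funD; exact: ms.
    have cN : countable [set t1; t2] by exact/finite_set_countable.
    exists [set t1; t2]; split.
    - exact: countable_measurable.
    - exact: countable_lebesgue_measure0.
    move=> t /= /not_implyP[]; rewrite in_itv/= => /andP[t0 tp] H.
    apply: contrapT => /not_orP[/eqP n1 /eqP n2]; apply: H.
    rewrite -EFinD -EFinM lee_fin mulrDr; have [tpi|tpi] := leP t pi.
      apply: le_trans (H1 t _ n1) _; first by rewrite t0.
      by rewrite lerDl mulr_ge0 ?powR_ge0.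
    apply: le_trans (H2 t _ n2) _; first by rewrite ltW.
    by rewrite lerDr mulr_ge0 ?powR_ge0.
  have mS : measurable_fun `[0, 2 * pi] (fun t => ((s t1 t)%:E + (s t2 t)%:E)%E).
    by apply: emeasurable_funD; exact: ms.
  rewrite ge0_integralZl//; last by move=> t _; rewrite -EFinD lee_fin addr_ge0 ?powR_ge0.
  rewrite EFinM lee_pmul2l//; last first.
    by rewrite lte_fin powR_gt0// divr_gt0.
  rewrite ge0_integralD//; try by [move=> t _; rewrite lee_fin powR_ge0|exact: ms].
  have L0 : 0 < 2 * pi :> R by exact: twopi_gt0.
  have p1 := ht1; have p2 := ht2; rewrite EFinD; apply: leeD; apply: sing_integral => //; lra.
have ik : rint k.
  apply/integrableP; split; first exact: mk.
  under eq_integral do rewrite gee0_abs ?lee_fin ?powR_ge0//.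
  exact: (le_lt_trans I (ltry _)).
split => //; rewrite /rmean -!mulrA ler_wpM2l ?twopi_inv_ge0//.
have -> : 8^-1 `^ (- d) * ((B + B) * r `^ (- d)) = K * (B + B).
  by rewrite /K powRM ?(ltW r0)// ; ring.
rewrite -lee_fin /Rintegral fineK//; exact: integrable_fin_num.
Qed.

End CirclePowerMean.

(** * The quotient F(z + c) / F(z) for a rational function F *)

Section RealContinuity.
Context {R : realType}.
Implicit Types (u v : R -> R) (t : R).

Lemma contD u v t : continuous_at t u -> continuous_at t v ->
  continuous_at t (fun x => u x + v x).
Proof. by move=> cu cv; exact: (continuousD cu cv). Qed.

Lemma contB u v t : continuous_at t u -> continuous_at t v ->
  continuous_at t (fun x => u x - v x).
Proof. by move=> cu cv; exact: (continuousB cu cv). Qed.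

Lemma eq_cont u v t : (forall x, u x = v x) -> continuous_at t u -> continuous_at t v.
Proof. by move=> e; rewrite (_ : v = u)//; apply/funext. Qed.

Lemma cont_max0 u t : continuous_at t u -> continuous_at t (fun x => Num.max (u x) 0).
Proof.
move=> cu; have -> : (fun x => Num.max (u x) 0) = u \max cst 0 by [].
by apply: continuous_max => //; exact: cvg_cst.
Qed.

End RealContinuity.

Section RationalFunction.
Context {R : realType} (k : R[i]) (A B : seq R[i]) (rho : R).
Context (k0 : k != 0) (rho_pos : 0 < rho)
  (hA : forall a, a \in A -> normc a != rho)
  (hB : forall b, b \in B -> normc b < rho).
Implicit Types (z w : R[i]) (s : seq R[i]) (t : R).

Definition ratf w : R[i] := k * \prod_(a <- A) (w - a) / \prod_(b <- B) (w - b).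

Lemma prod_sub_neq0 s w : w \notin s -> \prod_(a <- s) (w - a) != 0.
Proof.
move=> ws; rewrite prodf_seq_neq0; apply/allP => a asn /=.
by rewrite subr_eq0; apply: contra ws => /eqP ->.
Qed.

Lemma prod_sub_eq0 s w : w \in s -> \prod_(a <- s) (w - a) = 0.
Proof.
move=> ws; apply/eqP; rewrite prodf_seq_eq0; apply/hasP; exists w => //=.
by rewrite subrr.
Qed.

Lemma ln_prod_sub s w : w \notin s ->
  ln (normc (\prod_(a <- s) (w - a))) = \sum_(a <- s) ln (normc (w - a)).
Proof.
elim: s => [|a s IH] h; first by rewrite !big_nil normc1 ln1.
move: (h); rewrite inE negb_or => /andP[wa ws].
rewrite !big_cons normcM lnM ?posrE ?normc_gt0 ?subr_eq0 ?prod_sub_neq0//.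
by rewrite IH.
Qed.

Lemma ln_ratf w : w \notin A -> w \notin B ->
  ln (normc (ratf w)) = ln (normc k) + \sum_(a <- A) ln (normc (w - a))
    - \sum_(b <- B) ln (normc (w - b)).
Proof.
move=> wA wB; have pA := prod_sub_neq0 wA; have pB := prod_sub_neq0 wB.
rewrite /ratf 2!normcM normcV ln_div ?lnM ?posrE ?mulr_gt0 ?normc_gt0//.
by rewrite !ln_prod_sub.
Qed.

(** At a pole this is the convention that the inverse of 0 is 0; it makes quotients harmless at
    zeros and poles, where their [logp] is 0. *)
Lemma ratf_eq0 w : (w \in A) || (w \in B) -> ratf w = 0.
Proof.
by rewrite /ratf => /orP[] /prod_sub_eq0 ->; rewrite ?mulr0 ?mul0r ?invr0 ?mulr0.
Qed.

Lemma ratf_neq0 w : w \notin A -> w \notin B -> ratf w != 0.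
Proof. by move=> wA wB; rewrite !mulf_neq0 ?invr_eq0 ?prod_sub_neq0. Qed.

Lemma circ_notin s t : (forall a, a \in s -> normc a != rho) -> circ rho t \notin s.
Proof.
by move=> hs; apply/negP => /hs; rewrite normc_circ ?eqxx// ltW.
Qed.

Lemma circ_notinA t : circ rho t \notin A. Proof. exact: circ_notin. Qed.

Lemma hB' b : b \in B -> normc b != rho.
Proof. by move=> /hB; rewrite lt_neqAle => /andP[]. Qed.

Lemma circ_notinB t : circ rho t \notin B.
Proof. by apply: circ_notin => b; exact: hB'. Qed.

Lemma sum_ln_circ_cont s t : (forall a, a \in s -> normc a != rho) ->
  continuous_at t (fun t => \sum_(a <- s) ln (normc (circ rho t - a))).
Proof.
elim: s => [|a s IH] hs.
  by apply: (@eq_cont _ (fun=> 0)) => [x|]; [rewrite big_nil|exact: cvg_cst].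
apply: (@eq_cont _ (fun t => ln (normc (circ rho t - a))
    + \sum_(b <- s) ln (normc (circ rho t - b)))) => [x|]; first by rewrite big_cons.
apply: contD; first by apply: ln_circ_cont => //; apply: hs; rewrite mem_head.
by apply: IH => b bs; apply: hs; rewrite inE bs orbT.
Qed.

(** One formula per factor: a point outside the disc gives a plain Poisson mean, a point inside adds
    its Green function. *)
Lemma poisson_jensen_prod s z : (forall a, a \in s -> normc a != rho) ->
  normc z < rho -> z \notin s ->
  \sum_(a <- s) ln (normc (z - a)) =
    rmean (fun t => (\sum_(a <- s) ln (normc (circ rho t - a))) * pois rho z t)
    - \sum_(a <- s | normc a < rho) green rho z a.
Proof.
move=> + zr; elim: s => [|a s IH] hs zs.
  rewrite !big_nil subr0 -[LHS](rmean_cst (0 : R)); apply: eq_rmean => t.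
  by rewrite big_nil mul0r.
move: zs; rewrite inE negb_or => /andP[za zs].
have hs' b : b \in s -> normc b != rho by move=> bs; apply: hs; rewrite inE bs orbT.
have ha : normc a != rho by apply: hs; rewrite mem_head.
have i1 : rint (fun t => ln (normc (circ rho t - a)) * pois rho z t).
  by apply: rintM_pois => // t; exact: ln_circ_cont.
have i2 : rint (fun t => (\sum_(a <- s) ln (normc (circ rho t - a))) * pois rho z t).
  by apply: rintM_pois => // t; exact: sum_ln_circ_cont.
have -> : rmean (fun t => (\sum_(a <- a :: s) ln (normc (circ rho t - a))) * pois rho z t)
    = rmean (fun t => ln (normc (circ rho t - a)) * pois rho z t)
    + rmean (fun t => (\sum_(a <- s) ln (normc (circ rho t - a))) * pois rho z t).
  by rewrite -rmeanD//; apply: eq_rmean => t; rewrite big_cons mulrDl.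
rewrite !big_cons IH//; case: ifPn => ar.
  by rewrite (poisson_ln_inside zr ar za); ring.
rewrite -(poisson_ln_outside zr); first by ring.
by rewrite lt_neqAle eq_sym ha leNgt.
Qed.

Definition lncirc t : R := ln (normc (ratf (circ rho t))).

Lemma lncircE t : lncirc t = ln (normc k) + \sum_(a <- A) ln (normc (circ rho t - a))
    - \sum_(b <- B) ln (normc (circ rho t - b)).
Proof. by rewrite /lncirc ln_ratf ?circ_notinA ?circ_notinB. Qed.

Lemma lncirc_cont t : continuous_at t lncirc.
Proof.
have -> : lncirc = (fun t => ln (normc k) + \sum_(a <- A) ln (normc (circ rho t - a))
    - \sum_(b <- B) ln (normc (circ rho t - b))).
  by apply/funext => x; exact: lncircE.
apply: contB; last by apply: sum_ln_circ_cont => b; exact: hB'.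
by apply: contD; [exact: cvg_cst|exact: sum_ln_circ_cont].
Qed.

Lemma poisson_jensen z : normc z < rho -> z \notin A -> z \notin B ->
  ln (normc (ratf z)) = rmean (fun t => lncirc t * pois rho z t)
    - \sum_(a <- A | normc a < rho) green rho z a + \sum_(b <- B) green rho z b.
Proof.
move=> zr zA zB; rewrite ln_ratf//.
rewrite (poisson_jensen_prod hA zr zA) (poisson_jensen_prod hB' zr zB).
have iA : rint (fun t => (\sum_(a <- A) ln (normc (circ rho t - a))) * pois rho z t).
  by apply: rintM_pois => // t; exact: sum_ln_circ_cont.
have iB : rint (fun t => (\sum_(a <- B) ln (normc (circ rho t - a))) * pois rho z t).
  by apply: rintM_pois => // t; apply: sum_ln_circ_cont => b; exact: hB'.
have -> : rmean (fun t => lncirc t * pois rho z t) = ln (normc k)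
    + rmean (fun t => (\sum_(a <- A) ln (normc (circ rho t - a))) * pois rho z t)
    - rmean (fun t => (\sum_(a <- B) ln (normc (circ rho t - a))) * pois rho z t).
  rewrite -rmean_cstD_pois// -rmeanB//; first by
    apply: eq_rmean => t; rewrite lncircE; ring.
  apply: rintM_pois => // t.
  by apply: contD; [exact: cvg_cst|exact: sum_ln_circ_cont].
have -> : \sum_(a <- B | normc a < rho) green rho z a = \sum_(b <- B) green rho z b.
  by rewrite big_seq_cond [RHS]big_seq; apply: eq_bigl => b; case: (boolP (b \in B)) => // /hB ->.
ring.
Qed.

Lemma rint_lncirc : rint lncirc. Proof. by apply: rint_cont => t; exact: lncirc_cont. Qed.

Lemma rint_lncirc_pos : rint (fun t => Num.max (lncirc t) 0).
Proof. by apply: rint_cont => t; apply: cont_max0; exact: lncirc_cont. Qed.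

Lemma weight_sum_ge0 s : 0 <= \sum_(a <- s | normc a < rho) weight rho a.
Proof. by apply: sumr_ge0 => a ar; apply: ltW; exact: weight_gt0. Qed.

(** A form of the first fundamental theorem: Poisson-Jensen at [z0] bounds the negative part of
    [ln |F|] on the circle and the zeros by the positive part, the poles and the value at [z0]. The
    factor 8 is that of [green_ge_weight]. *)
Lemma zeros_poles_bound z0 : normc z0 <= rho / 2 -> z0 \notin A -> z0 \notin B ->
  rmean (fun t => `|lncirc t|) + \sum_(a <- A | normc a < rho) weight rho a
  <= 8 * (4 * rmean (fun t => Num.max (lncirc t) 0)
    + \sum_(b <- B) green rho z0 b - ln (normc (ratf z0))).
Proof.
move=> z2 zA zB; have zr : normc z0 < rho by have := rho_pos; lra.
have := poisson_jensen zr zA zB.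
have P3 t : pois rho z0 t <= 3.
  apply: le_trans (pois_le t zr) _; rewrite ler_pdivrMr ?subr_gt0//; lra.
have P3' t : 3^-1 <= pois rho z0 t.
  apply: le_trans (pois_ge t zr); rewrite ler_pdivlMr; last first.
    by rewrite ltr_wpDr ?normc_ge0.
  lra.
have ia : rint (fun t => `|lncirc t|) by apply/rint_abs/rint_lncirc.
have ip := rint_lncirc_pos.
(* As the kernel lies in [[1/3, 3]], [l * pois] is at most [10/3 * max l 0 - 1/3 * |l|]: the right
   side is [3 l] for [l >= 0] and [l / 3] for [l < 0]. *)
have M : rmean (fun t => lncirc t * pois rho z0 t) <=
    10 / 3 * rmean (fun t => Num.max (lncirc t) 0) - 3^-1 * rmean (fun t => `|lncirc t|).
  rewrite -!rmeanZ// -rmeanB; try exact: rintZ.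
  apply: le_rmean; first by apply: rintM_pois => // t; exact: lncirc_cont.
    by apply: rintB; exact: rintZ.
  move=> t; have [l0|l0] := leP 0 (lncirc t).
    rewrite ger0_norm//; have := ler_wpM2l l0 (P3 t); lra.
  rewrite ltr0_norm//; have := ler_wnM2l (ltW l0) (P3' t); lra.
have G : \sum_(a <- A | normc a < rho) weight rho a / 8 <=
    \sum_(a <- A | normc a < rho) green rho z0 a.
  rewrite [leLHS]big_seq_cond [leRHS]big_seq_cond; apply: ler_sum => a /andP[aA ar].
  apply: green_ge_weight => //.
  by apply: contraNneq zA => ->.
rewrite -mulr_suml in G.
have L0 : 0 <= rmean (fun t => `|lncirc t|) by apply: rmean_ge0.
have Lp0 : 0 <= rmean (fun t => Num.max (lncirc t) 0).
  by apply: rmean_ge0 => t; rewrite le_max lexx orbT.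
move: M G L0 Lp0; generalize (rmean (fun t => lncirc t * pois rho z0 t)) => M.
lra.
Qed.

(** Without poles the Green terms only lower [ln |F(z0)|], and the kernel is at most 3. For entire
    functions this bounds the proximity function from below. *)
Lemma ln_circle_le z0 : normc z0 <= rho / 2 -> z0 \notin A -> z0 \notin B -> B = [::] ->
  ln (normc (ratf z0)) <= 3 * rmean (fun t => Num.max (lncirc t) 0).
Proof.
move=> z2 zA zB B0; have zr : normc z0 < rho by have := rho_pos; lra.
rewrite (poisson_jensen zr zA zB) B0 big_nil addr0 lerBlDr.
apply: ler_wpDr.
  rewrite big_seq_cond sumr_ge0// => a /andP[aA ar]; apply: green_ge0 => //.
  by apply: contraNneq zA => ->.
rewrite -rmeanZ; last exact: rint_lncirc_pos.
apply: le_rmean; first by apply: rintM_pois => // t; exact: lncirc_cont.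
  by apply: rintZ; exact: rint_lncirc_pos.
move=> t; have P3 : pois rho z0 t <= 3.
  apply: le_trans (pois_le t zr) _; rewrite ler_pdivrMr ?subr_gt0//; lra.
have P0 := pois_ge0 t zr.
have [l0|l0] := leP 0 (lncirc t); first by rewrite mulrC ler_wpM2r.
by rewrite mulr0 mulr_le0_ge0// ltW.
Qed.

Section Shift.
Context (c : R[i]) (eta d s : R) (c0 : c != 0) (he : 0 < eta <= 1) (hd : 0 < d < 1)
  (hs : eta * rho <= rho - s).

Let K1 : R := 98%:R * normc c / (eta ^+ 4 * rho).
Let K2 : R := 2 * (normc c `^ d / d) / eta.

Let K10 : 0 <= K1.
Proof.
by case/andP: he => e0 _; rewrite divr_ge0 ?mulr_ge0 ?normc_ge0 ?exprn_ge0 ?(ltW e0) ?(ltW rho_pos).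
Qed.

Let K20 : 0 <= K2.
Proof.
case/andP: he => e0 _; case/andP: hd => d0 _.
by rewrite divr_ge0 ?(ltW e0)// mulr_ge0// divr_ge0 ?powR_ge0 ?(ltW d0).
Qed.

(** The bound of [green_dist] for the points [z] and [z + c]. Since [z + c - a = z - (a - c)], both
    singular powers are distances from [z] to fixed points and can be averaged over the circle of
    [z]. *)
Definition shift_bound z a : R := weight rho a *
  (K1 + K2 * (normc (z - a) `^ (- d) + normc (z - (a - c)) `^ (- d))).

Definition quot_bound z : R :=
  2 * rho * normc c / (rho - s) ^+ 2 * rmean (fun t => `|lncirc t|)
  + \sum_(a <- A | normc a < rho) shift_bound z a + \sum_(b <- B) shift_bound z b.

Lemma shift_bound_ge0 z a : normc a < rho -> 0 <= shift_bound z a.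
Proof.
move=> ar; rewrite mulr_ge0 ?(ltW (weight_gt0 _ ar))// addr_ge0// mulr_ge0//.
by rewrite addr_ge0 ?powR_ge0.
Qed.

Lemma quot_bound_ge0 z : 0 <= quot_bound z.
Proof.
rewrite /quot_bound !addr_ge0//.
- rewrite mulr_ge0 ?rmean_ge0// divr_ge0 ?sqr_ge0// !mulr_ge0 ?normc_ge0//.
  exact: ltW.
- by apply: sumr_ge0 => a; exact: shift_bound_ge0.
- by rewrite big_seq sumr_ge0// => b /hB; exact: shift_bound_ge0.
Qed.

(** Difference of the Poisson-Jensen formulas at [z + c] and [z]: [pois_dist] bounds the kernel
    part, [green_dist] each zero and pole. If one of the two points is itself a zero or pole, the
    quotient is 0 by convention. *)
Lemma logp_quot_le z : normc z <= s -> normc (z + c) <= s ->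
  logp (normc (ratf (z + c) / ratf z)) <= quot_bound z.
Proof.
move=> zs ws; have Q0 := quot_bound_ge0 z.
have logp0 : logp (normc (0 : R[i])) <= quot_bound z by rewrite normc0 /logp ln0// maxxx.
have er : 0 < eta * rho by case/andP: he => e0 _; rewrite mulr_gt0.
have sr : s < rho by move: (hs) er; lra.
have zr : normc z < rho := le_lt_trans zs sr.
have wr : normc (z + c) < rho := le_lt_trans ws sr.
have [zAB|] := boolP ((z \in A) || (z \in B)).
  by rewrite (ratf_eq0 zAB) invr0 mulr0.
rewrite negb_or => /andP[zA zB].
have [wAB|] := boolP ((z + c \in A) || (z + c \in B)).
  by rewrite (ratf_eq0 wAB) mul0r.
rewrite negb_or => /andP[wA wB].
rewrite /logp ge_max Q0 andbT normcM normcV ln_div ?posrE ?normc_gt0 ?ratf_neq0//.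
rewrite !poisson_jensen//.
have cE : normc (z - (z + c)) = normc c by rewrite opprD addrA subrr add0r normc_opp.
have hd' : 0 < d <= 1 by case/andP: hd => -> /ltW.
have G a : normc a < rho -> z != a -> z + c != a ->
    `|green rho z a - green rho (z + c) a| <= shift_bound z a.
  move=> ar za wa; have := green_dist rho_pos zs ws he hs hd' (a := a).
  rewrite cE normc_eq0 => /(_ c0 ar za wa).
  by rewrite /shift_bound opprB addrA.
have GA : `|\sum_(a <- A | normc a < rho) green rho z a
    - \sum_(a <- A | normc a < rho) green rho (z + c) a|
    <= \sum_(a <- A | normc a < rho) shift_bound z a.
  rewrite -sumrB big_seq_cond [leRHS]big_seq_cond; apply: le_trans (ler_norm_sum _ _ _) _.
  apply: ler_sum => a /andP[aA ar]; apply: G => //.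
    by apply: contraNneq zA => ->.
  by apply: contraNneq wA => ->.
have GB : `|\sum_(a <- B) green rho z a - \sum_(a <- B) green rho (z + c) a|
    <= \sum_(a <- B) shift_bound z a.
  rewrite -sumrB big_seq [leRHS]big_seq; apply: le_trans (ler_norm_sum _ _ _) _.
  apply: ler_sum => a aB; apply: G => //; first exact: hB.
    by apply: contraNneq zB => ->.
  by apply: contraNneq wB => ->.
have PM : `|rmean (fun t => lncirc t * pois rho (z + c) t)
     - rmean (fun t => lncirc t * pois rho z t)|
    <= 2 * rho * normc c / (rho - s) ^+ 2 * rmean (fun t => `|lncirc t|).
  have i1 : rint (fun t => lncirc t * pois rho (z + c) t).
    by apply: rintM_pois => // t; exact: lncirc_cont.
  have i2 : rint (fun t => lncirc t * pois rho z t).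
    by apply: rintM_pois => // t; exact: lncirc_cont.
  rewrite -rmeanB//; apply: le_trans (le_norm_rmean (rintB i1 i2)) _.
  rewrite -rmeanZ; last exact/rint_abs/rint_lncirc.
  apply: le_rmean; first exact/rint_abs/rintB.
    exact/rintZ/rint_abs/rint_lncirc.
  move=> t; rewrite -mulrBr normrM mulrC ler_wpM2r//.
  by have := pois_dist t ws zs sr; rewrite addrAC subrr add0r.
move: PM GA GB; rewrite /quot_bound !ler_norml.
move=> /andP[_ p] /andP[p1 p2] /andP[q1 q2]; lra.
Qed.

(** The mean of the singular power has a bound independent of the centre, so averaging leaves just
    the weight sums times one constant. *)
Lemma rint_quot_bound (C r : R) : 0 < r -> (forall a : R[i],
    rint (fun t => normc (circ r t - a) `^ (- d)) /\
    rmean (fun t => normc (circ r t - a) `^ (- d)) <= C * r `^ (- d)) ->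
  rint (fun t => quot_bound (circ r t)) /\
  rmean (fun t => quot_bound (circ r t)) <=
    2 * rho * normc c / (rho - s) ^+ 2 * rmean (fun t => `|lncirc t|)
    + (\sum_(a <- A | normc a < rho) weight rho a + \sum_(b <- B) weight rho b)
      * (K1 + 2 * K2 * (C * r `^ (- d))).
Proof.
move=> r0 HC.
have i1 a : rint (fun t => normc (circ r t - a) `^ (- d)) by case: (HC a).
have i2 a : rint (fun t => K1 + K2 * (normc (circ r t - a) `^ (- d)
    + normc (circ r t - (a - c)) `^ (- d))).
  by apply: rintD; [exact: rint_cst|apply: rintZ; exact: rintD].
have i3 a : rint (fun t => shift_bound (circ r t) a) by apply: rintZ.
have m3 a : normc a < rho -> rmean (fun t => shift_bound (circ r t) a) <=
    weight rho a * (K1 + 2 * K2 * (C * r `^ (- d))).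
  move=> ar; rewrite rmeanZ// ler_wpM2l ?(ltW (weight_gt0 _ ar))//.
  rewrite rmeanD; [|exact: rint_cst|by apply: rintZ; exact: rintD].
  rewrite rmean_cst lerD2l rmeanZ; last exact: rintD.
  have -> : 2 * K2 * (C * r `^ (- d)) = K2 * (2 * (C * r `^ (- d))) by ring.
  rewrite rmeanD// ler_wpM2l//.
  by have [_ h1] := HC a; have [_ h2] := HC (a - c); lra.
pose U t := \sum_(a <- [seq a <- A | normc a < rho]) shift_bound (circ r t) a.
pose V t := \sum_(b <- B) shift_bound (circ r t) b.
have iU : rint U by exact: rint_sum.
have iV : rint V by exact: rint_sum.
have E t : quot_bound (circ r t)
    = 2 * rho * normc c / (rho - s) ^+ 2 * rmean (fun t => `|lncirc t|) + U t + V t.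
  by rewrite /quot_bound /U /V big_filter.
have iQ : rint (fun t => 2 * rho * normc c / (rho - s) ^+ 2 * rmean (fun t => `|lncirc t|) + U t).
  by apply: rintD => //; exact: rint_cst.
split; first by apply: eq_rint (rintD iQ iV) => t; rewrite E.
rewrite (eq_rmean E) rmeanD// rmeanD//; last exact: rint_cst.
rewrite rmean_cst -addrA lerD2l mulrDl; apply: lerD.
  rewrite rmean_sum// big_filter mulr_suml; exact: ler_sum.
rewrite rmean_sum// mulr_suml big_seq [leRHS]big_seq; apply: ler_sum => b bB.
exact/m3/hB.
Qed.

End Shift.
End RationalFunction.

(** * Meromorphic functions on discs *)

Section DiscCompactness.
Context {R : realType}.

(** Compactness is taken from a square in ['rV[R]_2], whose balls use the maximum of the
    coordinates; radius [e / 2] there suffices because [|z| <= |Re z| + |Im z|]. *)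
Lemma disc_finite_cover (e : R[i] -> R) (rho : R) : (forall z, 0 < e z) ->
  exists s : seq R[i], forall z, normc z <= rho ->
    exists2 p, p \in s & normc (z - p) < e p.
Proof.
move=> e0; pose toC (v : 'rV[R]_2) : R[i] := v ord0 ord0 +i* v ord0 ord_max.
pose K := [set v : 'rV[R]_2 | forall i, `[- rho, rho]%classic (v ord0 i)].
have cK : compact K.
  by apply: (@rV_compact _ 2 (fun=> `[- rho, rho]%classic)) => i; exact: segment_compact.
pose f (v : 'rV[R]_2) : set 'rV[R]_2 := (ball v (e (toC v) / 2))°%classic.
move: cK; rewrite compact_cover => /(_ _ setT f)[|v _|D _ HD].
- by move=> v _; exact: open_interior.
- have p : 0 < e (toC v) / 2 by rewrite divr_gt0.
  by exists v => //; exact: (nbhsx_ballx v _ p).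
exists (map toC (finmap.enum_fset D)) => z zr.
pose v : 'rV[R]_2 := \row_i (if i == ord0 then Re z else Im z).
have vz : toC v = z by rewrite /toC !mxE /=; case: z {zr v}.
have Kv : K v.
  move=> i; rewrite mxE /= in_itv /= -ler_norml.
  by case: ifP => _; apply: le_trans zr; rewrite ?Re_le_normc ?Im_le_normc.
have [w wD fw] := HD _ Kv; exists (toC w); first by apply: map_f; exact: wD.
have [_ bw] := interior_subset fw.
have h0 := bw ord0 ord0; have h1 := bw ord0 ord_max.
rewrite -vz; apply: le_lt_trans (normc_le_ReIm _) _.
rewrite [e _]splitr ReDc ImDc ReNc ImNc; apply: ltrD.
  by rewrite distrC; exact: h0.
by rewrite distrC; exact: h1.
Qed.

End DiscCompactness.

Section Meromorphic.
Context {R : realType}.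
Implicit Types (f g : R[i] -> R[i]) (z w b : R[i]) (s : seq R[i]).

Lemma near_normc (P : R[i] -> Prop) z : (\forall w \near (z : R[i]^o), P w) ->
  exists2 e : R, 0 < e & forall w, normc (w - z) < e -> P w.
Proof.
rewrite -nbhs_nearE => /nbhs_ballP[r /= r0 Hr].
have rE : r = (Re r)%:C.
  by move: r0; rewrite ltcE /= => /andP[/eqP r0 _]; apply/eq_ReIm.
exists (Re r); first by rewrite -ltcR -rE.
move=> w wz; apply: Hr; rewrite -ball_normE /ball_ /= distrC normC_normc rE ltcR.
exact: wz.
Qed.

Lemma dnear_normc (P : R[i] -> Prop) z : (\forall w \near (z : R[i]^o)^', P w) ->
  exists2 e : R, 0 < e & forall w, normc (w - z) < e -> w != z -> P w.
Proof.
rewrite near_withinE => /near_normc[e e0 H].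
by exists e => // w wz wN; exact: H.
Qed.

Lemma holomorphic_cdiff f z : holomorphic_at f z ->
  exists2 e : R, 0 < e & forall w, normc (w - z) < e -> cdiff f w.
Proof.
move=> /near_normc[e e0 H]; exists e => // w /H; by move/derivable_cdiff.
Qed.

Lemma pole_local f z k : pole_of_order f z k -> exists g (e : R),
  [/\ 0 < e, g z != 0, forall w, normc (w - z) < e -> cdiff g w &
      forall w, normc (w - z) < e -> w != z -> f w = g w / (w - z) ^+ k].
Proof.
move=> [k0 [g [/holomorphic_cdiff[e1 e10 H1] gz /dnear_normc[e2 e20 H2]]]].
exists g, (Num.min e1 e2); split => //; first by rewrite lt_min e10.
  by move=> w; rewrite lt_min => /andP[/H1].
by move=> w; rewrite lt_min => /andP[_ /H2].
Qed.

(** If [f] were differentiable at [z] it would be bounded nearby, so [g w = f w * (w - z)^k] would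
    tend to 0, against [g z != 0]. *)
Lemma pole_not_cdiff f z k : pole_of_order f z k -> cdiff f z -> False.
Proof.
move=> hp [d df]; have [k0 _] := hp; have [g [e [e0 gz dg fg]]] := pole_local hp.
have [d' dg'] := dg z (ltac:(by rewrite subrr normc0)).
have ng : 0 < normc (g z) by rewrite normc_gt0.
pose m := normc (g z) / 4; have m0 : 0 < m by rewrite divr_gt0.
have [r1 r10 H1] := has_cderiv_cont dg' m0.
have [r2 r20 H2] := has_cderiv_cont df ltr01.
pose M := normc (f z) + 1; have M0 : 0 < M by rewrite ltr_wpDl// normc_ge0.
(* Distance of a test point [w] from [z]: the last entry gives [|g w| <= M h <= m], with [m] a
   quarter of [|g z|], the others validate the local estimates at [w]. *)
pose h := Num.min (Num.min (e / 2) (r1 / 2)) (Num.min (r2 / 2) (Num.min 1 (m / M))).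
have h0 : 0 < h by rewrite !lt_min !divr_gt0//= ltr01.
have he : h <= e / 2 by rewrite !ge_min lexx.
have hr1 : h <= r1 / 2 by rewrite !ge_min lexx !orbT.
have hr2 : h <= r2 / 2 by rewrite !ge_min lexx !orbT.
have h1 : h <= 1 by rewrite !ge_min lexx !orbT.
have hm : h <= m / M by rewrite !ge_min lexx !orbT.
pose w := z + h%:C; have wz : w - z = h%:C by rewrite /w addrC addKr.
have nw : normc (w - z) = h by rewrite wz normc_real gtr0_norm.
have wN : w != z by rewrite -subr_eq0 -normc_gt0 nw.
have fw := fg w (ltac:(rewrite nw; lra)) wN.
have g1 := H1 w (ltac:(rewrite nw; lra)); have f1 := H2 w (ltac:(rewrite nw; lra)).
have fM : normc (f w) <= M.
  by rewrite -(subrK (f z) (f w)) (le_trans (normcD_le _ _))// addrC /M lerD2l.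
have gE : g w = f w * (w - z) ^+ k.
  by rewrite fw divfK// expf_neq0// subr_eq0.
have : normc (g w) <= m.
  rewrite gE normcM normcX nw; apply: le_trans (_ : M * h <= _); last first.
    by rewrite mulrC -ler_pdivlMr.
  apply: ler_pM; rewrite ?normc_ge0 ?exprn_ge0 ?(ltW h0)//.
  case: k k0 {hp fg fw gE} => // k _; rewrite exprS ler_piMr ?(ltW h0)//.
  by rewrite exprn_ile1 ?(ltW h0).
have := normc_sub_ge (g z) (g w); rewrite normcBC; rewrite /m in g1 *; lra.
Qed.

Lemma pole_of_order_mult f z k : pole_of_order f z k -> pole_of_order f z (pole_mult f z).
Proof.
by move=> pk; apply: (@xgetPex _ _ [set k | pole_of_order f z k]); exists k.
Qed.

Lemma pole_multP f z : pole_mult f z != 0%N -> pole_of_order f z (pole_mult f z).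
Proof.
have [[k pk] _|np] := pselect (exists k, pole_of_order f z k).
  exact: pole_of_order_mult pk.
by rewrite /pole_mult xgetPN ?eqxx// => k pk; apply: np; exists k.
Qed.

Lemma not_pole_holomorphic f z : meromorphic f -> pole_mult f z = 0%N ->
  holomorphic_at f z.
Proof.
move=> mf h; case: (mf z) => // -[k /pole_of_order_mult].
by rewrite h => -[].
Qed.

Lemma pole_mult0 f z : cdiff f z -> pole_mult f z = 0%N.
Proof.
move=> df; apply/eqP; apply: contrapT => /negP /pole_multP /pole_not_cdiff.
exact.
Qed.

Lemma isolated_poles f z : meromorphic f -> exists2 e : R, 0 < e &
  forall w, normc (w - z) < e -> w != z -> cdiff f w.
Proof.
move=> mf; case: (mf z) => [/holomorphic_cdiff[e e0 H]|[k /pole_local[g [e [e0 gz dg fg]]]]].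
  by exists e => // w /H.
exists e => // w we wz.
have wz0 : 0 < normc (w - z) by rewrite normc_gt0 subr_eq0.
pose r := Num.min (e - normc (w - z)) (normc (w - z)).
have r0 : 0 < r by rewrite lt_min subr_gt0 we.
apply: (@cdiff_near _ (fun w => g w / (w - z) ^+ k) _ _ r) => //.
  move=> v; rewrite lt_min => /andP[v1 v2]; rewrite fg//.
    rewrite -(subrKA w); apply: le_lt_trans (normcD_le _ _) _; lra.
  by apply: contraTneq v2 => ->; rewrite normcBC ltxx.
apply: cdiffM; first exact: dg.
apply: cdiffV; first by rewrite expf_neq0// subr_eq0.
have -> : (fun w : R[i] => (w - z) ^+ k) = (fun w => \prod_(i <- nseq k z) (w - i)).
  apply/funext => v; elim: k {fg} => [|k IH]; first by rewrite expr0 big_nil.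
  by rewrite /= big_cons exprS IH.
by apply: cdiff_prod => i; exact: cdiff_subc.
Qed.

(** Around each point there is a disc where only the centre can be a pole. Finitely many of these
    cover the big disc, so every pole is one of the finitely many centres. *)
Lemma finite_poles f (rho : R) : meromorphic f ->
  exists s, uniq s /\ forall z, (z \in s) = (normc z <= rho) && (pole_mult f z != 0%N).
Proof.
move=> mf; have /choice[e He] : forall z, exists e : R, 0 < e /\
    forall w, normc (w - z) < e -> w != z -> cdiff f w.
  by move=> z; have [e e0 H] := isolated_poles z mf; exists e.
have [s Hs] := @disc_finite_cover R e rho (fun z => (He z).1).
exists (undup [seq z <- s | (normc z <= rho) && (pole_mult f z != 0%N)]).
rewrite undup_uniq; split => // z; rewrite mem_undup mem_filter.
case: (boolP ((normc z <= rho) && (pole_mult f z != 0%N))) => //= /andP[zr zp].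
have [p ps zpe] := Hs z zr; have [->//|zN] := eqVneq z p.
by move: zp; rewrite (pole_mult0 ((He p).2 z zpe zN)).
Qed.

Lemma dist_seq_pos s z : exists2 e : R, 0 < e & forall b, b \in s -> b != z -> e <= normc (b - z).
Proof.
elim: s => [|a s [e e0 IH]]; first by exists 1.
have [->|az] := eqVneq a z.
  by exists e => // b; rewrite inE => /orP[/eqP ->|/IH//]; rewrite eqxx.
exists (Num.min e (normc (a - z))); first by rewrite lt_min e0 normc_gt0 subr_eq0.
move=> b; rewrite inE => /orP[/eqP -> _|bs bz]; first by rewrite ge_min lexx orbT.
by rewrite ge_min IH.
Qed.

(** Only finitely many moduli exceed [rho]; this gives room for a larger disc without new poles. *)
Lemma radius_gap s (rho : R) : exists2 r : R, rho < r <= rho + 1 &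
  forall b, b \in s -> rho < normc b -> r < normc b.
Proof.
elim: s => [|a s [r /andP[r1 r2] IH]]; first by exists (rho + 1) => //; lra.
have [ar|ar] := ltP rho (normc a); last first.
  exists r; first by rewrite r1.
  by move=> b; rewrite inE => /orP[/eqP -> /(le_lt_trans ar)|/IH//]; rewrite ltxx.
exists (Num.min r ((rho + normc a) / 2)).
  by rewrite lt_min r1 ge_min r2 orTb andbT/=; lra.
move=> b; rewrite inE => /orP[/eqP -> _|bs br]; rewrite gt_min.
  by apply/orP; right; lra.
by rewrite IH.
Qed.

Lemma prod_sub_split s w b : \prod_(a <- s) (w - a) =
  (w - b) ^+ (count_mem b s) * \prod_(a <- s | a != b) (w - a).
Proof.
rewrite (bigID (pred1 b)) /=; congr (_ * _).
rewrite (eq_bigr (fun=> w - b)); last by move=> a /eqP ->.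
by rewrite big_const_seq iter_mulr_1.
Qed.

(** The product of [f] with [prod (z - b)] has removable singularities at the poles, which are
    filled with the local numerators. *)
Lemma meromorphic_factor f (r : R) s : meromorphic f ->
  (forall z, normc z <= r -> count_mem z s = pole_mult f z) ->
  exists g, cdiff_disc g r /\ forall z, normc z <= r -> z \notin s ->
    f z = g z / \prod_(b <- s) (z - b).
Proof.
move=> mf hs.
have /choice[h Hh] : forall b, exists h, pole_mult f b != 0%N -> exists e : R,
    [/\ 0 < e, forall w, normc (w - b) < e -> cdiff h w &
      forall w, normc (w - b) < e -> w != b -> f w = h w / (w - b) ^+ pole_mult f b].
  move=> b; have [p|p] := boolP (pole_mult f b != 0%N); last by exists id.
  by have [g [e [e0 _ dg fg]]] := pole_local (pole_multP p); exists g => _; exists e.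
(* At a pole the value of [f] carries no meaning, so [g] uses the local numerator [h z] times the
   factors of the other poles. *)
pose g z := if z \in s then h z z * \prod_(b <- s | b != z) (z - b)
            else f z * \prod_(b <- s) (z - b).
have dprod (P : pred R[i]) z : cdiff (fun w => \prod_(b <- s | P b) (w - b)) z.
  have -> : (fun w => \prod_(b <- s | P b) (w - b)) =
      (fun w => \prod_(b <- [seq b <- s | P b]) (w - b)).
    by apply/funext => w; rewrite big_filter.
  by apply: cdiff_prod => i; exact: cdiff_subc.
exists g; split; last first.
  by move=> z zr zs; rewrite /g (negbTE zs) mulfK// prod_sub_neq0.
move=> z zr; have [e e0 sep] := dist_seq_pos s z.
have [zs|zs] := boolP (z \in s); last first.
  have p0 : pole_mult f z = 0%N by rewrite -hs//; apply/count_memPn.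
  have [e' e'0 df] := holomorphic_cdiff (not_pole_holomorphic mf p0).
  apply: (@cdiff_near _ (fun w => f w * \prod_(b <- s) (w - b)) _ _ e) => //.
    move=> w we; rewrite /g ifF//; apply: contraTF we => ws.
    by rewrite -leNgt sep//; apply: contraNneq zs => <-.
  by apply: cdiffM; [apply: df; rewrite subrr normc0|exact: dprod].
have pz : pole_mult f z != 0%N by rewrite -hs// -lt0n -has_count has_pred1.
have [e' [e'0 dh fh]] := Hh z pz.
apply: (@cdiff_near _ (fun w => h z w * \prod_(b <- s | b != z) (w - b)) _ _
  (Num.min e e')); first by rewrite lt_min e0.
  move=> w; rewrite lt_min => /andP[we we']; rewrite /g.
  have [->|wz] := eqVneq w z; first by rewrite zs.
  rewrite ifF; last by apply: contraTF we => ws; rewrite -leNgt sep.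
  rewrite (fh w we' wz) (prod_sub_split s w z) hs// mulrA divfK// expf_neq0//.
  by rewrite subr_eq0.
by apply: cdiffM; [apply: dh; rewrite subrr normc0|exact: dprod].
Qed.

(** Counting occurrences encodes multiplicities, so that sums over poles become plain sums over a
    list. *)
Definition poles_list f (rho : R) s : Prop :=
  forall z, count_mem z s = if normc z <= rho then pole_mult f z else 0%N.

Lemma poles_listE f rho s z : poles_list f rho s ->
  (z \in s) = (normc z <= rho) && (pole_mult f z != 0%N).
Proof.
by move=> h; rewrite -has_pred1 has_count h lt0n; case: ifP => //=; rewrite eqxx.
Qed.

Lemma poles_list_exists f rho : meromorphic f -> exists s, poles_list f rho s.
Proof.
move=> mf; have [s [us hs]] := finite_poles rho mf.
exists (flatten [seq nseq (pole_mult f b) b | b <- s]) => z.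
have C : forall s, uniq s -> count_mem z (flatten [seq nseq (pole_mult f b) b | b <- s])
    = if z \in s then pole_mult f z else 0%N.
  elim=> [//|b s' IH] /= /andP[bs us']; rewrite count_cat IH// count_nseq in_cons.
  rewrite /= [b == z]eq_sym; have [->|zb] := eqVneq z b; last by rewrite mul0n.
  by rewrite mul1n (negbTE bs) addn0.
by rewrite C// hs; case: (normc z <= rho) => //=; case: eqVneq => //= ->.
Qed.

Definition generic f (rho : R) : Prop := forall z, normc z = rho -> pole_mult f z = 0%N.

(** The numerator is differentiable on a disc of radius [r > rho], the margin that polynomial
    approximation on [|z| <= rho] requires. *)
Lemma generic_factor f rho : meromorphic f -> generic f rho -> exists B g r,
  [/\ rho < r, poles_list f rho B, forall b, b \in B -> normc b < rho, cdiff_disc g r &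
    forall z, normc z <= r -> z \notin B -> f z = g z / \prod_(b <- B) (z - b)].
Proof.
move=> mf gen; have [B1 h1] := poles_list_exists (rho + 1) mf.
have [r /andP[r1 r2] gap] := radius_gap B1 rho.
have [B hB] := poles_list_exists rho mf.
have hr z : normc z <= r -> count_mem z B = pole_mult f z.
  move=> zr; rewrite hB; case: leP => // rz; symmetry; apply/eqP.
  apply: contrapT => /negP p; suff /gap /(_ rz) : z \in B1 by rewrite ltNge zr.
  by rewrite (poles_listE _ h1) p (le_trans zr r2).
have [g [dg fg]] := meromorphic_factor mf hr.
exists B, g, r; split => // b; rewrite (poles_listE _ hB) => /andP[br p].
rewrite lt_neqAle br andbT; apply/eqP => /gen p0; by rewrite p0 in p.
Qed.

End Meromorphic.

(** * The counting function of the poles *)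

Section CountingFunction.
Context {R : realType} (f : R[i] -> R[i]).
Implicit Types (z w b : R[i]) (s B : seq R[i]) (rho t : R).
Let mu := @lebesgue_measure R.

Lemma pole_count_list rho B t : poles_list f rho B -> t <= rho ->
  pole_count f t = \sum_(b <- B) ((normc b <= t)%R)%:R.
Proof.
move=> hB tr; pose B' := [seq b <- B | normc b <= t].
have cB' z : normc z <= t -> count_mem z B' = pole_mult f z.
  move=> zt; rewrite count_filter.
  have := hB z; rewrite (le_trans zt tr) => <-; apply: eq_count => b /=.
  by case: eqVneq => [->|//]; rewrite zt.
have inB' z : z \in B' -> normc z <= t by rewrite mem_filter => /andP[].
rewrite /pole_count (fsbigE (undup B')); first last.
- move=> z /= zt; rewrite mem_undup => zB; rewrite -cB'//.
  by rewrite (count_memPn zB).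
- by move=> z /=; rewrite mem_undup => /inB'.
- exact: undup_uniq.
have -> : \sum_(b <- B) ((normc b <= t)%R)%:R = \sum_(b <- B') 1 :> R.
  rewrite big_filter [in RHS]big_mkcond /=.
  by apply: eq_bigr => b _; case: ifP.
rewrite -(big_undup_iterop_count (@GRing.add R) B' xpredT (fun=> 1)).
rewrite [LHS]big_seq_cond [RHS]big_seq_cond; apply: eq_big => [z|z /andP[zB _]].
  apply: andb_id2l; rewrite mem_undup => zB.
  by apply: mem_set; exact: inB'.
by move: zB; rewrite mem_undup => zB; rewrite cB'//; exact: inB'.
Qed.

(** Contribution of a single pole to [N(rho, f)]; a pole at the origin enters through the term
    [n(0, f) ln rho]. *)
Definition count_term rho b : R := if b == 0 then ln rho else ln rho - ln (normc b).

Lemma Rintegral_step_inv (be rho : R) : 0 < be <= rho ->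
  mu.-integrable `]0, rho] (EFin \o (fun t : R => ((be <= t)%R)%:R / t)) /\
  \int[mu]_(t in `]0, rho]) (((be <= t)%R)%:R / t) = ln rho - ln be.
Proof.
move=> /andP[b0 br].
have E : (fun t : R => ((be <= t)%R)%:R / t) = (fun t => t^-1) \_ `[be, +oo[.
  apply/funext => t; rewrite patchE; have [bt|bt] := leP be t.
    by rewrite mem_set ?mul1r//= in_itv/= bt.
  by rewrite memNset ?mul0r//= in_itv/= andbT; apply/negP; rewrite -ltNge.
have S : `]0, rho]%classic `&` `[be, +oo[%classic = `[be, rho]%classic.
  apply/seteqP; split => t /=; rewrite !in_itv/= ?andbT.
    by move=> [/andP[_ ->] ->].
  by move=> /andP[bt ->]; rewrite bt (lt_le_trans b0 bt).
have ci t : be <= t <= rho -> {for t, continuous (fun t : R => t^-1)}.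
  by move=> /andP[bt _]; apply: inv_continuous; rewrite gt_eqF// (lt_le_trans b0).
have ii := continuous_itv_integrable ci.
split.
  rewrite E -restrict_EFin; apply/integrable_restrict => //.
  by rewrite S.
have dl t : be <= t <= rho -> is_derive t (1 : R) (@ln R) t^-1.
  by move=> /andP[bt _]; apply: is_derive1_ln; exact: lt_le_trans bt.
by rewrite E -Rintegral_mkcondr S (Rintegral_FTC br dl ci).
Qed.

Lemma integrated_count_list rho B : 0 < rho -> poles_list f rho B ->
  integrated_count rho f = \sum_(b <- B) count_term rho b.
Proof.
move=> r0 hB.
have Br b : b \in B -> normc b <= rho by rewrite (poles_listE b hB) => /andP[].
(* A pole at the origin cancels in [n(t) - n(0)], hence the value 0; it returns in the term with
   [ln rho]. *)
pose u b t : R := if b == 0 then 0 else ((normc b <= t)%R)%:R / t.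
have E t : t \in `]0, rho]%classic -> (pole_count f t - pole_count f 0) / t = \sum_(b <- B) u b t.
  rewrite inE /= in_itv/= => /andP[t0 tr].
  rewrite (pole_count_list hB tr) (pole_count_list hB (ltW r0)) -sumrB mulr_suml.
  apply: eq_bigr => b _; rewrite /u; case: eqVneq => [->|b0].
    by rewrite normc0 lexx (ltW t0) subrr mul0r.
  by rewrite [normc b <= 0]leNgt normc_gt0 b0 subr0.
have -> : integrated_count rho f = \int[mu]_(t in `]0, rho]) (\sum_(b <- B) u b t)
    + pole_count f 0 * ln rho.
  by congr (_ + _); apply: eq_Rintegral => t; exact: E.
rewrite (pole_count_list hB (ltW r0)).
have H s : (forall b, b \in s -> normc b <= rho) ->
    mu.-integrable `]0, rho] (EFin \o (fun t => \sum_(b <- s) u b t)) /\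
    \int[mu]_(t in `]0, rho]) (\sum_(b <- s) u b t)
    = \sum_(b <- s) (if b == 0 then 0 else ln rho - ln (normc b)).
  elim: s => [|b s IH] sr.
    have -> : (fun t => \sum_(b <- [::]) u b t) = (fun=> 0 : R).
      by apply/funext => t; rewrite big_nil.
    split; first exact: integrable0.
    by rewrite big_nil Rintegral_cst// mul0r.
  have [i1 I1] := IH (fun a ha => sr a (ltac:(by rewrite inE ha orbT))).
  have [i2 I2] : mu.-integrable `]0, rho] (EFin \o u b) /\
      \int[mu]_(t in `]0, rho]) u b t = if b == 0 then 0 else ln rho - ln (normc b).
    rewrite /u; case: eqVneq => [_|b0].
      by split; [exact: integrable0|rewrite Rintegral_cst// mul0r].
    by apply: Rintegral_step_inv; rewrite normc_gt0 b0 sr// mem_head.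
  have Es : (fun t => \sum_(a <- b :: s) u a t) = (fun t => u b t + \sum_(a <- s) u a t).
    by apply/funext => t; rewrite big_cons.
  split; first by rewrite Es; apply: (@integrableD _ _ _ mu _ _ (EFin \o u b)
    (EFin \o (fun t => \sum_(a <- s) u a t))).
  have -> : \int[mu]_(t in `]0, rho]) (\sum_(a <- b :: s) u a t)
     = \int[mu]_(t in `]0, rho]) (u b t + \sum_(a <- s) u a t).
    by apply: eq_Rintegral => t _; rewrite big_cons.
  by rewrite RintegralD// big_cons I1 I2.
have [_ ->] := H B Br; rewrite mulr_suml -big_split /=; apply: eq_bigr => b _.
rewrite /count_term; case: eqVneq => [->|b0]; first by rewrite normc0 lexx mul1r add0r.
by rewrite [normc b <= 0]leNgt normc_gt0 b0 mul0r addr0.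
Qed.

Lemma count_term_ge0 rho b : 1 <= rho -> normc b <= rho -> 0 <= count_term rho b.
Proof.
move=> r1 br; rewrite /count_term; case: eqVneq => [_|b0]; first exact: ln_ge0.
by rewrite subr_ge0 ler_ln ?posrE ?normc_gt0// (lt_le_trans ltr01).
Qed.

Lemma green_le_crude rho z b : normc z < rho -> normc b < rho -> z != b ->
  green rho z b <= ln rho + ln (2 / normc (z - b)).
Proof.
move=> zr br zb; have r0 := rho_gt0 zr.
have zb0 : 0 < normc (z - b) by rewrite normc_gt0 subr_eq0.
rewrite -lnM ?posrE ?divr_gt0//.
have n0 := green_num_gt0 zr br.
rewrite /green ler_ln ?posrE ?divr_gt0 ?mulr_gt0 ?divr_gt0 ?invr_gt0//.
rewrite ler_pdivrMr ?mulr_gt0//.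
have -> : rho * (2 / normc (z - b)) * (rho * normc (z - b)) = 2 * rho ^+ 2.
  by field; rewrite gt_eqF.
apply: le_trans (normcB_le _ _) _.
rewrite normc_real ger0_norm ?exprn_ge0 ?(ltW r0)// normcM normc_conj.
have : normc z * normc b <= rho * rho by rewrite ler_pM ?normc_ge0 ?(ltW zr) ?(ltW br).
by rewrite expr2; lra.
Qed.

(** This is [1 - x <= - ln x] at [x = (|b| / rho)^2]. *)
Lemma weight_le_ln rho b : 0 < rho -> b != 0 ->
  weight rho b <= 2 * (ln rho - ln (normc b)).
Proof.
move=> r0; rewrite -normc_gt0 => b0.
have q0 : 0 < (normc b / rho) ^+ 2 by rewrite exprn_gt0// divr_gt0.
have := ln_le_sub1 q0; rewrite lnXn ?divr_gt0// ln_div ?posrE// /weight -expr_div_n.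
by rewrite mulr2n; lra.
Qed.

(** If [|b| <= rho / 2], the crude bound exceeds [ln (rho / |b|)] by at most [2 ln 2], itself at
    most [2 ln (rho / |b|)]. Otherwise [greenX <= 16], and [weight_le_ln] concludes. *)
Lemma green_le_ln rho z b : normc z < rho -> normc b < rho -> b != 0 ->
  2 * normc z <= normc b -> green rho z b <= 16%:R * (ln rho - ln (normc b)).
Proof.
move=> zr br b0 zb; have r0 := rho_gt0 zr.
have nb : 0 < normc b by rewrite normc_gt0.
have h : normc b / 2 <= normc (z - b).
  by rewrite normcBC; apply: le_trans (normc_sub_ge _ _); lra.
have zb0 : 0 < normc (z - b) by apply: lt_le_trans h; rewrite divr_gt0.
have zNb : z != b by rewrite -subr_eq0 -normc_gt0.
have L0 : 0 <= ln rho - ln (normc b) by rewrite subr_ge0 ler_ln ?posrE// ltW.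
have [x2|x2] := leP (2 * normc b) rho.
  apply: le_trans (green_le_crude zr br zNb) _.
  have l2 : ln 2 <= ln rho - ln (normc b).
    by rewrite -ln_div ?posrE// ler_ln ?posrE ?divr_gt0// ler_pdivlMr.
  have : ln (2 / normc (z - b)) <= ln 2 + ln 2 - ln (normc b).
    rewrite -lnM ?posrE// -ln_div ?posrE// ler_ln ?posrE ?divr_gt0//.
    rewrite ler_pdivrMr// mulrAC ler_pdivlMr//; lra.
  lra.
rewrite greenE//.
have w0 := weight_gt0 r0 br; have wl := weight_le_ln r0 b0.
have X0 := greenX_gt0 zr zNb.
have X16 : greenX rho z b <= 16%:R.
  rewrite /greenX ler_pdivrMr ?exprn_gt0//.
  have : (normc b / 2) ^+ 2 <= normc (z - b) ^+ 2.
    by rewrite lerXn2r ?nnegrE ?normc_ge0 ?divr_ge0// ltW.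
  have : (normc b / 2) ^+ 2 = 4^-1 * normc b ^+ 2 by field.
  have : rho ^+ 2 <= (2 * normc b) ^+ 2.
    by rewrite lerXn2r ?nnegrE ?(ltW r0) ?(ltW x2) ?mulr_ge0 ?normc_ge0.
  have : (2 * normc b) ^+ 2 = 4 * normc b ^+ 2 by ring.
  have := sqr_ge0 (normc z); lra.
have := @le_ln1Dx R (weight rho b * greenX rho z b).
have wX : 0 < weight rho b * greenX rho z b by rewrite mulr_gt0.
have : weight rho b * greenX rho z b <= 2 * (ln rho - ln (normc b)) * 16%:R.
  by rewrite ler_pM ?(ltW w0) ?(ltW X0).
move=> h1 /(_ (ltac:(by apply: lt_trans wX; rewrite ltrN10))) h2; lra.
Qed.

(** Poles with [|b| > R1] satisfy [green_le_ln] and [weight_le_ln], whence [18 = 16 + 2]. The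
    finitely many others cost [ln rho] plus a constant each, as [z0] is not a pole. *)
Lemma pole_terms_bound z0 : meromorphic f -> pole_mult f z0 = 0%N ->
  exists2 C : R, 0 <= C & forall rho B, 2 * normc z0 + 1 <= rho ->
    poles_list f rho B -> (forall b, b \in B -> normc b < rho) ->
    \sum_(b <- B) green rho z0 b + \sum_(b <- B) weight rho b
    <= 18%:R * integrated_count rho f + C.
Proof.
move=> mf p0; pose R1 := 2 * normc z0 + 1.
have [B1 h1] := poles_list_exists R1 mf.
pose C b : R := 1 + `|ln (2 / normc (z0 - b))| + `|ln (normc b)|.
have C0 b : 0 <= C b by rewrite !addr_ge0.
exists (\sum_(b <- B1) C b); first by rewrite sumr_ge0.
move=> rho B zr hB Br; have n0 := normc_ge0 z0.
have r1 : 1 <= rho by lra.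
have r0 : 0 < rho by exact: lt_le_trans r1.
have zr' : normc z0 < rho by lra.
rewrite (integrated_count_list r0 hB) mulr_sumr -big_split /=.
(* Up to order, [B1] is the part of [B] in [|b| <= R1]; this makes the constant independent of
   [rho]. *)
have -> : \sum_(b <- B1) C b = \sum_(b <- B) (if normc b <= R1 then C b else 0).
  rewrite -[RHS]big_mkcond -[RHS]big_filter; apply: perm_big.
  apply/allP => z _ /=; apply/eqP; rewrite h1 count_filter.
  have [zR|zR] := leP (normc z) R1.
    have := hB z; rewrite (le_trans zR zr) => <-; apply: eq_count => b /=.
    by case: eqVneq => [->|//]; rewrite zR.
  rewrite (eq_count (a2 := pred0)) ?count_pred0// => b /=.
  by case: eqVneq => [->|//]; rewrite leNgt zR.
rewrite -big_split /= big_seq [leRHS]big_seq; apply: ler_sum => b bB.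
have br := Br b bB; have N0 := count_term_ge0 r1 (ltW br).
have w1 := @weight_le1 R rho b.
have zNb : z0 != b.
  by apply: contraTneq bB => <-; rewrite (poles_listE _ hB) p0 andbF.
have [bR|bR] := leP (normc b) R1.
  have g := green_le_crude zr' br zNb.
  have : ln rho <= count_term rho b + `|ln (normc b)|.
    rewrite /count_term; case: eqVneq => [_|_]; first by rewrite lerDl.
    by have := ler_norm (ln (normc b)); lra.
  by have := ler_norm (ln (2 / normc (z0 - b))); rewrite /C; lra.
have b0 : b != 0 by rewrite -normc_gt0 (le_lt_trans _ bR)// /R1; lra.
rewrite /count_term (negbTE b0) addr0.
have zb : 2 * normc z0 <= normc b by move: bR; rewrite /R1; lra.
have := green_le_ln zr' br b0 zb; have := weight_le_ln r0 b0; lra.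
Qed.

End CountingFunction.

(** * Approximation of a meromorphic function by rational functions *)

Section Approximants.
Context {R : realType}.
Implicit Types (z w : R[i]).

(** On nonnegative reals [logp x = ln (max x 1)], and [ln] has Lipschitz constant 1 on [[1,
    +oo[]. *)
Lemma logp_dist (x y : R) : 0 <= x -> 0 <= y -> `|logp x - logp y| <= `|x - y|.
Proof.
move=> x0 y0; have E (u : R) : 0 <= u -> logp u = ln (Num.max u 1).
  move=> u0; rewrite /logp; have [u1|u1] := leP u 1.
    by rewrite ln1; apply/max_r/ln_le0.
  by apply/max_l/ln_ge0/ltW.
rewrite !E//.
have m1 (u : R) : 1 <= Num.max u 1 by rewrite le_max lexx orbT.
apply: le_trans (ln_dist_le ltr01 (m1 x) (m1 y)) _; rewrite divr1.
rewrite ler_norml; have := ler_norm (x - y); have := ler_norm (y - x); rewrite [`|y - x|]distrC.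
by have [?|?] := leP x 1; have [?|?] := leP y 1; lra.
Qed.

Lemma logp_ge0 (x : R) : 0 <= logp x.
Proof. by rewrite /logp le_max lexx orbT. Qed.

Lemma logp0 : logp (0 : R) = 0.
Proof. by rewrite /logp ln0// maxxx. Qed.

Lemma logp_normc_dist z w : `|logp (normc z) - logp (normc w)| <= normc (z - w).
Proof. exact: le_trans (logp_dist (normc_ge0 z) (normc_ge0 w)) (dist_normc _ _). Qed.

Lemma ccont_logp (phi : R -> R[i]) t : ccont phi t ->
  continuous_at t (fun t => logp (normc (phi t))).
Proof.
move=> /ccontP H; apply/cvgrPdist_le => e e0; have [r r0 Hr] := H e e0.
rewrite -nbhs_nearE; apply/nbhs_ballP; exists r => // x /=.
rewrite /ball/= distrC => xr; rewrite distrC.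
exact: le_trans (logp_normc_dist _ _) (Hr _ xr).
Qed.

Lemma horner_lipschitz (p : {poly R[i]}) (M : R) : 0 <= M -> exists L : R, [/\ 0 <= L,
  forall z, normc z <= M -> normc p.[z] <= L &
  forall z w, normc z <= M -> normc w <= M -> normc (p.[z] - p.[w]) <= L * normc (z - w)].
Proof.
move=> M0; elim/poly_ind: p => [|p c [L [L0 H1 H2]]].
  exists 0; split=> // [z _|z w _ _]; first by rewrite horner0 normc0.
  by rewrite !horner0 subrr normc0 mul0r.
have n0 := normc_ge0 c.
exists (L * M + L + normc c); split.
- by rewrite !addr_ge0 ?mulr_ge0.
- move=> z zM; rewrite !hornerE; apply: le_trans (normcD_le _ _) _; rewrite normcM.
  have := ler_pM (normc_ge0 _) (normc_ge0 _) (H1 z zM) zM; lra.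
- move=> z w zM wM; rewrite !hornerE.
  have -> : p.[z] * z + c - (p.[w] * w + c) = p.[z] * (z - w) + (p.[z] - p.[w]) * w by ring.
  apply: le_trans (normcD_le _ _) _; rewrite !normcM.
  have a1 := ler_wpM2r (normc_ge0 (z - w)) (H1 z zM).
  have a2 := ler_pM (normc_ge0 _) (normc_ge0 _) (H2 z w zM wM) wM.
  have := mulr_ge0 n0 (normc_ge0 (z - w)); lra.
Qed.

(** A polynomial approximation [p] may have roots on the circle. Replacing [p w] by [p (t w)] with
    [t] slightly above 1 divides the roots by [t] and moves them off it. The condition [e < |g z0|]
    forces [p != 0]. *)
Lemma rational_approx (g : R[i] -> R[i]) (r rho e : R) z0 : cdiff_disc g r ->
  0 < rho < r -> normc z0 <= rho -> 0 < e < normc (g z0) ->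
  exists (k : R[i]) (A : seq R[i]), [/\ k != 0, forall a, a \in A -> normc a != rho &
    forall w, normc w <= rho -> normc (g w - k * \prod_(a <- A) (w - a)) <= e].
Proof.
move=> dg /andP[rho0 rr] z0r /andP[e0 eg].
have e2 : 0 < e / 2 by rewrite divr_gt0.
have rho_r : 0 <= rho < r by rewrite (ltW rho0).
have [p Hp] := poly_approx dg rho_r e2.
have pN0 : p != 0.
  apply: contraTneq eg => p0; have := Hp z0 z0r; rewrite p0 horner0 subr0 => h.
  by rewrite -leNgt (le_trans h)// ler_pdivrMr//; lra.
have [A0 pE] := closed_field_poly_normal p.
have M0 : 0 <= 2 * rho by rewrite mulr_ge0// ltW.
have [L [L0 _ HL]] := horner_lipschitz p M0.
have [s s0 Hs] := dist_seq_pos [seq (normc a / rho)%:C | a <- A0] 1.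
(* The first entry keeps [t = 1 + tau] away from every ratio [|a| / rho], the second keeps [t w] in
   the disc of radius [2 rho] where [L] is valid, the third limits the change of [p] to [e / 2]. *)
pose tau := Num.min (s / 2) (Num.min 1 (e / 2 / (rho * (L + 1)))).
have L1 : 0 < rho * (L + 1) by rewrite mulr_gt0// ltr_wpDl.
have tau0 : 0 < tau by rewrite !lt_min ltr01 !divr_gt0.
have tau_s : tau <= s / 2 by rewrite ge_min lexx.
have tau1 : tau <= 1 by rewrite !ge_min lexx !orbT.
have tau_e : tau <= e / 2 / (rho * (L + 1)) by rewrite !ge_min lexx !orbT.
pose t := 1 + tau; have t0 : 0 < t by rewrite /t; lra.
have tC : (t%:C : R[i]) != 0 by rewrite -normc_gt0 normc_real gtr0_norm.
pose A := [seq a / t%:C | a <- A0].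
have P w : \prod_(a <- A0) (t%:C * w - a) = t%:C ^+ size A0 * \prod_(a <- A) (w - a).
  rewrite /A; elim: A0 {pE Hs A} => [|a A0 IH]; first by rewrite !big_nil mulr1.
  by rewrite /= !big_cons IH exprS; field.
exists (lead_coef p * t%:C ^+ size A0), A; split.
- by rewrite mulf_neq0 ?expf_neq0// lead_coef_eq0.
- move=> _ /mapP[a aA ->]; rewrite normcM normcV normc_real (gtr0_norm t0).
  apply: contraTneq tau_s => na; rewrite -ltNge.
  have nE : normc a / rho = t.
    apply/eqP; rewrite -(inj_eq (mulIf (lt0r_neq0 rho0))) divfK ?lt0r_neq0//; apply/eqP.
    by rewrite -na mulrCA divff ?mulr1// gt_eqF.
  have tin : t%:C \in [seq (normc b / rho)%:C | b <- A0].
    by apply/mapP; exists a => //; rewrite nE.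
  have := Hs _ tin.
  have -> : (t%:C != 1 :> R[i]) by rewrite -subr_eq0 /t rmorphD rmorph1 addrAC subrr add0r
    -normc_gt0 normc_real gtr0_norm.
  move=> /(_ isT); rewrite /t rmorphD rmorph1 addrAC subrr add0r normc_real (gtr0_norm tau0).
  lra.
- move=> w wr; rewrite -mulrA -P.
  have -> : lead_coef p * \prod_(a <- A0) (t%:C * w - a) = p.[t%:C * w].
    rewrite [in RHS]pE hornerZ horner_prod; congr (_ * _).
    by apply: eq_bigr => a _; rewrite !hornerE.
  rewrite -(subrKA p.[w]) [e]splitr; apply: le_trans (normcD_le _ _) _.
  apply: lerD; first exact: Hp.
  apply: le_trans (HL _ _ _ _) _.
  + lra.
  + rewrite normcM normc_real (gtr0_norm t0).
    by rewrite ler_pM ?normc_ge0 ?(ltW t0)//; rewrite /t; lra.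
  + have -> : w - t%:C * w = - (tau%:C * w) by rewrite /t rmorphD rmorph1; ring.
    rewrite normc_opp normcM normc_real (gtr0_norm tau0).
    move: tau_e; rewrite ler_pdivlMr// => h.
    have := mulr_ge0 (mulr_ge0 L0 (ltW tau0)) (_ : 0 <= rho - normc w).
    rewrite subr_ge0 => /(_ wr); have := mulr_ge0 (ltW tau0) (ltW rho0); lra.
Qed.

End Approximants.

(** * Fatou's lemma for circle means, and exceptional parameters *)

Section Fatou.
Import HBNNSimple.
Context {R : realType}.
Let mu := @lebesgue_measure R.

(* The integrand [u] need not be measurable: its integral is a supremum over
   simple functions below it. *)
Lemma fatou_rmean (u : R -> R) (h : nat -> R -> R) (N : set R) (K : R) :
  countable N -> (forall t, 0 <= u t) -> (forall n t, 0 <= h n t) ->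
  (forall n, rint (h n)) -> (forall n, rmean (h n) <= K) ->
  (forall t, 0 <= t <= 2 * pi -> ~ N t -> forall e : R, 0 < e ->
     exists n0, forall n, (n0 <= n)%N -> u t <= h n t + e) ->
  rmean u <= K.
Proof.
move=> cN u0 h0 ih hK Hu.
pose D : set (measurableTypeR R) := `[0, 2 * pi]%classic.
have mD : measurable D by exact: measurable_itv.
pose H (t : measurableTypeR R) := limn_einf (fun n => (h n t)%:E).
have mh n : measurable_fun D (EFin \o h n) by have /integrableP[] := ih n.
have h0' n t : D t -> (0 <= (h n t)%:E)%E by rewrite lee_fin.
have mH : measurable_fun D H.
  apply: measurableT_comp => //; apply: measurable_fun_limn_esup => n.
  exact: (measurableT_comp (@oppe_measurable R setT) (mh n)).
have einfs_le (v : (\bar R)^nat) n : (einfs v n <= v n)%E.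
  by apply: ereal_inf_lbound; exists n => /=.
have HK : (\int[mu]_(t in D) H t <= (2 * pi * K)%:E)%E.
  have F := @fatou _ _ _ mu D mD (fun n => EFin \o h n) mh h0'.
  apply: (le_trans F); rewrite limn_einf_lim; apply: lime_le; first exact: is_cvg_einfs.
  apply: nearW => n; apply: le_trans (einfs_le _ n) _.
  have /integrable_fin_num : mu.-integrable D (EFin \o h n) := ih n.
  move=> /(_ mD)/fineK <-; rewrite lee_fin -ler_pdivrMl ?twopi_gt0//.
  exact: hK.
have H0 t : (0 <= H t)%E.
  rewrite /H limn_einf_lim; apply: lime_ge; first exact: is_cvg_einfs.
  by apply: nearW => n; apply: le_ereal_inf_tmp => _ [k _ <-]; rewrite lee_fin.
have uH t : D t -> ~ N t -> ((u t)%:E <= H t)%E.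
  rewrite /D /= in_itv/= => Dt Nt; apply/lee_addgt0Pr => e e0; have [n0 Hn] := Hu t Dt Nt e e0.
  rewrite -leeBlDr// -EFinB /H limn_einf_lim; apply: lime_ge; first exact: is_cvg_einfs.
  exists n0 => // n /= nn; apply: le_ereal_inf_tmp => _ [k /= nk <-].
  by rewrite lee_fin lerBlDr Hn// (leq_trans nn).
have uK : (\int[mu]_(t in D) (u t)%:E <= (2 * pi * K)%:E)%E.
  apply: le_trans HK; rewrite ge0_integralE; last by move=> t _; rewrite lee_fin.
  apply: ge_ereal_sup => _ [phi /= Hphi <-].
  have phiD t : ~ D t -> phi t = 0.
    move=> Dt; apply/eqP; rewrite eq_le; have := Hphi t.
    by rewrite patchE memNset// lee_fin => ->/=; exact: fun_ge0.
  have -> : sintegral mu phi = (\int[mu]_(t in D) (phi t)%:E)%E.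
    rewrite integral_nnsfun//; congr sintegral; apply/funext => t.
    by rewrite patchE; case: ifPn => // /negP; rewrite inE => /phiD.
  apply: ae_ge0_le_integral => //.
  - by move=> t _; rewrite lee_fin; exact: fun_ge0.
  - by apply/measurable_EFinP; exact: measurable_funTS.
  exists N; split.
  - exact: countable_measurable.
  - exact: countable_lebesgue_measure0.
  move=> t /= Ht; apply: contrapT => Nt; apply: Ht => Dt.
  by apply: le_trans (uH t Dt Nt); have := Hphi t; rewrite patchE mem_set.
rewrite /rmean ler_pdivrMl ?twopi_gt0// /Rintegral -lee_fin fineK//.
rewrite ge0_fin_numE; first exact: le_lt_trans uK (ltry _).
by apply: integral_ge0 => t _; rewrite lee_fin.
Qed.

(** The cosine is injective on [[0, pi]] and, after reflection, on [[pi, 2 pi]], so each half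
    contains at most one solution. *)
Lemma finite_circ_eq (r : R) (b : R[i]) : 0 < r ->
  finite_set [set t | 0 <= t <= 2 * pi /\ circ r t = b].
Proof.
move=> r0; have C1 (S : set R) : (forall x y, S x -> S y -> x = y) -> finite_set S.
  move=> H; have [[x Sx]|nS] := pselect (S !=set0).
    rewrite (_ : S = [set x]); first exact: finite_set1.
    by apply/seteqP; split => [y /H|y ->//]; apply.
  rewrite (_ : S = set0); first exact: finite_set0.
  by apply/seteqP; split => // y Sy; apply: nS; exists y.
have ce x y : circ r x = b -> circ r y = b -> cos x = cos y.
  move=> <- [/mulfI E _]; symmetry; apply: E; exact: lt0r_neq0.
have U : [set t | 0 <= t <= 2 * pi /\ circ r t = b] `<=`
    [set t | 0 <= t <= pi /\ circ r t = b] `|` [set t | pi <= t <= 2 * pi /\ circ r t = b].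
  move=> t /= [/andP[t0 t2] tb]; have [tp|tp] := leP t pi; [left|right]; split => //.
    by rewrite t0.
  by rewrite (ltW tp).
apply: (sub_finite_set U); rewrite finite_setU; split; apply: C1 => x y /= [hx bx] [hy yb].
  by apply: (@cos_inj R); rewrite ?in_itv//=; exact: ce.
have : 2 * pi - x = 2 * pi - y.
  apply: (@cos_inj R); rewrite ?in_itv/=; [lra|lra|].
  have c2 (u : R) : cos (2 * pi - u) = cos u.
    by rewrite -cosN opprB mulr_natl -(cosD2pi (u - pi *+ 2)) subrK.
  by rewrite !c2; exact: ce.
lra.
Qed.

End Fatou.

(** * The proximity function of the quotient, for good radii *)

Section MeromorphicQuotient.
Context {R : realType}.
Implicit Types (f : R[i] -> R[i]) (rho e : R) (z w : R[i]).

Lemma prod_sub_lb (B : seq R[i]) rho w : normc w = rho -> (forall b, b \in B -> normc b < rho) ->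
  0 < \prod_(b <- B) (rho - normc b) <= normc (\prod_(b <- B) (w - b)).
Proof.
move=> wr; elim: B => [|b B IH] hB; first by rewrite !big_nil normc1 ltr01 lexx.
have /andP[p0 pw] : 0 < \prod_(b <- B) (rho - normc b) <= normc (\prod_(b <- B) (w - b)).
  by apply: IH => x xB; apply: hB; rewrite inE xB orbT.
have br := hB b (mem_head _ _); rewrite !big_cons normcM mulr_gt0 ?subr_gt0//=.
apply: ler_pM; rewrite ?subr_ge0 ?(ltW br) ?(ltW p0)//.
by rewrite -{1}wr; exact: normc_sub_ge.
Qed.

Lemma normc_div_close (a b : R[i]) e : b != 0 -> 0 < e -> exists2 eta : R, 0 < eta &
  forall a' b', normc (a' - a) <= eta -> normc (b' - b) <= eta ->
    normc (a / b - a' / b') <= e.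
Proof.
rewrite -normc_gt0 => b0 e0; have S : 0 < normc a + normc b by rewrite ltr_wpDl ?normc_ge0.
exists (Num.min (normc b / 2) (e * normc b ^+ 2 / (2 * (normc a + normc b)))).
  by rewrite lt_min !divr_gt0 ?mulr_gt0 ?exprn_gt0.
move=> a' b'; rewrite !le_min => /andP[_ ha] /andP[hb1 hb2].
have b2 : normc b / 2 <= normc b'.
  by have := normc_sub_ge b (b - b'); rewrite subKr normcBC; lra.
have b'0 : 0 < normc b' by apply: lt_le_trans b2; rewrite divr_gt0.
have bN : b != 0 by rewrite -normc_gt0.
have b'N : b' != 0 by rewrite -normc_gt0.
have -> : a / b - a' / b' = (a * (b' - b) - (a' - a) * b) / (b * b').
  by field; rewrite bN b'N.
rewrite normcM normcV normcM ler_pdivrMr ?mulr_gt0//.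
apply: le_trans (normcB_le _ _) _; rewrite !normcM.
set y := e * _ / _ in ha hb2.
have yE : y * (normc a + normc b) = e * normc b ^+ 2 / 2.
  by rewrite /y; field; rewrite gt_eqF.
apply: (@le_trans _ _ (y * (normc a + normc b))).
  have := ler_wpM2l (normc_ge0 a) hb2; have := ler_wpM2r (ltW b0) ha; lra.
rewrite yE expr2 !mulrA -mulrA ler_wpM2l// mulr_ge0 ?(ltW e0) ?(ltW b0)//.
Qed.

(** Only the numerator is approximated: all approximants share the poles [B], and the error is
    divided by the modulus of the common denominator. *)
Lemma meromorphic_approx f rho z0 : meromorphic f -> generic f rho -> normc z0 < rho ->
  pole_mult f z0 = 0%N -> f z0 != 0 -> exists B, [/\ poles_list f rho B,
    forall b, b \in B -> normc b < rho & forall e, 0 < e -> exists k A, [/\ k != 0,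
      forall a, a \in A -> normc a != rho & forall w, normc w <= rho -> w \notin B ->
        normc (ratf k A B w - f w) <= e / normc (\prod_(b <- B) (w - b))]].
Proof.
move=> mf gf z0r p0 fz0; have [B [g [r [rr hB Br dg fg]]]] := generic_factor mf gf.
exists B; split => // e e0.
have z0B : z0 \notin B by rewrite (poles_listE z0 hB) p0 eqxx andbF.
have gz0 : 0 < normc (g z0).
  rewrite normc_gt0; apply: contra fz0 => /eqP gz0.
  by rewrite fg// ?gz0 ?mul0r// (le_trans (ltW z0r))// ltW.
pose e' := Num.min e (normc (g z0) / 2).
have he' : 0 < e' < normc (g z0).
  rewrite lt_min gt_min e0 divr_gt0//=; apply/orP; right; lra.
have hr : 0 < rho < r by rewrite rr (le_lt_trans (normc_ge0 z0)).
have [k [A [k0 hA kA]]] := rational_approx dg hr (ltW z0r) he'.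
exists k, A; split => // w wr wB.
have Q0 := prod_sub_neq0 wB.
rewrite (fg w)//; last by rewrite (le_trans wr)// ltW.
rewrite /ratf -mulrBl normcM normcV ler_pM2r ?invr_gt0 ?normc_gt0//.
by rewrite normcBC (le_trans (kA w wr))// ge_min lexx.
Qed.

Lemma cdiff_not_pole f z : meromorphic f -> pole_mult f z = 0%N -> cdiff f z.
Proof.
move=> mf /(not_pole_holomorphic mf)/holomorphic_cdiff[e e0]; apply.
by rewrite subrr normc0.
Qed.

Lemma rint_logp_circ f rho : meromorphic f -> 0 <= rho -> generic f rho ->
  rint (fun t => logp (normc (f (circ rho t)))).
Proof.
move=> mf r0 gf; apply: rint_cont => t; apply: ccont_logp; apply: ccont_comp.
  by apply: cdiff_not_pole => //; apply: gf; rewrite normc_circ.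
exact: ccont_circ.
Qed.

Lemma proximity_ge0 f rho : 0 <= proximity rho f.
Proof. by apply: rmean_ge0 => t; exact: logp_ge0. Qed.

(* On the circle the approximants are within 1 of [f]. *)
Lemma proximity_approx f rho k A B e : meromorphic f -> 0 < rho -> generic f rho -> k != 0 ->
  (forall a, a \in A -> normc a != rho) -> (forall b, b \in B -> normc b < rho) ->
  e <= \prod_(b <- B) (rho - normc b) ->
  (forall w, normc w <= rho -> w \notin B ->
    normc (ratf k A B w - f w) <= e / normc (\prod_(b <- B) (w - b))) ->
  rmean (fun t => Num.max (lncirc k A B rho t) 0) <= proximity rho f + 1.
Proof.
move=> mf r0 gf k0 hA hB em H; have ip := rint_logp_circ mf (ltW r0) gf.
rewrite -[X in _ + X](rmean_cst (1 : R)) /proximity -/(rmean _) -rmeanD//; last exact: rint_cst.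
apply: le_rmean.
- exact: rint_lncirc_pos.
- exact: rintD ip (rint_cst 1).
move=> t; have cB : circ rho t \notin B := circ_notinB r0 hB t.
have nr : normc (circ rho t) = rho by rewrite normc_circ// ltW.
have /andP[q0 q1] := prod_sub_lb nr hB.
have := H (circ rho t); rewrite nr lexx => /(_ isT cB) h.
have h1 : normc (ratf k A B (circ rho t) - f (circ rho t)) <= 1.
  by apply: le_trans h _; rewrite ler_pdivrMr ?mul1r ?(le_trans em)// (lt_le_trans q0).
have := logp_normc_dist (ratf k A B (circ rho t)) (f (circ rho t)).
rewrite -/(lncirc k A B rho t) {1}/logp -/(lncirc k A B rho t) ler_norml => /andP[_].
rewrite -/(circ rho t); lra.
Qed.

End MeromorphicQuotient.

Section QuotientBound.
Context {R : realType}.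
Variables (f : R[i] -> R[i]) (c z0 : R[i]) (d : R).
Hypotheses (mf : meromorphic f) (c0 : c != 0) (hd : 0 < d < 1).
Hypotheses (pz0 : pole_mult f z0 = 0%N) (fz0 : f z0 != 0).

Lemma over_succ_small (x e : R) : 0 <= x -> 0 < e ->
  exists n0, forall n, (n0 <= n)%N -> x / n.+1%:R <= e.
Proof.
move=> x0 e0; have [n0 Hn] : exists n, x / e < n%:R.
  by exists (Num.bound (x / e)); apply: archi_boundP; rewrite divr_ge0// ltW.
exists n0 => n nn; rewrite ler_pdivrMr ?ltr0n// mulrC -ler_pdivrMr//.
by rewrite (le_trans (ltW Hn))// ler_nat (leq_trans nn).
Qed.

(** The first entry keeps the approximants within 1 of [f] on the circle, the second within
    [|f z0| / 2] of [f z0] at [z0]. *)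
Definition tolerance (rho : R) (B : seq R[i]) : R :=
  Num.min (\prod_(b <- B) (rho - normc b))
    (normc (\prod_(b <- B) (z0 - b)) * (normc (f z0) / 2)).

(** The bound is the same for all approximants, whatever the number of their zeros. Here
    [144 = 8 * 18] multiplies the factors of [zeros_poles_bound] and [pole_terms_bound]; [C]
    collects the error 1 in the proximity function, the poles near the origin and
    [ln (|f z0| / 2)]. *)
Lemma approx_sums_bound : exists2 C : R, 0 <= C & forall rho k A B e,
  2 * normc z0 + 1 <= rho -> generic f rho -> k != 0 ->
  (forall a, a \in A -> normc a != rho) -> (forall b, b \in B -> normc b < rho) ->
  poles_list f rho B ->
  e <= tolerance rho B ->
  (forall w, normc w <= rho -> w \notin B ->
    normc (ratf k A B w - f w) <= e / normc (\prod_(b <- B) (w - b))) ->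
  rmean (fun t => `|lncirc k A B rho t|) + \sum_(a <- A | normc a < rho) weight rho a
    + \sum_(b <- B) weight rho b <= 144%:R * (characteristic rho f + C).
Proof.
have [C C0 HC] := pole_terms_bound mf pz0.
have F0 : 0 < normc (f z0) by rewrite normc_gt0.
pose L := ln (normc (f z0) / 2).
exists (1 + C + `|L|); first by rewrite !addr_ge0.
move=> rho k A B e rz gf k0 hA hB pB; rewrite /tolerance le_min => /andP[em ez] H.
have zr0 := normc_ge0 z0.
have r0 : 0 < rho by lra.
have z2 : normc z0 <= rho / 2 by lra.
have z0B : z0 \notin B by rewrite (poles_listE z0 pB) pz0 eqxx andbF.
have Q0 : 0 < normc (\prod_(b <- B) (z0 - b)) by rewrite normc_gt0 prod_sub_neq0.
have Fz : normc (f z0) / 2 <= normc (ratf k A B z0).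
  have zr : normc z0 <= rho by lra.
  have := H z0 zr z0B; rewrite ler_pdivlMr// => h.
  have : normc (ratf k A B z0 - f z0) <= normc (f z0) / 2.
    by rewrite -(ler_pM2r Q0) [X in _ <= X]mulrC (le_trans h).
  have := normc_sub_ge (f z0) (f z0 - ratf k A B z0).
  by rewrite subKr normcBC; lra.
have z0A : z0 \notin A.
  apply/negP => zA; move: Fz; rewrite ratf_eq0 ?zA// normc0; lra.
have X1 := zeros_poles_bound k0 r0 hA hB z2 z0A z0B.
have X2 := proximity_approx mf r0 gf k0 hA hB em H.
have X3 := HC rho B rz pB hB.
have X4 : L <= ln (normc (ratf k A B z0)).
  by rewrite ler_ln ?posrE ?divr_gt0// (lt_le_trans _ Fz)// divr_gt0.
have W : 0 <= \sum_(b <- B) weight rho b.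
  by rewrite big_seq sumr_ge0// => b /hB br; apply/ltW/weight_gt0.
have P0 := proximity_ge0 f rho; have L1 := ler_norm (- L); rewrite normrN in L1.
have L2 := normr_ge0 L; rewrite /characteristic; lra.
Qed.

(** The uniform control of [approx_sums_bound] bounds the means of [quot_bound] over the circle, and
    Fatou's lemma transfers this to [f], since the quotients of the approximants converge off
    finitely many parameters. *)
Lemma proximity_quotient_bound : exists K1 K2 : R, [/\ 0 <= K1, 0 <= K2 & forall r rho eta,
  1 <= r -> 0 < eta <= 1 -> eta * rho <= rho - (r + normc c) -> 2 * normc z0 + 1 <= rho ->
  generic f rho -> 0 <= characteristic rho f + K2 /\
  proximity r (fun z => f (z + c) / f z) <=
    K1 * (eta ^+ 4)^-1 * r `^ (- d) * (characteristic rho f + K2)].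
Proof.
have [C1 C10 HC1] := approx_sums_bound; have [C C0 HC] := circle_power_mean hd.
have nc := normc_ge0 c.
(* [M] dominates both coefficients of the averaged bound: [2 |c|] from the Poisson kernels, and
   [98 |c|] plus twice the doubled power term from the Green functions. *)
pose M := 100%:R * normc c + 4 * (normc c `^ d / d) * C.
have D0 : 0 <= normc c `^ d / d by rewrite divr_ge0 ?powR_ge0//; case/andP: hd => /ltW.
have M0 : 0 <= M by rewrite /M addr_ge0//; [exact: mulr_ge0|apply: mulr_ge0 => //; exact: mulr_ge0].
exists (M * 144%:R), C1; split; [by rewrite mulr_ge0 ?ler0n|exact: C10|].
move=> r rho eta r1 he her rz gf.
have r0 : 0 < r by lra.
have rho0 : 0 < rho by have := normc_ge0 z0; lra.
have sr : r + normc c < rho by have : 0 < eta * rho; [case/andP: he => e0 _; exact: mulr_gt0|lra].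
have zr : normc z0 < rho by have := normc_ge0 z0; lra.
have [B [pB hB approx]] := meromorphic_approx mf gf zr pz0 fz0.
have nr0 : normc (circ rho 0) = rho by rewrite normc_circ// ltW.
have /andP[q0 _] := prod_sub_lb nr0 hB.
have z0B : z0 \notin B by rewrite (poles_listE z0 pB) pz0 eqxx andbF.
pose e0 := tolerance rho B.
have e00 : 0 < e0 by rewrite /e0 /tolerance lt_min q0 mulr_gt0 ?divr_gt0// normc_gt0// prod_sub_neq0.
pose en n := e0 / n.+1%:R.
have en0 n : 0 < en n by rewrite divr_gt0.
have en_le n : en n <= e0 by rewrite ler_pdivrMr// ler_peMr ?(ltW e00)// ler1n.
have /choice[kA HkA] : forall n, exists kA : R[i] * seq R[i], [/\ kA.1 != 0,
      forall a, a \in kA.2 -> normc a != rho & forall w, normc w <= rho -> w \notin B ->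
        normc (ratf kA.1 kA.2 B w - f w) <= en n / normc (\prod_(b <- B) (w - b))].
  by move=> n; have [k [A H]] := approx _ (en0 n); exists (k, A).
have X n : rmean (fun t => `|lncirc (kA n).1 (kA n).2 B rho t|)
    + \sum_(a <- (kA n).2 | normc a < rho) weight rho a
    + \sum_(b <- B) weight rho b <= 144%:R * (characteristic rho f + C1).
  have [k0 hA hK] := HkA n; exact: HC1 rz gf k0 hA hB pB (en_le n) hK.
have m0 n : 0 <= rmean (fun t => `|lncirc (kA n).1 (kA n).2 B rho t|) by exact: rmean_ge0.
have A0 n : 0 <= \sum_(a <- (kA n).2 | normc a < rho) weight rho a by exact: weight_sum_ge0.
have B0 : 0 <= \sum_(b <- B) weight rho b.
  by rewrite big_seq sumr_ge0// => b /hB br; apply/ltW/weight_gt0.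
have T0 : 0 <= characteristic rho f + C1 by have := X 0%N; have := m0 0%N; have := A0 0%N; lra.
split => //.
pose s := r + normc c.
(* Parameters at which [circ r t] or its shift is a pole; there the approximants need not converge
   to [f]. *)
pose N := [set t | 0 <= t <= 2 * pi /\ (circ r t \in B \/ circ r t + c \in B)].
have cN : countable N.
  pose S (b : R[i]) := [set t | 0 <= t <= 2 * pi /\ circ r t = b].
  apply: (@sub_countable _ _ _ (\bigcup_(b in [set` B]) (S b `|` S (b - c)))).
    apply: subset_card_le => t [ht [tB|tB]]; [exists (circ r t) => //; left|
      exists (circ r t + c) => //; right]; split => //; by rewrite addrK.
  apply: bigcup_countable => [|b _]; first exact/finite_set_countable/finite_seq.
  by apply: finite_set_countable; rewrite finite_setU; split; exact: finite_circ_eq.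
have Hr a := HC r a r0.
have QB n := rint_quot_bound (kA n).1 (kA n).2 rho0 hB c s he hd r0 Hr.
(* All negative powers of [eta] are raised to the fourth, and [rho^(-1) <= r^(-1) <= r^(-d)] because
   [1 <= r <= rho] and [d < 1]. *)
have coef : 2 * rho * normc c / (rho - s) ^+ 2 <= M * (eta ^+ 4)^-1 * r `^ (- d) /\
    98%:R * normc c / (eta ^+ 4 * rho) + 2 * (2 * (normc c `^ d / d) / eta) * (C * r `^ (- d))
      <= M * (eta ^+ 4)^-1 * r `^ (- d).
  move: D0; rewrite /M; set D := _ / d => D0.
  have [eta0 eta1] := andP he; have [d0 d1] := andP hd.
  have ie0 : 0 < eta^-1 by rewrite invr_gt0.
  have ie1 : 1 <= eta^-1 by rewrite invf_ge1.
  have p1 : rho^-1 <= r `^ (- d).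
    apply: (@le_trans _ _ r^-1); first by rewrite lef_pV2 ?posrE//; lra.
    by rewrite -powR_inv1 ?(ltW r0)// ler_powR//; lra.
  set p := r `^ (- d) in p1 *; have ir0 : 0 < rho^-1 by rewrite invr_gt0.
  have q2 : eta^-1 ^+ 2 <= eta^-1 ^+ 4 by rewrite ler_weXn2l.
  have q1 : eta^-1 <= eta^-1 ^+ 4 by rewrite -{1}[eta^-1]expr1 ler_weXn2l.
  rewrite -(exprVn eta); set q := eta^-1 ^+ 4 in q1 q2 *.
  have qge0 : 0 <= q by lra.
  have qp : eta^-1 ^+ 2 * rho^-1 <= q * p by rewrite ler_pM// ?sqr_ge0// ltW.
  have qp' : q * rho^-1 <= q * p by rewrite ler_wpM2l.
  have p0 : 0 <= p by lra.
  have DC0 : 0 <= D * C by exact: mulr_ge0.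
  have U : 4 * D * C * q * p = (D * C) * (4 * (q * p)) by ring.
  split.
    apply: (@le_trans _ _ (2 * normc c * (eta^-1 ^+ 2 * rho^-1))).
      have -> : 2 * normc c * (eta^-1 ^+ 2 * rho^-1) = 2 * rho * normc c / (eta * rho) ^+ 2.
        by field; rewrite !gt_eqF.
      apply: ler_wpM2l; first by rewrite mulr_ge0 ?mulr_ge0 ?(ltW rho0).
      have er0 : 0 < eta * rho by exact: mulr_gt0.
      have rs0 : 0 < rho - s by rewrite subr_gt0.
      by rewrite lef_pV2 ?posrE ?exprn_gt0// ler_pXn2r ?nnegrE ?(ltW er0) ?(ltW rs0).
    have i1 := ler_wpM2l (mulr_ge0 (ler0n R 2) nc) qp.
    have i2 := mulr_ge0 DC0 (mulr_ge0 qge0 p0).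
    have i3 := mulr_ge0 nc (mulr_ge0 qge0 p0); apply: (le_trans i1); lra.
  have -> : 98%:R * normc c / (eta ^+ 4 * rho) = 98%:R * normc c * (q * rho^-1).
    by rewrite /q exprVn; field; rewrite !gt_eqF.
  have i1 := ler_wpM2l nc qp'.
  have i2 := ler_wpM2l DC0 (ler_wpM2r p0 q1).
  have i3 := mulr_ge0 nc (mulr_ge0 qge0 p0).
  have -> : 2 * (2 * D / eta) * (C * p) = 4 * (D * C * (eta^-1 * p)) by ring.
  lra.
rewrite /proximity -/(rmean _).
apply: (fatou_rmean (h := fun n t => quot_bound (kA n).1 (kA n).2 B rho c eta d s (circ r t)) cN).
- by move=> t; exact: logp_ge0.
- by move=> n t; exact: quot_bound_ge0.
- by move=> n; case: (QB n).
- move=> n; have [_ /le_trans] := QB n; apply.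
  set m := rmean _; set a := \sum_(a <- _ | _) _; set b := \sum_(b <- _) _.
  have [k1 k2] := coef; have Xn : m + a + b <= _ := X n.
  have MQ : 0 <= M * (eta ^+ 4)^-1 * r `^ (- d).
    by rewrite 2?mulr_ge0 ?powR_ge0 ?invr_ge0 ?exprn_ge0//; case/andP: he => /ltW.
  have i1 := ler_wpM2r (m0 n) k1.
  have i2 := ler_wpM2l (addr_ge0 (A0 n) B0) k2.
  have i3 := ler_wpM2l MQ Xn.
  move: i1 i2 i3; rewrite -/m -/a -/b; set U := M * _ * _.
  have -> : M * 144%:R * (eta ^+ 4)^-1 * r `^ (- d) = U * 144%:R by rewrite /U; ring.
  lra.
move=> t ht Nt e ep; rewrite -/(circ r t).
have zs : normc (circ r t) = r by rewrite normc_circ// ltW.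
have [zB wB] : circ r t \notin B /\ circ r t + c \notin B.
  by split; apply/negP => tB; apply: Nt; split => //; [left|right].
move: (circ r t) zs zB wB => z zs zB wB.
have z1 : normc z <= s by rewrite zs /s lerDl.
have w1 : normc (z + c) <= s by rewrite (le_trans (normcD_le _ _))// zs.
(* At a zero of [f] the quotient has the default value 0, so its [logp] is 0. *)
have [fz|fz] := eqVneq (f z) 0.
  exists 0%N => n _; rewrite fz invr0 mulr0 normc0 logp0.
  by rewrite addr_ge0 ?(ltW ep)// quot_bound_ge0.
have [eta1 eta10 Heta] := normc_div_close (f (z + c)) fz ep.
have conv w : normc w <= s -> w \notin B -> exists n0, forall n, (n0 <= n)%N ->
    normc (ratf (kA n).1 (kA n).2 B w - f w) <= eta1.
  move=> ws wsB; have Q0 : 0 < normc (\prod_(b <- B) (w - b)) by rewrite normc_gt0 prod_sub_neq0.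
  have [n0 Hn] := over_succ_small (ltW (divr_gt0 e00 Q0)) eta10.
  exists n0 => n /Hn; apply: le_trans; have [_ _] := HkA n.
  move=> /(_ w) H; apply: le_trans (H _ wsB) _; first by rewrite (le_trans ws)// ltW.
  by rewrite /en mulrAC.
have [n1 H1] := conv z z1 zB; have [n2 H2] := conv (z + c) w1 wB.
exists (maxn n1 n2) => n; rewrite geq_max => /andP[/H1 h1 /H2 h2].
have [k0 hA _] := HkA n.
have := logp_quot_le k0 rho0 hA hB c0 he hd her z1 w1.
have := logp_normc_dist (f (z + c) / f z)
  (ratf (kA n).1 (kA n).2 B (z + c) / ratf (kA n).1 (kA n).2 B z).
have := Heta _ _ h2 h1; rewrite ler_norml => ? /andP[_ ?]; rewrite /s; lra.
Qed.

End QuotientBound.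

(** * A lower bound for the characteristic *)

Section CharacteristicBound.
Context {R : realType}.
Variable f : R[i] -> R[i].
Hypotheses (mf : meromorphic f) (nf : ~ exists a, forall z, f z = a).

(** A point with [f z != 0] may be a pole, where the value means nothing; next to it
    [f = g / (w - z)^k] is regular and nonzero. *)
Lemma exists_nonzero_regular : exists z, pole_mult f z = 0%N /\ f z != 0.
Proof.
have [z fz] : exists z, f z != 0.
  apply: contrapT => h; apply: nf; exists 0 => z.
  by apply: contrapT => fz; apply: h; exists z; apply/eqP.
have [p0|/pole_multP pz] := eqVneq (pole_mult f z) 0%N; first by exists z.
have [g [e [e0 gz dg fg]]] := pole_local pz.
have [e1 e10 He1] := isolated_poles z mf.
have [d dz] : cdiff g z by apply: dg; rewrite subrr normc0.
have hg : 0 < normc (g z) / 2 by rewrite divr_gt0// normc_gt0.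
have [e2 e20 He2] := has_cderiv_cont dz hg.
pose t := Num.min e (Num.min e1 e2) / 2.
have t0 : 0 < t by rewrite divr_gt0// !lt_min e0 e10.
have tlt x : Num.min e (Num.min e1 e2) <= x -> t < x.
  by move=> h; rewrite /t; move: t0; rewrite /t; lra.
have nt : normc (z + t%:C - z) = t by rewrite addrAC subrr add0r normc_real gtr0_norm.
have wz : z + t%:C != z by rewrite -subr_eq0 -normc_gt0 nt.
exists (z + t%:C); split.
  apply: pole_mult0; apply: He1 => //; rewrite nt; apply: tlt.
  by rewrite !ge_min lexx orbT.
rewrite fg//; last by rewrite nt; apply: tlt; rewrite ge_min lexx.
rewrite mulf_neq0 ?invr_eq0 ?expf_neq0 ?subr_eq0//.
have := He2 (z + t%:C); rewrite nt => /(_ (tlt _ _)); rewrite !ge_min lexx !orbT => /(_ isT) h.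
rewrite -normc_gt0; have := normc_sub_ge (g z) (g z - g (z + t%:C)).
rewrite subKr normcBC; lra.
Qed.

(** A pole [b] contributes at least 1 to [N(rho, f)] once [rho >= e (1 + |b|)]. Without poles,
    Liouville's theorem gives a value above [e^4 + 1], and [ln_circle_le] then yields
    [4 <= 3 (m(rho, f) + 1)]. Borel's lemma starts from this bound, and additive constants become
    multiples of [T]. *)
Lemma characteristic_lb : exists rho0 : R, forall rho, rho0 <= rho -> generic f rho ->
  3^-1 <= characteristic rho f.
Proof.
have [[b pb]|np] := pselect (exists b, pole_mult f b != 0%N).
  exists (expR 1 * (1 + normc b)) => rho hr gf.
  have nb := normc_ge0 b.
  have e1 : 2 <= expR 1 :> R by rewrite (le_trans _ (expR_ge1Dx _)).
  have h1 := mulr_ge0 (_ : 0 <= expR 1 - 2) nb; rewrite subr_ge0 in h1.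
  have {}h1 := h1 e1.
  have rho1 : 1 <= rho by lra.
  have rb : normc b <= rho by lra.
  have [B pB] := poles_list_exists rho mf.
  have bB : b \in B by rewrite (poles_listE b pB) rb pb.
  have rho0 : 0 < rho by lra.
  rewrite /characteristic (integrated_count_list rho0 pB) (big_rem b)//=.
  have P0 := proximity_ge0 f rho.
  have S0 : 0 <= \sum_(y <- rem b B) count_term rho y.
    rewrite big_seq sumr_ge0// => y /mem_rem; rewrite (poles_listE y pB) => /andP[yr _].
    exact: count_term_ge0.
  have lr : 1 + ln (1 + normc b) <= ln rho.
    rewrite -[X in X + _](expRK (1 : R)) -lnM ?posrE ?expR_gt0 ?ltr_pwDl//.
    by rewrite ler_ln ?posrE// mulr_gt0 ?expR_gt0 ?ltr_pwDl.
  have : 1 <= count_term rho b.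
    rewrite /count_term; case: eqVneq => [_|b0].
      by have : 0 <= ln (1 + normc b) by [apply: ln_ge0; lra]; lra.
    have : ln (normc b) <= ln (1 + normc b); last by lra.
    by rewrite ler_ln ?posrE ?normc_gt0 ?ltr_pwDl//; lra.
  lra.
have p0 z : pole_mult f z = 0%N by apply/eqP/negPn/negP => pz; apply: np; exists z.
have [z1 hz1] : exists z, expR 4 + 1 < normc (f z).
  apply: contrapT => h; apply: nf; exists (f 0); apply: (@liouville R f (expR 4 + 1)).
    by move=> z; apply: cdiff_not_pole.
  by move=> z; rewrite leNgt; apply/negP => hz; apply: h; exists z.
have n1 := normc_ge0 z1; have e4 := expR_gt0 (4 : R).
exists (2 * normc z1 + 1) => rho hr gf.
have fz1 : f z1 != 0 by rewrite -normc_gt0; lra.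
have zr : normc z1 < rho by lra.
have z2 : normc z1 <= rho / 2 by lra.
have rho0 : 0 < rho by lra.
have [B [pB hB approx]] := meromorphic_approx mf gf zr (p0 z1) fz1.
have B0 : B = [::].
  case: B pB {hB approx} => // b B /(poles_listE b).
  by rewrite mem_head p0 andbF.
have [k [A [k0 hA H]]] := approx 1 ltr01.
have z1B : z1 \notin B by rewrite B0.
have P1 : rmean (fun t => Num.max (lncirc k A B rho t) 0) <= proximity rho f + 1.
  by apply: (proximity_approx mf rho0 gf k0 hA hB _ H); rewrite B0 big_nil.
have Fz : expR 4 <= normc (ratf k A B z1).
  have := H z1 (ltW zr) z1B; rewrite B0 big_nil normc1 divr1 => h.
  have := normc_sub_ge (f z1) (f z1 - ratf k A [::] z1).
  rewrite subKr normcBC; lra.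
have z1A : z1 \notin A by apply/negP => zA; move: Fz; rewrite ratf_eq0 ?zA// normc0; lra.
have L4 : 4 <= ln (normc (ratf k A B z1)).
  by rewrite -(expRK (4 : R)) ler_ln ?posrE// (lt_le_trans e4).
have := ln_circle_le k0 rho0 hA hB z2 z1A z1B B0.
rewrite /characteristic (integrated_count_list rho0 pB) B0 big_nil.
rewrite B0 in P1 L4 *; lra.
Qed.

End CharacteristicBound.

(** * Borel's growth lemma *)

Section BorelGrowth.
Context {R : realType}.
Let mu := @lebesgue_measure R.
Implicit Types (E : set (measurableTypeR R)).

Lemma measurable_invr_pos E : measurable E -> E `<=` `]0, +oo[%classic ->
  measurable_fun E (fun r : measurableTypeR R => (r^-1)%:E).
Proof.
move=> mE E0; apply/measurable_EFinP; apply: (measurable_funS _ E0); first exact: measurable_itv.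
apply: open_continuous_measurable_fun; first exact: interval_open.
move=> x; rewrite inE /= in_itv/= andbT => x0; apply: inv_continuous; exact: lt0r_neq0.
Qed.

(** The interval has length [x h / (1 + h)] and [r^(-1) <= (1 + h) / x] on it; the product is
    [h]. *)
Lemma log_measure_itv (x h : R) E : 0 <= h -> measurable E ->
  E `<=` `]0, +oo[%classic -> E `<=` `[x / (1 + h), x]%classic ->
  (\int[mu]_(r in E) (r^-1)%:E <= h%:E)%E.
Proof.
move=> h0 mE E0 Ex; have h1 : 0 < 1 + h by rewrite ltr_pwDl.
have [x0|x0] := leP x 0.
  rewrite (_ : E = set0) ?integral_set0 ?lee_fin//.
  apply/seteqP; split => // r Er; have := E0 r Er; have := Ex r Er.
  by rewrite /= !in_itv/= andbT => /andP[_ rx]; lra.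
have y0 : 0 < x / (1 + h) by rewrite divr_gt0.
have mf := measurable_invr_pos mE E0.
have B : (\int[mu]_(r in E) (r^-1)%:E <= \int[mu]_(r in E) cst ((x / (1 + h))^-1)%:E r)%E.
  apply: ge0_le_integral => //.
  - by move=> r /E0 /=; rewrite in_itv/= andbT lee_fin invr_ge0 => /ltW.
  - move=> r Er; have := E0 r Er; have := Ex r Er; rewrite /= !in_itv/= andbT => /andP[xr _] r0.
    by rewrite lee_fin lef_pV2 ?posrE.
apply: (le_trans B); rewrite integral_cst//.
have xx : x / (1 + h) <= x by rewrite ler_pdivrMr// ler_peMr ?(ltW x0)// lerDl.
have M : (mu E <= (x - x / (1 + h))%:E)%E.
  apply: (@le_trans _ _ (mu `[x / (1 + h), x]%classic)).
    by apply: le_measure; rewrite ?inE//; exact: measurable_itv.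
  rewrite /mu lebesgue_measure_itv/= lte_fin; case: ifP => // _.
  by rewrite lee_fin subr_ge0.
apply: (@le_trans _ _ (((x / (1 + h))^-1)%:E * (x - x / (1 + h))%:E)%E).
  by apply: lee_wpmul2l => //; rewrite lee_fin invr_ge0 ltW.
rewrite -EFinM lee_fin; have -> : (x / (1 + h))^-1 * (x - x / (1 + h)) = h; last by [].
by field; rewrite !gt_eqF.
Qed.

Lemma sum_geometric_le (C q : R) n : 0 <= C -> 0 < q < 1 ->
  \sum_(0 <= i < n) C * q ^+ i <= C / (1 - q).
Proof.
move=> C0 /andP[q0 q1]; have q1' : 0 < 1 - q by rewrite subr_gt0.
rewrite -mulr_sumr ler_wpM2l// -[leRHS]mul1r ler_pdivlMr//.
suff -> : (\sum_(0 <= i < n) q ^+ i) * (1 - q) = 1 - q ^+ n by rewrite gerBl exprn_ge0// ltW.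
elim: n => [|n IH]; first by rewrite big_geq// mul0r expr0 subrr.
by rewrite big_nat_recr//= mulrDl IH exprS; ring.
Qed.

(** Countable subadditivity, obtained by making the sets disjoint with [seqDU], and a geometric
    series. *)
Lemma finite_log_measure_bigcup (F : nat -> set R) (C q : R) : 0 <= C -> 0 < q < 1 ->
  (forall n, measurable (F n : set (measurableTypeR R))) ->
  (forall n, F n `<=` `]0, +oo[%classic) ->
  (forall n, (\int[mu]_(r in F n) (r^-1)%:E <= (C * q ^+ n)%:E)%E) ->
  finite_log_measure (\bigcup_n F n).
Proof.
move=> C0 hq mF F0 HF; split; first by apply: bigcup_measurable => n _; exact: mF.
have F0' : \bigcup_n F n `<=` `]0, +oo[%classic by move=> r [n _ /F0].
have pos (A : set R) : A `<=` `]0, +oo[%classic -> forall r, A r -> (0 <= (r^-1)%:E)%E.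
  by move=> A0 r /A0 /=; rewrite in_itv/= andbT lee_fin invr_ge0 => /ltW.
have mD n : measurable (seqDU F n : set (measurableTypeR R)) by exact: seqDU_measurable.
have mU : measurable (\bigcup_n F n : set (measurableTypeR R)).
  by apply: bigcup_measurable => n _; exact: mF.
have mf := measurable_invr_pos mU F0'.
rewrite seqDU_bigcup_eq in mf F0' *.
rewrite (ge0_integral_bigcup mu mD mf (pos _ F0') (trivIset_seqDU F)).
apply: (@le_lt_trans _ _ (C / (1 - q))%:E); last exact: ltry.
have ge0 n : (0 <= \int[mu]_(r in seqDU F n) (r^-1)%:E)%E.
  apply: integral_ge0 => r Fr; apply: (pos _ (F0 n)); exact: subset_seqDU Fr.
apply: lime_le; first by apply: is_cvg_nneseries => n _ _; exact: ge0.
apply: nearW => n; apply: (@le_trans _ _ (\sum_(0 <= i < n) (C * q ^+ i)%:E)%E).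
  apply: lee_sum => i _; apply: le_trans (HF i).
  apply: ge0_subset_integral => //; [exact: measurable_invr_pos|exact: pos|exact: subset_seqDU].
by rewrite sumEFin lee_fin; exact: sum_geometric_le.
Qed.

(* Monotonicity of [T] is not available; comparing [r] with the supremum of each
   sublevel set of [T], rather than with a shifted value of [T], makes up for it. *)
Lemma borel_growth (T : R -> R) (G : set R) (tau kap r1 : R) : 0 < tau -> 0 < kap ->
  countable (`]0, +oo[ `\` G) -> (forall r, r1 <= r -> G r -> tau <= T r) ->
  exists E : set R, [/\ E `<=` `]0, +oo[%classic, finite_log_measure E &
    forall r, 0 < r -> r1 <= r -> ~ E r -> exists s h, [/\ G s, 0 < h <= 1,
      r * (1 + h) <= s, T s <= 2 * T r &
      tau <= T r /\ (h ^+ 4)^-1 <= (2 * T r / tau) `^ (4 * kap)]].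
Proof.
move=> tau0 kap0 cG GT.
pose A n := [set r | [/\ 0 < r, G r & T r <= tau * 2 ^+ n]].
(* The relative gap at height [2^n] will be [q^n]: summable because [q < 1], and with
   [(q^n)^(-4) = (2^n)^(4 kap)]. *)
pose q : R := 2 `^ (- kap).
have q0 : 0 < q by rewrite powR_gt0.
have q1 : q < 1.
  rewrite /q powRN invf_lt1 ?powR_gt0//.
  have := gt0_ltr_powR kap0 (_ : 1 \is Num.nneg) (_ : 2 \is Num.nneg).
  by rewrite powR1 !nnegrE; apply; lra.
(* [F 0] holds the countably many radii outside [G]. [F n.+1] is the interval just below
   [sup (A n)], of logarithmic measure at most [q^n]; if [A n] is unbounded, the default
   [sup (A n) = 0] makes it empty. *)
pose F n : set R := if n is m.+1 then
  `]0, +oo[ `&` `[sup (A m) / (1 + q ^+ m), sup (A m)] else `]0, +oo[ `\` G.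
have F0 n : F n `<=` `]0, +oo[%classic by case: n => [|n] r [].
have qn n : 0 < q ^+ n <= 1 by rewrite exprn_gt0// exprn_ile1// ltW.
exists (\bigcup_n F n); split.
- by move=> r [n _ /F0].
- have mF n : measurable (F n : set (measurableTypeR R)).
    case: n => [|n]; first exact: countable_measurable.
    by apply: measurableI; exact: measurable_itv.
  (* The constant [q^-1] corrects the shift of index: [F n.+1] has the bound [q^n]. *)
  apply: (finite_log_measure_bigcup (C := q^-1) (q := q)) => //.
  + by rewrite invr_ge0 ltW.
  + by rewrite q0.
  + case=> [|n].
      rewrite (null_set_integral (mF 0%N) (measurable_invr_pos (mF 0%N) (F0 0%N))).
        by rewrite lee_fin expr0 mulr1 invr_ge0 ltW.
      exact: countable_lebesgue_measure0.
    rewrite exprS mulKf ?gt_eqF//; apply: (log_measure_itv (x := sup (A n)) _ (mF n.+1) (F0 n.+1)).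
      by case/andP: (qn n) => /ltW.
    by move=> r [].
move=> r r0 rr nE.
have Gr : G r.
  by apply: contrapT => nG; apply: nE; exists 0%N => //; split => //=; rewrite in_itv/= r0.
have Tr := GT r rr Gr; have Tr0 : 0 < T r := lt_le_trans tau0 Tr.
have exn : exists n, T r <= tau * 2 ^+ n.
  exists (Num.bound (T r / tau)); rewrite mulrC -ler_pdivrMr//.
  rewrite (le_trans (ltW (archi_boundP _)))// ?divr_ge0 ?(ltW tau0) ?(ltW Tr0)//.
  by rewrite -natrX ler_nat ltnW// ltn_expl.
(* For [n > 0] minimality gives [tau 2^(n-1) < T r], hence [T s <= 2 T r] on [A n] and
   [2^n <= 2 T r / tau]; for [n = 0] both follow from [tau <= T r]. *)
have [n Tn minn] := ex_minnP exn.
(* If [A n] is bounded, [r] is in [A n] but not in [F n.+1], so [r (1 + q^n) < sup (A n)]; if it is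
   unbounded, a far enough point exists anyway. *)
have [s As rs] : exists2 s, A n s & r * (1 + q ^+ n) <= s.
  have Ar : A n r by [].
  have h1 : 0 < 1 + q ^+ n by case/andP: (qn n) => ? _; rewrite addr_gt0.
  have [hs|nhs] := pselect (has_sup (A n)).
    have rsup : r <= sup (A n) by apply: ub_le_sup => //; case: hs.
    have lt : r * (1 + q ^+ n) < sup (A n).
      rewrite -ltr_pdivlMr// ltNge; apply/negP => h; apply: nE; exists n.+1 => //.
      by split; rewrite /= in_itv/= ?r0// h.
    have [s As rs] := sup_gt (hs.1) lt; by exists s => //; exact: ltW.
  have [//|h] := pselect (exists2 s, A n s & r * (1 + q ^+ n) <= s).
  case: nhs; split; first by exists r.
  exists (r * (1 + q ^+ n)) => s As; apply/ltW; rewrite ltNge; apply/negP => rs.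
  by apply: h; exists s.
exists s, (q ^+ n); case: As => s0 Gs Ts; split => //.
  case: n Tn minn rs Ts {qn} => [|n] Tn minn rs Ts; first by rewrite expr0 in Ts; lra.
  have : ~~ (T r <= tau * 2 ^+ n) by apply/negP => /minn; rewrite ltnn.
  by rewrite -ltNge; move: Ts; rewrite exprS; lra.
split => //.
have E : ((q ^+ n) ^+ 4)^-1 = (2 ^+ n) `^ (4 * kap) :> R.
  rewrite -exprM -powR_invn ?(ltW q0)// /q -powRrM -(powR_mulrn n (ler0n R 2)) -powRrM.
  by congr (_ `^ _); rewrite natrM; ring.
have t0 : 0 <= 2 * T r / tau by rewrite divr_ge0 ?(ltW tau0)// mulr_ge0// ltW.
rewrite E; apply: ge0_ler_powR.
- by rewrite mulr_ge0// ltW.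
- by rewrite nnegrE exprn_ge0.
- by rewrite nnegrE.
rewrite ler_pdivlMr// mulrC.
case: n Tn minn {rs Ts E} => [|n] Tn minn; first by rewrite expr0; lra.
have : ~~ (T r <= tau * 2 ^+ n) by apply/negP => /minn; rewrite ltnn.
by rewrite -ltNge exprS; lra.
Qed.

End BorelGrowth.

(** * Choice of the radius and conclusion *)

Section Assembly.
Context {R : realType}.
Variable f : R[i] -> R[i].
Hypothesis mf : meromorphic f.

(** Each disc of integer radius has finitely many poles, and a bad [r] is [|z| - a] for some pole
    [z]. *)
Lemma countable_not_generic (a : R) :
  countable (`]0, +oo[%classic `\` [set r | generic f (r + a)]).
Proof.
have /choice[s Hs] : forall n : nat, exists s : seq R[i],
    forall z, (z \in s) = (normc z <= n%:R) && (pole_mult f z != 0%N).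
  by move=> n; have [s [_ Hs]] := finite_poles n%:R mf; exists s.
apply: (@sub_countable _ _ _ (\bigcup_n [set normc z - a | z in [set` s n]])).
  apply: subset_card_le => r [_ /existsNP[z /not_implyP[zr pz]]].
  exists (Num.bound (r + a)) => //; exists z; last by rewrite zr addrK.
  rewrite /= Hs zr; apply/andP; split; last exact/eqP.
  by apply/ltW/archi_boundP; rewrite -zr normc_ge0.
apply: bigcup_countable => // n _.
by apply: finite_set_countable; apply: finite_image; exact: finite_seq.
Qed.

Lemma proximity_quotient_growth (c : R[i]) (d eps : R) : (~ exists a, forall z, f z = a) ->
  c != 0 -> 0 < d < 1 -> 0 < eps -> exists (E : set R) (K r1 : R),
    [/\ E `<=` `]0, +oo[%classic, finite_log_measure E, 0 <= K & forall r, r1 <= r -> ~ E r ->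
      0 < characteristic (r + normc c) f /\ proximity r (fun z => f (z + c) / f z) <=
      K * r `^ (- d) * characteristic (r + normc c) f `^ (1 + eps)].
Proof.
move=> nf c0 hd eps0; have [z0 [pz0 fz0]] := exists_nonzero_regular mf nf.
have [K1 [K2 [K10 K20 H]]] := proximity_quotient_bound mf c0 hd pz0 fz0.
have [rho0 Hlb] := characteristic_lb mf nf.
pose a := normc c; have a0 : 0 <= a := normc_ge0 c.
pose T r := characteristic (r + a) f.
have tau0 : 0 < 3^-1 :> R by rewrite invr_gt0.
(* With [kap = eps / 4] the factor [h^(-4)] costs exactly a multiple of [T^eps]. *)
have kap0 : 0 < eps / 4 by rewrite divr_gt0.
have GT r : rho0 <= r -> generic f (r + a) -> 3^-1 <= T r.
  by move=> h; apply: Hlb; lra.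
have [E [E0 mE HE]] := borel_growth tau0 kap0 (countable_not_generic a) GT.
(* [256 = 4^4] comes from [eta = h / 4], [6 = 2 / tau] from [tau = 1/3], and [2 + 3 K2] from
   [T s <= 2 T r] and [1 <= 3 T r]. *)
pose L := K1 * 256%:R * 6%:R `^ eps * (2 + 3 * K2).
have L0 : 0 <= L by rewrite /L !mulr_ge0 ?powR_ge0// addr_ge0// mulr_ge0.
exists E, L, (Num.max rho0 (Num.max 1 (Num.max a (2 * normc z0 + 1)))); split => // r.
rewrite !ge_max => /and4P[r_rho r1 ra rz] Er.
have r0 : 0 < r by lra.
have [s [h [Gs /andP[h0 h1] rs Ts [Tr hT]]]] := HE r r0 r_rho Er.
have rh := mulr_ge0 (ltW r0) (ltW h0).
have he : 0 < h / 4 <= 1 by rewrite divr_gt0//=; lra.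
have sr : r <= s by lra.
(* Taking a quarter of [h] pays for the shift by [a <= r]: [s (1 - h/4) >= r (1 + h) (1 - h/4) >= r
   (1 + h/4)], as [h <= 1]. *)
have g : h / 4 * (s + a) <= s + a - (r + normc c).
  rewrite -/a; have := ler_wpM2l (_ : 0 <= h / 4) ra; have := ler_wpM2r (_ : 0 <= 1 - h / 4) rs.
  have := ler_wpM2l rh h1; case/andP: he => he1 he2.
  rewrite subr_ge0 (ltW he1) => i1 /(_ he2) i2 /(_ isT) i3; lra.
have z2 : 2 * normc z0 + 1 <= s + a by lra.
have [_ B] := H r (s + a) (h / 4) r1 he g z2 Gs.
have Tr0 : 0 < T r by lra.
split => //; apply: (le_trans B); rewrite -/(T s) -/a -/(T r).
have e4 : ((h / 4) ^+ 4)^-1 = 256%:R * (h ^+ 4)^-1.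
  by rewrite exprMn invfM exprVn invrK mulrC; congr (_ * _); ring.
have hT' : (h ^+ 4)^-1 <= 6%:R `^ eps * T r `^ eps.
  rewrite -powRM ?(ltW Tr0)//; apply: (le_trans hT).
  rewrite invrK (_ : 2 * T r * 3 = 6%:R * T r); last by ring.
  by rewrite (_ : 4 * (eps / 4) = eps)//; field.
have S : T s + K2 <= (2 + 3 * K2) * T r.
  have := ler_wpM2l K20 Tr; lra.
have -> : L * r `^ (- d) * T r `^ (1 + eps) =
    (K1 * (256%:R * (6%:R `^ eps * T r `^ eps)) * r `^ (- d)) * ((2 + 3 * K2) * T r).
  rewrite powRD ?(gt_eqF Tr0) ?implybT// powRr1 ?(ltW Tr0)// /L; ring.
rewrite e4; have p0 := powR_ge0 r (- d).
have hh : 0 <= (h ^+ 4)^-1 by rewrite invr_ge0 exprn_ge0// ltW.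
apply: (@le_trans _ _ (K1 * (256%:R * (h ^+ 4)^-1) * r `^ (- d) * ((2 + 3 * K2) * T r))).
  by apply: ler_wpM2l S; rewrite !mulr_ge0.
apply: ler_wpM2r; first by rewrite mulr_ge0 ?(ltW Tr0)// addr_ge0// mulr_ge0.
by apply: ler_wpM2r => //; apply: ler_wpM2l => //; apply: ler_wpM2l.
Qed.

Lemma proximity_quotient0 (r : R) : proximity r (fun z => f (z + 0) / f z) = 0.
Proof.
rewrite /proximity -/(rmean _) -[RHS](rmean_cst (0 : R)); apply: eq_rmean => t.
rewrite addr0; have [->|fz] := eqVneq (f (circ r t)) 0.
  by rewrite mul0r normc0 logp0.
by rewrite divff// normc1 /logp ln1 maxxx.
Qed.

End Assembly.

Theorem theorem2p1 (R : realType) (f : R[i] -> R[i]) (c : R[i])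
    (delta epsilon : R)
    (f_meromorphic : meromorphic f)
    (f_nonconstant : ~ exists a : R[i], forall z : R[i], f z = a)
    (delta_lt1 : delta < 1) (epsilon_gt0 : 0 < epsilon) :
  exists E : set R,
    [/\ E `<=` `]0, +oo[, finite_log_measure E &
        (fun r => proximity r (fun z => f (z + c) / f z))
        =o_ (infty_off E)
        (fun r => characteristic (r + normc c) f `^ (1 + epsilon)
                  / r `^ delta)].
Proof.
(* The Green estimates require [c != 0]. For [c = 0] the quotient is 1, or 0 at zeros of [f], and
   the proximity function vanishes. *)
have [c0|c0] := eqVneq c 0.
  exists set0; split => //.
    by split => //; rewrite integral_set0 ltry.
  apply/eqoP => e e0; near=> r; rewrite c0 proximity_quotient0 normr0.
  by rewrite mulr_ge0 ?(ltW e0).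
(* The entry 1/2 ensures [d > 0], since [delta] may be negative; the midpoint of [delta] and 1
   ensures [d > delta]. *)
pose d := Num.max (2^-1) ((1 + delta) / 2).
have hd : 0 < d < 1.
  by rewrite lt_max gt_max invr_gt0 ltr0n/=; apply/andP; split; lra.
have dd : 0 < d - delta.
  have : (1 + delta) / 2 <= d by rewrite le_max lexx orbT.
  lra.
have [E [K [r1 [E0 mE K0 H]]]] :=
  proximity_quotient_growth f_meromorphic f_nonconstant c0 hd epsilon_gt0.
exists E; split => //; apply/eqoP => e e0.
have : \forall r \near (pinfty_nbhs R), ~ E r ->
    `|proximity r (fun z => f (z + c) / f z)| <=
    e * `|characteristic (r + normc c) f `^ (1 + epsilon) / r `^ delta|.
  (* Beyond the last entry [K r^(-(d - delta)) <= e], so the spare power of [r] absorbs the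
     constant. *)
  exists (Num.max r1 (Num.max 1 ((K / e) `^ ((d - delta)^-1)))); split; first exact: num_real.
  move=> r; rewrite /= !gt_max => /and3P[rr r_1 rK] Er.
  have [T0 B] := H r (ltW rr) Er.
  have r0 : 0 < r by lra.
  rewrite ger0_norm ?proximity_ge0// ger0_norm ?divr_ge0 ?powR_ge0//.
  apply: (le_trans B).
  move: (_ `^ (1 + epsilon)) (powR_ge0 (characteristic (r + normc c) f) (1 + epsilon)) => C C0.
  have -> : r `^ (- d) = r `^ (- (d - delta)) / r `^ delta.
    by rewrite -powRN -powRD ?(gt_eqF r0) ?implybT//; congr (_ `^ _); lra.
  have Kr : K * r `^ (- (d - delta)) <= e.
    have Ke : 0 <= K / e by rewrite divr_ge0// ltW.
    rewrite powRN ler_pdivrMr ?powR_gt0// mulrC -ler_pdivrMr//.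
    have -> : K / e = (K / e) `^ ((d - delta)^-1) `^ (d - delta).
      by rewrite -powRrM mulVf ?gt_eqF// powRr1.
    by apply: ge0_ler_powR; rewrite ?nnegrE ?powR_ge0 ?(ltW dd) ?(ltW r0) ?(ltW rK).
  have := ler_wpM2r (divr_ge0 C0 (powR_ge0 r delta)) Kr.
  by congr (_ <= _); ring.
rewrite /infty_off /= near_withinE.
exact: id.
Unshelve. all: by end_near.
Qed.
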